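(* Let $1<Q<+\infty$. Suppose that $(X,d,\mu)$ is a complete, unbounded metric measure space with metric $d$ and Ahlfors $Q$-regular measure $\mu$ supporting a $Q$-Poincaré inequality. Let $c\in[-\infty,\infty]$. Then for every function $u\in\dot N^{1,Q}(X)$, the following are equivalent: I. There exists an infinite curve $\gamma\in\Gamma^{+\infty}$ such that $\lim_{t\to+\infty}u(\gamma(t))=c$. II. There is a thin set $E$ such that $\lim_{E\not\ni x\to+\infty}u(x)=c$. III. There is a thick set $F$ such that $\lim_{F\ni x\to+\infty}u(x)=c$. IV. There is a family $\Gamma$ of infinite curves such that $\lim_{t\to+\infty}u(\gamma(t))=c$ for each $\gamma\in\Gamma$, satisfying the following for all sufficiently large $R>0$: 1. $\mu(B(O,R)\cap|\Gamma|)\simeq\mu(A_R\cap|\Gamma|)\simeq\mu(B(O,R))$, 2. $\ell(\gamma\cap B(O,R))\simeq\ell(\gamma\cap A_R)\simeq R$ for each $\gamma\in\Gamma$, where $A_R:=B(O,R)\setminus B(O,R/2)$ and $|\Gamma|$ denotes the union of the trajectories of the curves in $\Gamma$. Furthermore, for every function $u\in\dot N^{1,Q}(X)$, there is at most one $c\in[-\infty,\infty]$ such that any of the conditions I, II, III, IV holds.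
   Context: A metric measure space $(X,d,\mu)$ is a separable metric space $(X,d)$ with a nontrivial locally finite Borel-regular measure $\mu$; for an arbitrary set $A$, $\mu(A):=\inf\{\mu(U):A\subset U,\ U\ \mu\text{-measurable}\}$. $B(x,r)$ is the ball of center $x$ and radius $r$. $\mu$ is Ahlfors $Q$-regular if there is a constant $C_Q\ge1$ with $r^Q/C_Q\le\mu(B(x,r))\le C_Qr^Q$ for all $x\in X$, $r>0$. Upper gradient: a Borel function $\rho:X\to[0,+\infty]$ is an upper gradient of a locally integrable function $u$ if $|u(x)-u(y)|\le\int_\gamma\rho\,ds$ for every rectifiable curve $\gamma$ connecting $x$ and $y$ (for all $x,y\in X$). $\dot N^{1,Q}(X)$ is the collection of all locally integrable functions on $X$ (defined pointwise everywhere) that have a $Q$-integrable upper gradient on $X$. $Q$-Poincaré inequality: every ball has finite positive measure and there are finite constants $C>0$, $\lambda\ge1$ such that $\frac1{\mu(B(x,r))}\int_{B(x,r)}|u-u_{B(x,r)}|\,d\mu\le Cr\left(\frac1{\mu(B(x,\lambda r))}\int_{B(x,\lambda r)}\rho^Q\,d\mu\right)^{1/Q}$ for all balls $B(x,r)$ and all pairs $(u,\rho)$ with $u$ integrable on balls and $\rho$ an upper gradient of $u$, where $u_A=\frac1{\mu(A)}\int_Au\,d\mu$. A base point $O\in X$ is fixed, $|x|:=d(O,x)$, and $x\to+\infty$ means $|x|\to+\infty$; limits with $E\not\ni x\to+\infty$ (resp. $F\ni x\to+\infty$) are taken along $x\in X\setminus E$ (resp. $x\in F$). Infinite curve: a locally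 rectifiable curve $\gamma:[0,+\infty)\to X$, parametrized by arc length, such that $\gamma\setminus B\ne\emptyset$ for all balls $B$. $\Gamma^{+\infty}$ is the collection of all infinite curves. $\ell$ denotes length ($\ell(\gamma\cap A)$ is the length of the part of $\gamma$ lying in $A$). Hausdorff content: for $\beta\ge0$, $\mathcal H^\beta_{+\infty}(E)=\inf\{\sum_kr_k^\beta: E\subset\bigcup_kB_k,\ B_k \text{ a ball of radius } r_k\in(0,+\infty)\}$ (countable covers). For $C\ge1$, $A_{C2^{j+1}}:=B(O,C2^{j+2})\setminus B(O,C2^{j+1})$. Thin set (i.e. $Q$-thin): $E\subset X$ such that there is a finite constant $C\ge1$ with $\lim_{k\to+\infty}\sum_{j=k}^{+\infty}\frac{\mathcal H^{\alpha}_{+\infty}(E\cap A_{C2^{j+1}})}{(C2^{j+1})^\alpha}=0$ for all $0<\alpha<Q$. Thick set: an unbounded set $F\subset X$ such that for every $0<\alpha<Q$ there are finite constants $\delta>0$, $k\in\mathbb N$ and $C\ge1$ with $\mathcal H^\alpha_{+\infty}(F\cap A_{C2^{j+1}})\ge\delta(2^{j+1})^\alpha$ for all $j\ge k$. $A\simeq B$ means $C^{-1}B\le A\le CB$ for a constant $C>0$ depending only on the structural constants (associated with, for example, the Ahlfors regularity or the Poincaré inequality); in particular $C$ is independent of $R$ and $\gamma$. *)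

(* Defs.v *)
From HB Require Import structures.
From mathcomp Require Import all_boot all_order all_algebra.
From mathcomp Require Import all_classical all_reals all_analysis measurable_realfun.

Set Implicit Arguments.
Unset Strict Implicit.
Unset Printing Implicit Defensive.

Import Order.TTheory GRing.Theory Num.Theory.
Import numFieldNormedType.Exports.

Local Open Scope classical_set_scope.
Local Open Scope ring_scope.

#[short(type="completeMetricType")]
HB.structure Definition CompleteMetric (R : numDomainType) :=
  {T of CompletePseudoMetric R T & Metric R T}.

Section metric_notions.
Context {R : realType} {X : completeMetricType R}.
Implicit Types (A E F : set X) (O : X) (gamma : R -> X) (a b t : R).

Definition borel A : Prop := <<s @open X >> A.

Definition unbounded_set A : Prop :=
  forall (x : X) (r : R), exists2 y, A y & ~ ball x r y.

(* The filter of neighbourhoods of infinity: |x| = d(O, x) tends to +oo. *)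
Definition at_infinity O : set_system X :=
  [set A | exists M : R, forall x, M < mdist O x -> A x].

Global Instance at_infinity_filter O : Filter (at_infinity O).
Proof.
split; first by exists 0.
- move=> A B [M AM] [N BN]; exists (Num.max M N) => x.
  by rewrite gt_max => /andP[Mx Nx]; split; [exact: AM|exact: BN].
- by move=> A B AB [M AM]; exists M => x /AM /AB.
Qed.

(* Length of the restriction of gamma to [a, b], for a <= b. *)
Definition curve_length gamma a b : \bar R :=
  ereal_sup [set (\sum_(0 <= n < size s)
      mdist (gamma (nth b (a :: s) n)) (gamma (nth b (a :: s) n.+1)))%:E
    | s in itv_partition a b].

Definition rectifiable_curve gamma a b : Prop :=
  [/\ a <= b, {within `[a, b], continuous gamma}
    & (curve_length gamma a b < +oo)%E].

(* Arc length parametrization of the rectifiable curve gamma on [a, b]: for s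
   in [0, length], the common value of gamma at the parameters t such that
   the length of gamma on [a, t] is s; it does not depend on the choice. *)
Definition arclength_param gamma a b (s : R) : X :=
  gamma (xget a [set t | a <= t <= b /\ curve_length gamma a t = s%:E]).

Definition line_integral (rho : X -> \bar R) gamma a b : \bar R :=
  (\int[lebesgue_measure]_(s in `[0%R, fine (curve_length gamma a b)])
     rho (arclength_param gamma a b s))%E.

Definition upper_gradient (u : X -> R) (rho : X -> \bar R) : Prop :=
  [/\ forall x, (0 <= rho x)%E,
      measurable_fun setT (rho : g_sigma_algebraType (@open X) -> \bar R)
    & forall gamma a b, rectifiable_curve gamma a b ->
        (`|u (gamma a) - u (gamma b)|%:E <= line_integral rho gamma a b)%E].

(* A curve [0, +oo) -> X is a function on R of which only the values on
   [0, +oo) are used. Parametrization by arc length makes every restriction to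
   a compact interval of finite length, hence entails local rectifiability. *)
Definition infinite_curve gamma : Prop :=
  [/\ {within `[0%R, +oo[, continuous gamma},
      forall t, 0 <= t -> curve_length gamma 0 t = t%:E
    & unbounded_set (gamma @` `[0%R, +oo[)].

(* Length of the part in A of a curve on [0, +oo) parametrized by arc length,
   i.e. the integral of the indicator function of A along gamma. *)
Definition length_in gamma A : \bar R :=
  lebesgue_measure (`[0%R, +oo[ `&` gamma @^-1` A).

Definition trajectories (Gam : set (R -> X)) : set X :=
  \bigcup_(gamma in Gam) (gamma @` `[0%R, +oo[).

(* Countable (finite or infinite) covers are indexed by a set J of naturals. *)
Definition hausdorff_content (beta : R) E : \bar R :=
  ereal_inf [set v | exists (J : set nat) (x : nat -> X) (r : nat -> R),
    [/\ forall k, J k -> 0 < r k,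
        E `<=` \bigcup_(k in J) ball (x k) (r k)
      & v = (\esum_(k in J) (r k `^ beta)%R%:E)%E]].

(* B(O, 2 r) minus B(O, r), which for r = C 2^(j+1) is the annulus used in the
   definitions of thin and thick sets. *)
Definition outer_annulus O (r : R) : set X := ball O (2 * r) `\` ball O r.

(* B(O, r) minus B(O, r / 2), the annulus used for families of curves. *)
Definition inner_annulus O (r : R) : set X := ball O r `\` ball O (r / 2).

Definition thin (Q : R) O E : Prop :=
  exists2 C : R, 1 <= C & forall alpha : R, 0 < alpha < Q ->
    (fun k : nat => \sum_(k <= j <oo)
       (hausdorff_content alpha (E `&` outer_annulus O (C * 2 ^+ j.+1))
        * (((C * 2 ^+ j.+1) `^ alpha)%R^-1)%:E))%E @ \oo --> 0%E.

Definition thick (Q : R) O F : Prop :=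
  unbounded_set F /\
  forall alpha : R, 0 < alpha < Q ->
    exists (delta : R) (k : nat) (C : R), [/\ 0 < delta, 1 <= C &
      forall j : nat, (k <= j)%N ->
        ((delta * (2 ^+ j.+1) `^ alpha)%R%:E <=
         hausdorff_content alpha (F `&` outer_annulus O (C * 2 ^+ j.+1)))%E].

(* x and y are comparable with constant K; for families of curves, K is to be
   chosen before the space and depends only on the structural constants. *)
Definition comparable_upto (K : R) (x y : \bar R) : Prop :=
  (K^-1%:E * y <= x)%E /\ (x <= K%:E * y)%E.

End metric_notions.

Section measure_notions.
Context {R : realType} {X : completeMetricType R}.
Variable mu : {outer_measure set X -> \bar R}.
Implicit Types (A : set X) (u : X -> R) (rho : X -> \bar R).

(* A Borel-regular measure is an outer measure for which Borel sets are
   measurable (in the sense of Caratheodory) and every set is contained in a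
   Borel set of the same measure. *)
Definition borel_regular : Prop :=
  (forall B, borel B -> mu.-cara.-measurable B) /\
  (forall A, exists B, [/\ borel B, A `<=` B & mu B = mu A]).

(* mu as a measure on the sigma-algebra of mu-measurable sets. *)
Definition cmeasure : {measure set (caratheodory_type mu) -> \bar R} :=
  (mu : set (caratheodory_type mu) -> \bar R).

Lemma borel_regular_ereal_inf A : borel_regular ->
  mu A = ereal_inf [set mu U | U in [set U | A `<=` U /\ mu.-cara.-measurable U]].
Proof.
move=> [mB rB]; apply/eqP; rewrite eq_le; apply/andP; split.
  by apply: le_ereal_inf_tmp => _ [U [AU _] <-]; exact: le_outer_measure.
have [B [bB AB <-]] := rB A.
by apply: ereal_inf_lbound; exists B => //; split => //; exact: mB.
Qed.

Record metric_measure_space : Prop := MetricMeasureSpace {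
  mms_separable : exists2 S : set X, countable S & dense S ;
  mms_nontrivial : (0 < mu setT)%E ;
  mms_locally_finite : forall x : X,
    exists2 r : R, 0 < r & (mu (ball x r) < +oo)%E ;
  mms_borel_regular : borel_regular }.

Definition ahlfors_regular (Q CQ : R) : Prop :=
  forall (x : X) (r : R), 0 < r ->
    ((r `^ Q / CQ)%R%:E <= mu (ball x r) <= (CQ * r `^ Q)%R%:E)%E.

Definition integrable_on A u : Prop := cmeasure.-integrable A (EFin \o u).

Definition locally_integrable_fun u : Prop :=
  forall x : X, exists2 r : R, 0 < r & integrable_on (ball x r) u.

Definition mean A (f : X -> \bar R) : \bar R :=
  ((mu A)^-1 * \int[cmeasure]_(y in A) f y)%E.

Definition poincare (Q CP lam : R) : Prop :=
  (forall (x : X) (r : R), 0 < r -> (0 < mu (ball x r) < +oo)%E) /\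
  (forall u rho,
    (forall (x : X) (r : R), 0 < r -> integrable_on (ball x r) u) ->
    upper_gradient u rho ->
    forall (x : X) (r : R), 0 < r ->
      (mean (ball x r) (fun y => `|(u y)%:E - mean (ball x r) (EFin \o u)|) <=
       (CP * r)%R%:E *
         (mean (ball x (lam * r)) (fun y => rho y `^ Q)) `^ (Q^-1)%R)%E).

(* The homogeneous Newtonian space; functions are real-valued and defined at
   every point. *)
Definition homogeneous_newtonian (Q : R) u : Prop :=
  locally_integrable_fun u /\
  exists2 rho, upper_gradient u rho &
    (\int[cmeasure]_x (rho x `^ Q) < +oo)%E.

End measure_notions.

Section limits_at_infinity.
Context {R : realType} {X : completeMetricType R}.
Variables (O : X) (u : X -> R) (c : \bar R).

Definition limit_along_curve (gamma : R -> X) : Prop :=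
  (u (gamma t))%:E @[t --> +oo%R] --> c.

Definition limit_along_set (F : set X) : Prop :=
  (u x)%:E @[x --> within F (at_infinity O)] --> c.

Definition limit_some_curve : Prop :=
  exists2 gamma : R -> X, infinite_curve gamma & limit_along_curve gamma.

Definition limit_off_thin_set (Q : R) : Prop :=
  exists2 E : set X, thin Q O E & limit_along_set (~` E).

Definition limit_on_thick_set (Q : R) : Prop :=
  exists2 F : set X, thick Q O F & limit_along_set F.

Definition limit_curve_family (mu : {outer_measure set X -> \bar R}) (K : R) :
    Prop :=
  exists Gam : set (R -> X),
  [/\ forall gamma, Gam gamma -> infinite_curve gamma,
      forall gamma, Gam gamma -> limit_along_curve gamma
    & \forall r \near +oo%R,
      [/\ comparable_upto K (mu (ball O r `&` trajectories Gam))
                            (mu (inner_annulus O r `&` trajectories Gam)),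
          comparable_upto K (mu (inner_annulus O r `&` trajectories Gam))
                            (mu (ball O r))
        & forall gamma, Gam gamma ->
            comparable_upto K (length_in gamma (ball O r))
                              (length_in gamma (inner_annulus O r)) /\
            comparable_upto K (length_in gamma (inner_annulus O r)) r%:E]].

End limits_at_infinity.

(* Main.v *)
Require Import Defs.
From HB Require Import structures.
From mathcomp Require Import all_boot all_order all_algebra.
From mathcomp Require Import all_classical all_reals all_analysis measurable_realfun.
From mathcomp Require Import ring lra zify.

(* Let h be a lower semicontinuous majorant in L^Q of an upper gradient of u
   (Vitali-Caratheodory). At scale 2^j call x good if, for all i, the energy of
   h in the ball of radius comparable to 2^(j-i) around x, away from O, is at
   most theta_j (i+1)^(-2Q). Two good points x, y of neighbouring annuli are
   joined by a curve of g-length at most 1/2, where g = max (Lambda h, penalty):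
   for a Lipschitz approximation of g, the infimum of the g-length over chains
   of points from x is a continuous function with that approximation as upper
   gradient, so that telescoping the Poincare inequality over dyadic balls
   around x and y bounds its value at y; a limit of chains is then the curve.
   The penalty is of order 1/(m |z|). As Q > 1, its energy in a ball of depth
   2^-m is small for m large, but going from radius 1 to radius 2^-m costs more
   than 1/2, so that the curve stays away from O. Hence u oscillates along the
   curve by at most 1/Lambda, which tends to 0 with theta_j.
   Covering by maximal separated families, the bad points of the j-th annulus
   have normalized content at most a constant times the local energy over
   theta_j; for theta_j the square root of the tail of the energy, the sum over
   j telescopes, so that the set E of bad points is thin. Each of the conditions
   is equivalent to: u tends to c off E. Indeed an infinite curve and a thick
   set have too much content in the annuli to be contained in E there, and
   conversely the curves joining good points of successive annuli are
   concatenated into infinite curves, one through each good point. *)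

Set Implicit Arguments.
Unset Strict Implicit.
Unset Printing Implicit Defensive.

Import Order.TTheory GRing.Theory Num.Theory.
Import numFieldNormedType.Exports.

Local Open Scope classical_set_scope.
Local Open Scope ring_scope.

(** * Length of curves and arc length parametrization *)

Section curve_length.
Context {R : realType} {X : completeMetricType R}.
Implicit Types (gamma : R -> X) (a b c t : R) (s : seq R).

(** Curves arise as limits of discrete chains, not through moduli of curve families. A chain
    potential is Lipschitz by construction, so its averages over shrinking balls converge at every
    point and the Poincare inequality yields estimates at each good point, without an exceptional
    null set. Lower semicontinuity of the weight lets bounds for its Lipschitz approximations pass
    to the weight along a fixed curve, by monotone convergence.

    The levels pull both ways: theta_j has to tend to 0 for the oscillation to vanish, but slowly
    enough for the contents of the bad sets to be summable. Energy near O would be charged again at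
    every scale and spoil this summation, so it is left out; the price is that the curves must be
    kept away from O, whence the penalty. Its depth m is fixed by Q and the constants of regularity
    and of the Poincare inequality alone, and so is the comparability constant of the curve family,
    which has to precede the space. Staying away from O also bounds lengths: on a concatenated curve
    the piece at scale j avoids a ball of radius of order 2^j, and the pieces up to it have total
    length of order 2^j. *)

Fixpoint polygon_length gamma a s : R :=
  if s is x :: s' then mdist (gamma a) (gamma x) + polygon_length gamma x s'
  else 0.

Lemma polygon_lengthE gamma a b s :
  \sum_(0 <= n < size s)
     mdist (gamma (nth b (a :: s) n)) (gamma (nth b (a :: s) n.+1)) =
  polygon_length gamma a s.
Proof.
elim: s a => [|x s ih] a; first by rewrite big_geq.
by rewrite big_nat_recl//= -(ih x).
Qed.

Lemma polygon_length_cat gamma a s s2 :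
  polygon_length gamma a (s ++ s2) =
  polygon_length gamma a s + polygon_length gamma (last a s) s2.
Proof. by elim: s a => [|x s ih] a /=; rewrite ?add0r// ih addrA. Qed.

Lemma curve_length_sup gamma a b : curve_length gamma a b =
  ereal_sup [set (polygon_length gamma a s)%:E | s in itv_partition a b].
Proof.
rewrite /curve_length; congr ereal_sup; apply/seteqP; split => _ [s sab <-];
  by exists s => //; rewrite polygon_lengthE.
Qed.

Lemma polygon_length_le gamma a b s :
  path <=%R a s -> last a s = b ->
  ((polygon_length gamma a s)%:E <= curve_length gamma a b)%E.
Proof.
move=> pas lab; rewrite curve_length_sup.
suff [t [pt lt ->]] : exists t : seq R, [/\ path <%R a t, last a t = b &
    polygon_length gamma a s = polygon_length gamma a t].
  by apply: ereal_sup_ubound; exists t => //; split=> //; apply/eqP.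
elim: s a pas lab => [|x s ih] a /=; first by exists [::].
move=> /andP[ax pxs] lb; have [t [pt lt e]] := ih _ pxs lb.
move: ax; rewrite le_eqVlt => /predU1P[->|ax].
  by exists t; rewrite mdistxx add0r.
by exists (x :: t); rewrite /= ax pt e.
Qed.

Lemma curve_length_ub gamma a b (l : \bar R) :
  (forall s, path <%R a s -> last a s = b ->
    ((polygon_length gamma a s)%:E <= l)%E) ->
  (curve_length gamma a b <= l)%E.
Proof.
move=> H; rewrite curve_length_sup; apply: ge_ereal_sup => _ [s [ps /eqP ls] <-].
exact: H.
Qed.

Lemma curve_length_ge_mdist gamma a b : a <= b ->
  ((mdist (gamma a) (gamma b))%:E <= curve_length gamma a b)%E.
Proof.
move=> ab; have := @polygon_length_le gamma a b [:: b].
by rewrite /= ab addr0; exact.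
Qed.

Lemma curve_length_ge0 gamma a b : a <= b -> (0 <= curve_length gamma a b)%E.
Proof.
by move=> ab; apply: le_trans (curve_length_ge_mdist _ ab); rewrite lee_fin mdist_ge0.
Qed.

Lemma curve_lengthxx gamma a : curve_length gamma a a = 0%E.
Proof.
apply/eqP; rewrite eq_le curve_length_ge0// andbT.
apply: curve_length_ub => s ps ls.
have /itv_partitionxx -> // : itv_partition a a s by split=> //; apply/eqP.
Qed.

Lemma curve_length_prepend gamma a x b : a <= x ->
  ((mdist (gamma a) (gamma x))%:E + curve_length gamma x b <=
   curve_length gamma a b)%E.
Proof.
move=> ax; rewrite -leeBrDl//; apply: curve_length_ub => s ps ls.
rewrite leeBrDl// -EFinD; apply: (@polygon_length_le _ _ _ (x :: s)) => //=.
by rewrite ax/=; apply: sub_path ps => ? ?; exact: ltW.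
Qed.

Lemma curve_lengthD gamma a b c : a <= b -> b <= c ->
  curve_length gamma a c =
  (curve_length gamma a b + curve_length gamma b c)%E.
Proof.
move=> ab bc; apply/eqP; rewrite eq_le; apply/andP; split.
  apply: curve_length_ub => s ps ls.
  have {}ps : path <=%R a s by apply: sub_path ps => ? ?; exact: ltW.
  elim: s a ab ps ls => [|x s ih] a ab /=.
    by move=> _ ac; rewrite adde_ge0 ?curve_length_ge0.
  move=> /andP[ax ps] ls; have [xb|bx] := leP x b.
    apply: le_trans (leeD (curve_length_prepend gamma b ax) (le_refl _)).
    by rewrite EFinD -addeA leeD2l//; exact: ih.
  apply: (@le_trans _ _ ((mdist (gamma a) (gamma b))%:E +
                         (polygon_length gamma b (x :: s))%:E)%E).
    by rewrite -EFinD lee_fin/= addrA lerD2r metric_triangle.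
  rewrite leeD ?curve_length_ge_mdist//.
  by apply: polygon_length_le => //=; rewrite (ltW bx).
have H s : path <%R a s -> last a s = b ->
    ((polygon_length gamma a s)%:E + curve_length gamma b c <=
     curve_length gamma a c)%E.
  move=> ps ls; rewrite -leeBrDl//; apply: curve_length_ub => t pt lt.
  rewrite leeBrDl// -EFinD -{1}ls -polygon_length_cat.
  apply: polygon_length_le; last by rewrite last_cat ls.
  by rewrite cat_path ls; apply/andP; split;
    [apply: sub_path ps|apply: sub_path pt] => ? ?; exact: ltW.
(* Subtraction is legitimate for a finite length only; if the second piece is infinitely long, so is
   the whole. *)
have [fin|] := boolP (curve_length gamma b c \is a fin_num).
  rewrite -leeBrDr//; apply: curve_length_ub => s ps ls.
  by rewrite leeBrDr//; exact: H.
rewrite ge0_fin_numE ?curve_length_ge0// ltey negbK => /eqP bcy.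
suff -> : curve_length gamma a c = +oo%E by rewrite leey.
move: ab; rewrite le_eqVlt => /predU1P[->//|ab].
by have := H [:: b]; rewrite /= ab bcy => /(_ isT erefl); rewrite addey// leye_eq => /eqP.
Qed.

Lemma curve_length_le gamma a a' b' b : a <= a' -> a' <= b' -> b' <= b ->
  (curve_length gamma a' b' <= curve_length gamma a b)%E.
Proof.
move=> aa ab bb.
rewrite (@curve_lengthD _ a a' b)// ?(le_trans ab)//.
rewrite (@curve_lengthD _ a' b' b)//.
apply: (@le_trans _ _ (curve_length gamma a' b' + curve_length gamma b' b)%E).
  by rewrite leeDl// curve_length_ge0.
by rewrite leeDr// curve_length_ge0.
Qed.

Lemma curve_length_fin gamma a a' b' b : a <= a' -> a' <= b' -> b' <= b ->
  (curve_length gamma a b < +oo)%E -> curve_length gamma a' b' \is a fin_num.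
Proof.
move=> aa ab bb fin; rewrite ge0_fin_numE ?curve_length_ge0//.
exact: le_lt_trans (curve_length_le _ aa ab bb) fin.
Qed.

Lemma within_continuous_mdist gamma (A : set R) t : {within A, continuous gamma} ->
  A t -> forall e, 0 < e -> exists2 r, 0 < r &
  forall t', A t' -> `|t - t'| < r -> mdist (gamma t) (gamma t') < e.
Proof.
move=> /subspace_continuousP cg At e e0.
have : nbhs (gamma t) (ball (gamma t) e) by exact: nbhsx_ballx.
move=> /(cg t At); rewrite /within/= => -[r /= r0 H].
by exists r => // t' At' tt'; have := H t' tt' At'; rewrite ballEmdist.
Qed.

Lemma curve_length_approx gamma a b (e : R) : 0 < e ->
  curve_length gamma a b \is a fin_num -> exists s, [/\ path <%R a s, last a s = b &
  (curve_length gamma a b < (polygon_length gamma a s + e)%:E)%E].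
Proof.
rewrite curve_length_sup => e0 fin.
have [_ [s [ps /eqP ls] <-]] := ub_ereal_sup_adherent e0 fin.
by rewrite lteBlDr// => H; exists s; rewrite EFinD.
Qed.

(** Right continuity of the length. A polygon almost as long as the curve on [t, b] loses less than
    e / 2 when its first vertex is moved to a nearby t', which leaves less than e for the piece
    between t and t'. *)
Lemma curve_length_right gamma a b t (e : R) : rectifiable_curve gamma a b ->
  a <= t < b -> 0 < e ->
  exists t', [/\ t < t', t' <= b & (curve_length gamma t t' < e%:E)%E].
Proof.
move=> [ab cg fin] /andP[at_ tb] e0.
have fint : curve_length gamma t b \is a fin_num.
  exact: curve_length_fin (ltW tb) (lexx _) fin.
have e20 : 0 < e / 2 by rewrite divr_gt0.
have tab : `[a, b]%classic t by rewrite /= in_itv/= at_ ltW.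
have [r r0 Hr] := within_continuous_mdist cg tab e20.
have [[|x s] [ps ls Hs]] := curve_length_approx e20 fint.
  by move: tb; rewrite -ls /= ltxx.
have /andP[/= tx pxs] := ps.
have xb : x <= b by apply: (@itv_partition_le _ _ x b s); split=> //; apply/eqP.
pose t' := t + Num.min (r / 2) (x - t).
have tt' : t < t' by rewrite ltrDl lt_min divr_gt0//= subr_gt0.
have t'x : t' <= x by rewrite /t' -lerBrDl ge_min lexx orbT.
have t'b : t' <= b := le_trans t'x xb.
have dtt' : mdist (gamma t) (gamma t') < e / 2.
  apply: Hr; first by rewrite /= in_itv/= (le_trans at_ (ltW tt')).
  rewrite distrC gtr0_norm ?subr_gt0// /t' addrC addKr gt_min.
  by rewrite gtr_pMr// invf_lt1// ltr1n.
exists t'; split => //.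
have ft' : curve_length gamma t' b \is a fin_num.
  by apply: curve_length_fin fin => //; rewrite (le_trans at_ (ltW tt')).
have ftt' : curve_length gamma t t' \is a fin_num.
  by apply: curve_length_fin fin => //; exact: ltW.
have le1 : ((mdist (gamma t') (gamma x) + polygon_length gamma x s)%:E <=
    curve_length gamma t' b)%E.
  apply: (@polygon_length_le _ _ _ (x :: s)) => //=.
  by rewrite t'x/=; apply: sub_path pxs => ? ?; exact: ltW.
move: Hs le1; rewrite (@curve_lengthD _ t t' b) ?(ltW tt')//.
rewrite -(fineK ft') -(fineK ftt') -EFinD !lee_fin !lte_fin /=.
have := metric_triangle (gamma t) (gamma t') (gamma x).
by move: dtt'; lra.
Qed.

Lemma curve_length_left gamma a b t (e : R) : rectifiable_curve gamma a b ->
  a < t <= b -> 0 < e ->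
  exists t', [/\ a <= t', t' < t & (curve_length gamma t' t < e%:E)%E].
Proof.
move=> [ab cg fin] /andP[at_ tb] e0.
have fint : curve_length gamma a t \is a fin_num.
  exact: curve_length_fin (ltW at_) tb fin.
have e20 : 0 < e / 2 by rewrite divr_gt0.
have tab : `[a, b]%classic t by rewrite /= in_itv/= tb ltW.
have [r r0 Hr] := within_continuous_mdist cg tab e20.
have [s [ps ls Hs]] := curve_length_approx e20 fint.
move: s ps ls Hs => /lastP[|s x]; first by move=> _ /= ta; move: at_; rewrite ta ltxx.
rewrite last_rcons -cats1 cat_path/= andbT => /andP[ps pt] xt.
rewrite {}xt in pt *; rewrite polygon_length_cat/= addr0.
set p := last a s in pt * => Hs.
have ap : a <= p by apply: (@itv_partition_le _ _ a p s); split=> //; apply/eqP.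
have le1 : ((polygon_length gamma a s)%:E <= curve_length gamma a p)%E.
  by apply: polygon_length_le => //; apply: sub_path ps => ? ?; exact: ltW.
pose t' := Num.max p (t - r / 2).
have t't : t' < t by rewrite gt_max pt/= ltrBlDr ltrDl divr_gt0.
have pt' : p <= t' by rewrite le_max lexx.
have dtt' : mdist (gamma t) (gamma t') < e / 2.
  apply: Hr.
    by rewrite /= in_itv/= (le_trans ap pt')/= (le_trans (ltW t't)).
  rewrite gtr0_norm ?subr_gt0// ltrBlDr -ltrBlDl lt_max; apply/orP; right.
  by rewrite ltrD2l ltrN2 gtr_pMr// invf_lt1// ltr1n.
exists t'; split => //; first exact: le_trans pt'.
have fp : curve_length gamma a p \is a fin_num.
  by apply: curve_length_fin fin => //; rewrite (le_trans (ltW pt)).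
have fpt' : curve_length gamma p t' \is a fin_num.
  by apply: curve_length_fin fin => //; rewrite (le_trans (ltW t't)).
have ft't : curve_length gamma t' t \is a fin_num.
  apply: curve_length_fin fin => //; last exact: ltW.
  exact: le_trans pt'.
move: Hs le1 (curve_length_ge_mdist gamma pt').
rewrite (@curve_lengthD _ a p t) ?(ltW pt)// (@curve_lengthD _ p t' t) ?(ltW t't)//.
rewrite -(fineK fp) -(fineK fpt') -(fineK ft't) -!EFinD !lee_fin !lte_fin /=.
have := metric_triangle (gamma p) (gamma t') (gamma t).
by move: dtt'; rewrite (metric_sym (gamma t)); lra.
Qed.

(** At the supremum t of the parameters of length at most s, left continuity of the length excludes
    a value above s and right continuity a value below s. *)
Lemma curve_length_ivt gamma a b (s : R) : rectifiable_curve gamma a b ->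
  0 <= s -> (s%:E <= curve_length gamma a b)%E ->
  exists2 t, a <= t <= b & curve_length gamma a t = s%:E.
Proof.
move=> rg s0 sL; have [ab cg fin] := rg.
pose S := [set t | a <= t <= b /\ (curve_length gamma a t <= s%:E)%E].
have Sa : S a by rewrite /S/= lexx ab curve_lengthxx lee_fin.
have hS : has_sup S by split; [exists a | exists b => t [/andP[]]].
pose t := sup S.
have at_ : a <= t by exact: ub_le_sup (proj2 hS) _ Sa.
have tb : t <= b by apply: sup_le_ub (proj1 hS) _ => t' [/andP[]].
have ft : curve_length gamma a t \is a fin_num.
  exact: curve_length_fin fin.
have below t' : a <= t' -> t' < t -> (curve_length gamma a t' <= s%:E)%E.
  move=> at' t't; have [t2 [/andP[at2 t2b] H2] t't2] := sup_gt (proj1 hS) t't.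
  by apply: le_trans H2; apply: curve_length_le => //; exact: ltW.
have le_s : (curve_length gamma a t <= s%:E)%E.
  rewrite leNgt; apply/negP => slt.
  have {}at_ : a < t.
    rewrite lt_neqAle at_ andbT; apply/eqP => ate.
    by move: slt; rewrite -ate curve_lengthxx lte_fin ltNge s0.
  pose e := fine (curve_length gamma a t) - s.
  have e0 : 0 < e by rewrite subr_gt0 -lte_fin fineK.
  have [|t' [at' t't Ht]] := @curve_length_left _ _ _ t _ rg _ e0.
    by rewrite at_ tb.
  have ft' : curve_length gamma t' t \is a fin_num.
    by apply: curve_length_fin fin => //; exact: ltW.
  have fa' : curve_length gamma a t' \is a fin_num.
    by apply: curve_length_fin fin => //; exact: ltW (lt_le_trans t't tb).
  move: Ht (below _ at' t't); rewrite /e.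
  rewrite (@curve_lengthD _ a t' t) ?(ltW t't)//.
  by rewrite -(fineK ft') -(fineK fa') -EFinD !lte_fin lee_fin/=; lra.
exists t; first by rewrite at_ tb.
apply/eqP; rewrite eq_le le_s/= leNgt; apply/negP => ls.
have {}tb : t < b.
  rewrite lt_neqAle tb andbT; apply/eqP => tbe.
  by move: ls; rewrite tbe ltNge sL.
pose e := s - fine (curve_length gamma a t).
have e0 : 0 < e by rewrite subr_gt0 -lte_fin fineK.
have [|t' [tt' t'b Ht]] := @curve_length_right _ _ _ t _ rg _ e0.
  by rewrite at_ tb.
have ft' : curve_length gamma t t' \is a fin_num.
  by apply: curve_length_fin fin => //; exact: ltW.
move: Ht; rewrite -(fineK ft') lte_fin /e => H.
suff : S t' by move/(ub_le_sup (proj2 hS)); rewrite leNgt tt'.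
rewrite /S/= t'b (le_trans at_ (ltW tt')); split => //.
rewrite (@curve_lengthD _ a t t') ?(ltW tt')//.
by rewrite -(fineK ft') -(fineK ft) -EFinD lee_fin; lra.
Qed.

Lemma arclength_paramP gamma a b (s : R) : rectifiable_curve gamma a b ->
  0 <= s <= fine (curve_length gamma a b) ->
  exists t, [/\ a <= t <= b, curve_length gamma a t = s%:E &
    arclength_param gamma a b s = gamma t].
Proof.
move=> rg /andP[s0 sL]; have [ab _ fin] := rg.
have fL : curve_length gamma a b \is a fin_num by exact: curve_length_fin fin.
have [|t tab ts] := curve_length_ivt rg s0; first by rewrite -(fineK fL) lee_fin.
rewrite /arclength_param; case: xgetP => [t' _ [t'ab t's]|]; first by exists t'.
by move=> /(_ t) []; split.
Qed.

(** The parameters need not come in the order of their lengths: if t' precedes t, the two lengths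
    coincide and the piece between has length zero. The case s = s' makes [arclength_param]
    independent of the chosen parameter. *)
Lemma curve_length_eq_mdist gamma a t t' (s s' : R) : a <= t -> a <= t' ->
  curve_length gamma a t = s%:E -> curve_length gamma a t' = s'%:E ->
  s <= s' -> mdist (gamma t) (gamma t') <= s' - s.
Proof.
move=> at_ at' ts t's ss.
have [tt'|/ltW t't] := leP t t'.
  have := curve_length_ge_mdist gamma tt'.
  move: t's; rewrite (@curve_lengthD _ a t t')// ts.
  case: (curve_length gamma t t') => [r|//|//]; rewrite -EFinD => -[<-].
  by rewrite lee_fin => ?; rewrite addrC addKr.
have := curve_length_ge_mdist gamma t't.
move: ts; rewrite (@curve_lengthD _ a t' t)// t's.
case: (curve_length gamma t' t) => [r|//|//]; rewrite -EFinD => -[sr].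
by rewrite lee_fin metric_sym; move: ss (mdist_ge0 (gamma t') (gamma t)); lra.
Qed.

Lemma arclength_param_lip gamma a b (s s' : R) : rectifiable_curve gamma a b ->
  0 <= s -> s <= s' -> s' <= fine (curve_length gamma a b) ->
  mdist (arclength_param gamma a b s) (arclength_param gamma a b s') <= s' - s.
Proof.
move=> rg s0 ss s'L.
have [|t [/andP[at_ tb] ts ->]] := @arclength_paramP _ _ _ s rg.
  by rewrite s0 (le_trans ss).
have [|t' [/andP[at' t'b] ts' ->]] := @arclength_paramP _ _ _ s' rg.
  by rewrite s'L (le_trans s0).
exact: curve_length_eq_mdist ts ts' ss.
Qed.

Lemma arclength_param_curve_length gamma a b t : rectifiable_curve gamma a b ->
  a <= t <= b ->
  arclength_param gamma a b (fine (curve_length gamma a t)) = gamma t.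
Proof.
move=> rg /andP[at_ tb]; have [ab cg fin] := rg.
have ft : curve_length gamma a t \is a fin_num by exact: curve_length_fin fin.
have [|t' [/andP[at' t'b] ts' ->]] :=
    @arclength_paramP _ _ _ (fine (curve_length gamma a t)) rg.
  rewrite fine_ge0 ?curve_length_ge0//=; apply: fine_le => //.
    exact: curve_length_fin fin.
  exact: curve_length_le.
apply: mdist_positivity; apply/eqP; rewrite eq_le mdist_ge0 andbT.
rewrite -[leRHS](subrr (fine (curve_length gamma a t))).
by apply: (@curve_length_eq_mdist _ a) => //; rewrite ?fineK.
Qed.

End curve_length.

(** * Quadratic bounds on increments; integrals of Lipschitz functions *)

Section small_increments.
Context {R : realType}.
Implicit Types (a b C L l s : R) (g k : R -> R).

(** N equal steps accumulate at most C (b - a)^2 / N, which tends to 0. This takes the place of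
    differentiation when a function is compared with an integral along a curve. *)
Lemma small_increment_le g a b C tau : 0 < tau -> a <= b ->
  (forall t t', a <= t -> t <= t' -> t' <= b -> t' - t <= tau ->
    g t' - g t <= C * (t' - t) ^+ 2) ->
  g b <= g a.
Proof.
move=> tau0 ab H; rewrite leNgt; apply/negP => gab.
pose e := g b - g a.
have e0 : 0 < e by rewrite subr_gt0.
(* Large enough for the accumulated error to be below e and for the steps to be shorter than tau. *)
pose N := (Num.truncn (Num.max (C * (b - a) ^+ 2 / e) ((b - a) / tau))).+1.
have : Num.max (C * (b - a) ^+ 2 / e) ((b - a) / tau) < N%:R := truncnS_gt _.
rewrite gt_max => /andP[NR NR2].
have N0 : 0 < N%:R :> R by rewrite ltr0n.
pose d := (b - a) / N%:R.
have d0 : 0 <= d by rewrite divr_ge0 ?subr_ge0// ltW.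
have dN : N%:R * d = b - a by rewrite /d mulrC divfK// gt_eqF.
pose p n := a + n%:R * d.
have dtau : d <= tau.
  by move: NR2; rewrite ltr_pdivrMr// /d ler_pdivrMr// mulrC => /ltW.
have pN : p N = b by rewrite /p dN addrC subrK.
have step n : (n <= N)%N -> g (p n) - g a <= n%:R * (C * d ^+ 2).
  elim: n => [|n ih] nN.
    by rewrite /p !mul0r addr0 subrr.
  have E : p n.+1 = p n + d by rewrite /p -natr1 mulrDl mul1r addrA.
  have -> : g (p n.+1) - g a = (g (p n.+1) - g (p n)) + (g (p n) - g a) by ring.
  rewrite -natr1 mulrDl mul1r addrC; apply: lerD; first exact/ih/ltnW.
  rewrite -[d in leRHS](_ : p n.+1 - p n = d); last by rewrite E addrC addKr.
  apply: H.
  - by rewrite /p lerDl mulr_ge0.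
  - by rewrite E lerDl.
  - by rewrite -pN /p lerD2l ler_wpM2r// ler_nat.
  - by rewrite E addrC addKr.
have := step N (leqnn _); rewrite pN -/e.
have -> : N%:R * (C * d ^+ 2) = C * (b - a) ^+ 2 / N%:R.
  by rewrite -dN; field; rewrite gt_eqF.
rewrite ler_pdivlMr//; move: NR; rewrite ltr_pdivrMr// (mulrC e) => h1 h2.
by have := lt_le_trans h1 h2; rewrite mulrC ltxx.
Qed.

Lemma lipschitz_Rintegral k L l : 0 <= l ->
  (forall s s', 0 <= s -> s <= s' -> s' <= L -> `|k s' - k s| <= l * (s' - s)) ->
  (@lebesgue_measure R).-integrable `[0, L] (EFin \o k) /\
  forall s s', 0 <= s -> s <= s' -> s' <= L ->
    (k s - l * (s' - s)) * (s' - s) <=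
    \int[lebesgue_measure]_(x in `[0, s']) k x -
    \int[lebesgue_measure]_(x in `[0, s]) k x <=
    (k s + l * (s' - s)) * (s' - s).
Proof.
move=> l0 H.
have ck : {within `[0, L], continuous k}.
  apply/subspace_continuousP => x /=; rewrite in_itv/= => /andP[x0 xL].
  apply/cvgrPdist_le => e e0.
  have l1 : 0 < l + 1 by rewrite ltr_wpDl.
  exists (e / (l + 1)) => /=; first by rewrite divr_gt0.
  move=> y /= xy; rewrite in_itv/= => /andP[y0 yL].
  rewrite ltr_pdivlMr// mulrC in xy; apply: le_trans (ltW xy).
  have H2 s s' : 0 <= s -> s <= s' -> s' <= L ->
      `|k s' - k s| <= (l + 1) * `|s' - s|.
    move=> s0 ss' s'L; apply: le_trans (H _ _ s0 ss' s'L) _.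
    by rewrite (@ger0_norm _ (s' - s)) ?subr_ge0// ler_wpM2r ?subr_ge0// lerDl.
  have [yx|/ltW xy'] := leP y x; first exact: H2.
  by rewrite distrC (distrC x); exact: H2.
have ik : (@lebesgue_measure R).-integrable `[0, L] (EFin \o k).
  by apply: continuous_compact_integrable => //; exact: segment_compact.
split => // s s' s0 ss' s'L.
have iks' : (@lebesgue_measure R).-integrable `[0, s'] (EFin \o k).
  by apply: integrableS ik => //; apply: subset_itvl; rewrite bnd_simp.
rewrite Rintegral_itvB//.
have sub : `]s, s']%classic `<=` `[0, s']%classic.
  by apply: subset_itvr; rewrite bnd_simp.
have icst (r : R) :
    (@lebesgue_measure R).-integrable `]s, s'] (EFin \o (fun=> r)).
  suff : (@lebesgue_measure R).-integrable `[0, s'] (EFin \o (fun=> r)).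
    exact: integrableS.
  apply: continuous_compact_integrable; first exact: segment_compact.
  by apply: continuous_subspaceT => x; exact: cvg_cst.
have iks : (@lebesgue_measure R).-integrable `]s, s'] (EFin \o k).
  exact: integrableS iks'.
have len : fine (lebesgue_measure `]s, s']%classic) = s' - s.
  rewrite lebesgue_measure_itv/= lte_fin; case: ltgtP ss' => //= -> _.
  by rewrite subrr.
have cst (r : R) : \int[lebesgue_measure]_(x in `]s, s']) r = r * (s' - s).
  by rewrite Rintegral_cst// len.
rewrite -(cst (k s - l * (s' - s))) -(cst (k s + l * (s' - s))).
apply/andP; split; apply: le_Rintegral => //= x;
  rewrite in_itv/= => /andP[sx xs'].
  have := H s x s0 (ltW sx) (le_trans xs' s'L); rewrite ler_norml => /andP[h _].
  have := ler_wpM2l l0 xs'; move: h; lra.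
have := H s x s0 (ltW sx) (le_trans xs' s'L); rewrite ler_norml => /andP[_ h].
have := ler_wpM2l l0 xs'; move: h; lra.
Qed.
End small_increments.

(** * Line integrals of Lipschitz weights *)

Section line_integral.
Context {R : realType} {X : completeMetricType R}.
Implicit Types (gamma : R -> X) (a b t : R) (f h : X -> R).

Definition lipschitz_with (l : R) h :=
  forall x y, `|h x - h y| <= l * mdist x y.

Lemma arclength_param0 gamma a b : rectifiable_curve gamma a b ->
  arclength_param gamma a b 0 = gamma a.
Proof.
move=> rg; have := arclength_param_curve_length rg (t := a).
by rewrite curve_lengthxx/=; apply; rewrite lexx; case: rg.
Qed.

Lemma arclength_param1 gamma a b : rectifiable_curve gamma a b ->
  arclength_param gamma a b (fine (curve_length gamma a b)) = gamma b.
Proof.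
move=> rg; apply: arclength_param_curve_length => //.
by rewrite lexx; case: rg => ->.
Qed.

Lemma line_integral_lipschitz gamma a b h l : rectifiable_curve gamma a b ->
  0 <= l -> lipschitz_with l h ->
  let L := fine (curve_length gamma a b) in
  let F s := \int[lebesgue_measure]_(x in `[0, s]) h (arclength_param gamma a b x) in
  [/\ line_integral (EFin \o h) gamma a b = (F L)%:E, F 0 = 0 &
   forall s s', 0 <= s -> s <= s' -> s' <= L ->
    (h (arclength_param gamma a b s) - l * (s' - s)) * (s' - s) <=
    F s' - F s <=
    (h (arclength_param gamma a b s) + l * (s' - s)) * (s' - s)].
Proof.
move=> rg l0 lh L F.
have [|i H] := @lipschitz_Rintegral R (h \o arclength_param gamma a b) L l l0.
  move=> s s' s0 ss' s'L /=; apply: le_trans (lh _ _) _.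
  by rewrite ler_wpM2l// metric_sym arclength_param_lip.
split => //; last by rewrite /F set_itv1 Rintegral_set1.
rewrite /line_integral /F /Rintegral fineK//; exact: integrable_fin_num.
Qed.

Lemma lipschitz_continuous h l : lipschitz_with l h -> continuous h.
Proof.
move=> lh x; apply/cvgrPdist_lt => e e0.
have l1 : 0 < `|l| + 1 by rewrite ltr_wpDl.
have : nbhs x (ball x (e / (`|l| + 1))).
  by apply: nbhsx_ballx; rewrite divr_gt0.
apply: filterS => y; rewrite ballEmdist/= ltr_pdivlMr// mulrC => H.
apply: le_lt_trans H; apply: le_trans (lh _ _) _.
by rewrite ler_wpM2r ?mdist_ge0// (le_trans (ler_norm _))// lerDl.
Qed.

Lemma continuous_borel_measurable (f : X -> R) : continuous f ->
  measurable_fun setT (f : g_sigma_algebraType (@open X) -> R).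
Proof.
move=> cf; apply: (measurability _ (RGenOpens.measurableE R)).
move=> _ [_ [a [b ->] <-]]; rewrite setTI.
apply: sub_sigma_algebra; move/continuousP : cf; apply; exact: interval_open.
Qed.

(** Along the arc length parametrization the increments of f exceed those of the integral of h by a
    quadratic error at most, so that [small_increment_le] compares the two. Exchanging p and q gives
    the same hypothesis for the opposite of f, hence the absolute value. *)
Lemma upper_gradient_lipschitz f h l tau : 0 < tau -> 0 <= l ->
  (forall x, 0 <= h x) -> lipschitz_with l h ->
  (forall p q, mdist p q <= tau -> f p - f q <= Num.max (h p) (h q) * mdist p q) ->
  upper_gradient f (EFin \o h).
Proof.
move=> tau0 l0 h0 lh H; split.
- by move=> x; rewrite lee_fin.
- apply/measurable_EFinP; apply: continuous_borel_measurable.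
  exact: lipschitz_continuous lh.
move=> gamma a b rg.
have [->] := line_integral_lipschitz rg l0 lh.
set s1 := arclength_param gamma a b; set L := fine _.
set F := fun s => \int[lebesgue_measure]_(x in `[0, s]) h (s1 x).
move=> F0 HF; rewrite lee_fin.
have L0 : 0 <= L by rewrite fine_ge0// curve_length_ge0//; case: rg.
suff K (g : X -> R) : (forall p q, mdist p q <= tau ->
    g p - g q <= Num.max (h p) (h q) * mdist p q) -> g (gamma b) - g (gamma a) <= F L.
  rewrite ler_norml -lerN2 opprK; apply/andP; split; last first.
    have := K (fun x => - f x); rewrite opprK addrC; apply => p q pq.
    by rewrite opprK addrC maxC metric_sym; apply: H; rewrite metric_sym.
  by rewrite opprB; exact: K.
move=> {}H.
rewrite -(arclength_param0 rg) -(arclength_param1 rg) -/s1 -/L.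
suff : g (s1 L) - F L <= g (s1 0) - F 0.
  by rewrite (F0 : F 0 = 0) subr0 lerBlDr lerBlDl addrC.
(* One l comes from freezing h at the left end, the other from the error in the integral. *)
apply: (@small_increment_le _ (fun t => g (s1 t) - F t) _ _ (2 * l) tau) => //.
move=> t t' t0 tt' t'L tau'.
have lp : mdist (s1 t') (s1 t) <= t' - t.
  by rewrite metric_sym; exact: arclength_param_lip.
have /H : mdist (s1 t') (s1 t) <= tau by exact: le_trans tau'.
have /andP[HF1 _] := HF _ _ t0 tt' t'L.
have hmax : Num.max (h (s1 t')) (h (s1 t)) <= h (s1 t) + l * (t' - t).
  rewrite ge_max; apply/andP; split; last first.
    by rewrite lerDl mulr_ge0// subr_ge0.
  rewrite -lerBlDl (le_trans (ler_norm _))// (le_trans (lh _ _))//.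
  exact: ler_wpM2l.
have : Num.max (h (s1 t')) (h (s1 t)) * mdist (s1 t') (s1 t) <=
    (h (s1 t) + l * (t' - t)) * (t' - t).
  apply: ler_pM => //; first by rewrite le_max h0.
  exact: mdist_ge0.
move: HF1; rewrite -/(F t) -/(F t').
by nra.
Qed.

Lemma polygon_length_le_weighted gamma a b (c : R) s : 0 <= c ->
  (forall t t', a <= t -> t <= t' -> t' <= b ->
    c * mdist (gamma t) (gamma t') <= t' - t) ->
  path <%R a s -> last a s = b -> c * polygon_length gamma a s <= b - a.
Proof.
move=> c0; elim: s a => [|x s ih] a H /=.
  by move=> _ <-; rewrite mulr0 subrr.
move=> /andP[ax ps] ls; rewrite mulrDr.
have xb : x <= b by apply: (@itv_partition_le _ _ x b s); split=> //; apply/eqP.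
have -> : b - a = (x - a) + (b - x) by ring.
apply: lerD; first by apply: H => //; exact: ltW.
by apply: ih => // t t' xt; apply: H; exact: le_trans (ltW ax) xt.
Qed.

Lemma curve_length_le_weighted gamma a b (c : R) : 0 < c -> a <= b ->
  (forall t t', a <= t -> t <= t' -> t' <= b ->
    c * mdist (gamma t) (gamma t') <= t' - t) ->
  (curve_length gamma a b <= ((b - a) / c)%:E)%E.
Proof.
move=> c0 ab H; apply: curve_length_ub => s ps ls.
rewrite lee_fin ler_pdivlMr// mulrC.
exact: polygon_length_le_weighted (ltW c0) H ps ls.
Qed.

Lemma rectifiable_lipschitz gamma a b (c : R) : 0 < c -> a <= b ->
  (forall t t', a <= t -> t <= t' -> t' <= b ->
    c * mdist (gamma t) (gamma t') <= t' - t) ->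
  rectifiable_curve gamma a b.
Proof.
move=> c0 ab H; split => //; last first.
  exact: le_lt_trans (curve_length_le_weighted c0 ab H) (ltey _).
apply/subspace_continuousP => x /=; rewrite in_itv/= => /andP[ax xb].
move=> A; rewrite /= -nbhs_ballE => -[e /= e0 eA].
exists (c * e) => /=; first by rewrite mulr_gt0.
move=> y /= xy; rewrite in_itv/= => /andP[ay yb]; apply: eA; rewrite ballEmdist/=.
rewrite -(ltr_pM2l c0); apply: le_lt_trans xy.
have [yx|/ltW xy'] := leP y x.
  by rewrite metric_sym (le_trans (H _ _ ay yx xb))// ler_norm.
by rewrite (le_trans (H _ _ ax xy' yb))// distrC ler_norm.
Qed.

(** A converse to the upper gradient inequality, for a curve whose time bounds a weighted distance.
    As gamma moves at speed at most 1 / c, the weight on a short interval [t, t'] is close to its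
    value at t, so this value times the length of the piece is at most t' - t up to a quadratic
    error. *)
Lemma line_integral_le gamma a b h l (c : R) : 0 < c -> a <= b -> 0 <= l ->
  (forall x, 0 <= h x) -> lipschitz_with l h ->
  (forall t t', a <= t -> t <= t' -> t' <= b ->
    c * mdist (gamma t) (gamma t') <= t' - t /\
    (h (gamma t) - l * mdist (gamma t) (gamma t')) * mdist (gamma t) (gamma t')
      <= t' - t) ->
  (line_integral (EFin \o h) gamma a b <= (b - a)%:E)%E.
Proof.
move=> c0 ab l0 h0 lh H.
have rg : rectifiable_curve gamma a b.
  by apply: (rectifiable_lipschitz c0) => // t t' *; case: (H t t').
have fin : (curve_length gamma a b < +oo)%E by case: rg.
have [-> F0] := line_integral_lipschitz rg l0 lh.
set s1 := arclength_param gamma a b; set L := fine _.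
set F := fun s => \int[lebesgue_measure]_(x in `[0, s]) h (s1 x).
move=> HF; rewrite lee_fin.
pose s t := fine (curve_length gamma a t).
have s0 : s a = 0 by rewrite /s curve_lengthxx.
suff : F (s b) - b <= F (s a) - a.
  by rewrite s0 (F0 : F 0 = 0) sub0r lerBlDr addrC.
(* Twice l from bounding h minus l times the distance from below on the piece, once from the
   integral; the division by c ^+ 2 converts times into distances. *)
apply: (@small_increment_le _ (fun t => F (s t) - t) _ _ (3 * l / c ^+ 2) 1) => //.
move=> t t' at_ tt' t'b _.
have ft : curve_length gamma a t \is a fin_num.
  by apply: curve_length_fin fin => //; exact: le_trans t'b.
have ftt' : curve_length gamma t t' \is a fin_num by exact: curve_length_fin fin.
pose la := fine (curve_length gamma t t').
have la0 : 0 <= la by rewrite fine_ge0// curve_length_ge0.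
have sE : s t' - s t = la.
  by rewrite /s (curve_lengthD _ at_ tt') fineD// addrC addKr.
have sL : s t' <= L.
  have ? : curve_length gamma a t' \is a fin_num.
    by apply: curve_length_fin fin => //; exact: le_trans tt'.
  apply: fine_le => //; first by exact: curve_length_fin fin.
  by apply: curve_length_le => //; exact: le_trans tt'.
have st0 : 0 <= s t by rewrite fine_ge0// curve_length_ge0.
have sle : s t <= s t' by rewrite -subr_ge0 sE.
have /andP[_] := HF _ _ st0 sle sL; rewrite sE.
rewrite [s1 (s t)]arclength_param_curve_length//; last first.
  by rewrite at_ (le_trans tt').
rewrite -/(F (s t)) -/(F (s t')) => HFt.
pose ka := (t' - t) / c.
have ka0 : 0 <= ka by rewrite divr_ge0 ?subr_ge0// ltW.
have laka : la <= ka.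
  rewrite -lee_fin /la fineK//; apply: curve_length_le_weighted => // u u' tu uu' u't'.
  by case: (H u u') => //; [exact: le_trans tu|exact: le_trans t'b].
have hla : (h (gamma t) - 2 * l * ka) * la <= t' - t.
  have [cp|cn] := ltP 0 (h (gamma t) - 2 * l * ka); last first.
    by rewrite (@le_trans _ _ 0) ?subr_ge0// mulr_le0_ge0.
  rewrite mulrC -ler_pdivlMr// -lee_fin /la fineK//.
  apply: curve_length_le_weighted => // u u' tu uu' u't'.
  have [|//||h1 h2] := H u u'; [exact: le_trans tu|exact: le_trans t'b|].
  have [h3 _] := H _ _ at_ tu (le_trans uu' (le_trans u't' t'b)).
  apply: le_trans h2; apply: ler_wpM2r; first exact: mdist_ge0.
  have d1 : mdist (gamma t) (gamma u) <= ka.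
    by rewrite /ka ler_pdivlMr// mulrC (le_trans h3)// lerD2r (le_trans uu').
  have d2 : mdist (gamma u) (gamma u') <= ka.
    rewrite /ka ler_pdivlMr// mulrC (le_trans h1)//.
    exact: lerB.
  have := lh (gamma t) (gamma u); rewrite ler_norml => /andP[_ d3].
  have := ler_wpM2l l0 d1; have := ler_wpM2l l0 d2; move: d3; lra.
have -> : 3 * l / c ^+ 2 * (t' - t) ^+ 2 = 3 * l * ka ^+ 2.
  by rewrite /ka; field; rewrite gt_eqF.
have h4 : la * la <= ka * ka by apply: ler_pM.
have h5 : ka * la <= ka * ka by apply: ler_wpM2l.
move: HFt hla (ler_wpM2l l0 h4) (ler_wpM2l l0 h5); rewrite expr2.
move: (F _) (F _) (h _) => u1 u2 u3; clear; lra.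
Qed.

End line_integral.

(** * Lipschitz approximation from below *)

Section lipschitz_approximation.
Context {R : realType} {X : completeMetricType R}.
Implicit Types (g : X -> \bar R) (x y : X) (n : nat).

(** The Pasch-Hausdorff envelope: the largest n-Lipschitz function below the minimum of g and n. The
    truncation keeps [fine] away from infinite values. *)
Definition lip_approx g n x : R :=
  inf [set fine (Order.min (g y) n%:R%:E) + n%:R * mdist x y | y in setT].

Section basic.
Variable g : X -> \bar R.
Hypothesis g0 : forall x, (0 <= g x)%E.

Lemma mine_fin_num x n : Order.min (g x) n%:R%:E \is a fin_num.
Proof.
rewrite ge0_fin_numE ?le_min ?g0 ?lee_fin ?ler0n//.
by apply: le_lt_trans (ltry n%:R); rewrite ge_min lexx orbT.
Qed.

Let T n x y := fine (Order.min (g y) n%:R%:E) + n%:R * mdist x y.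

Let T_ge0 n x y : 0 <= T n x y.
Proof.
by rewrite addr_ge0 ?mulr_ge0 ?mdist_ge0// fine_ge0// le_min g0 lee_fin/=.
Qed.

Lemma lip_approx_lb n x y : lip_approx g n x <= T n x y.
Proof. by apply: ge_inf; [exists 0 => _ [z _ <-]; exact: T_ge0|exists y]. Qed.

Lemma le_lip_approx n x (r : R) : (forall y, r <= T n x y) -> r <= lip_approx g n x.
Proof.
move=> H; apply: lb_le_inf; first by exists (T n x x); exists x.
by move=> _ [y _ <-]; exact: H.
Qed.

Lemma lip_approx_ge0 n x : 0 <= lip_approx g n x.
Proof. exact: le_lip_approx. Qed.

Lemma lip_approx_lipschitz n : lipschitz_with n%:R (lip_approx g n).
Proof.
have H x y : lip_approx g n x - lip_approx g n y <= n%:R * mdist x y.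
  rewrite lerBlDl -lerBlDr; apply: le_lip_approx => z.
  rewrite lerBlDr; apply: le_trans (lip_approx_lb n x z) _.
  by rewrite /T -addrA lerD2l -mulrDr ler_wpM2l// addrC metric_triangle.
move=> x y; rewrite ler_norml H andbT lerNl opprB metric_sym; exact: H.
Qed.

Lemma lip_approx_le_min n x : ((lip_approx g n x)%:E <= Order.min (g x) n%:R%:E)%E.
Proof.
rewrite -(fineK (mine_fin_num x n)) lee_fin.
by have := lip_approx_lb n x x; rewrite /T mdistxx mulr0 addr0.
Qed.

Lemma lip_approx_le n x : ((lip_approx g n x)%:E <= g x)%E.
Proof. by rewrite (le_trans (lip_approx_le_min n x))// ge_min lexx. Qed.

Lemma lip_approx_le_nat n x : lip_approx g n x <= n%:R.
Proof.
by rewrite -lee_fin (le_trans (lip_approx_le_min n x))// ge_min lexx orbT.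
Qed.

Lemma lip_approx_nd n m x : (n <= m)%N -> lip_approx g n x <= lip_approx g m x.
Proof.
move=> nm; apply: le_lip_approx => y; apply: le_trans (lip_approx_lb n x y) _.
apply: lerD; last by rewrite ler_wpM2r ?mdist_ge0// ler_nat.
apply: fine_le; rewrite ?mine_fin_num// le_min ge_min lexx/= ge_min.
by rewrite lee_fin ler_nat nm orbT.
Qed.

Lemma lip_approx_ge (d : R) n x : (forall y, d%:E <= g y)%E -> d <= n%:R ->
  d <= lip_approx g n x.
Proof.
move=> dg dn; apply: le_lip_approx => y; rewrite -[d]addr0 lerD//.
  by rewrite -lee_fin fineK ?mine_fin_num// le_min dg lee_fin.
by rewrite mulr_ge0// mdist_ge0.
Qed.

(** If g > r on the ball of radius e around x, the points of this ball contribute at least r for n >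
    r, and the other points at least n e; so the envelope reaches r for n large. *)
Lemma lip_approx_cvg x : lower_semicontinuous g ->
  (lip_approx g n x)%:E @[n --> \oo] --> g x.
Proof.
move=> lsc.
have -> : g x = ereal_sup (range (fun n => (lip_approx g n x)%:E)).
  apply/eqP; rewrite eq_le; apply/andP; split; last first.
    by apply: ge_ereal_sup => _ [n _ <-]; exact: lip_approx_le.
  have key (r : R) : (r%:E < g x)%E ->
      (r%:E <= ereal_sup (range (fun n => (lip_approx g n x)%:E)))%E.
    move=> rg; have [V] := lsc x r rg.
    rewrite -nbhs_ballE => -[e /= e0 eV] HV.
    pose n := (Num.truncn (Num.max r (r / e))).+1.
    have : Num.max r (r / e) < n%:R := truncnS_gt _.
    rewrite gt_max => /andP[rn ren].
    apply: le_trans (ereal_sup_ubound _); last by exists n.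
    rewrite lee_fin; apply: le_lip_approx => y.
    have [xy|xy] := ltP (mdist x y) e.
      rewrite -[r]addr0 /T lerD//; last by rewrite mulr_ge0// mdist_ge0.
      rewrite -lee_fin fineK ?mine_fin_num// le_min lee_fin (ltW rn) andbT.
      by apply/ltW/HV/eV; rewrite ballEmdist.
    rewrite /T -[r]add0r lerD//.
      by rewrite fine_ge0// le_min g0 lee_fin/=.
    rewrite (@le_trans _ _ (n%:R * e))//; last by rewrite ler_wpM2l.
    by move: ren; rewrite ltr_pdivrMr// => /ltW.
  rewrite leNgt; apply/negP => H.
  set S := ereal_sup _ in H key *.
  have S0 : (0 <= S)%E.
    apply: (@le_trans _ _ (lip_approx g 0 x)%:E); first by rewrite lee_fin lip_approx_ge0.
    by apply: ereal_sup_ubound; exists 0%N.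
  clearbody S; case: S S0 key H => [s _ key H|_ _|//]; last by rewrite ltNge leey.
  have [r sr rg] : exists2 r, s < r & (r%:E < g x)%E.
    case: (g x) H => // [t|_]; last by exists (s + 1); rewrite ?ltrDl ?ltey.
    rewrite lte_fin => st; exists ((s + t) / 2); rewrite ?lte_fin; lra.
  by have := key r rg; rewrite lee_fin leNgt sr.
apply: ereal_nondecreasing_cvgn => n m nm; rewrite lee_fin.
exact: lip_approx_nd.
Qed.

End basic.
End lipschitz_approximation.

(** * Chains and their costs *)

Section chains.
Context {R : realType} {X : Type}.
Implicit Types (c : X -> X -> R) (x y z : X) (s : seq X).

Fixpoint chain_cost c x s : R :=
  if s is y :: s' then c x y + chain_cost c y s' else 0.

Definition chain_dist c x y : R :=
  inf [set chain_cost c x s | s in [set s | last x s = y]].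

Section nonneg.
Variable c : X -> X -> R.
Hypothesis c0 : forall x y, 0 <= c x y.

Lemma chain_cost_ge0 x s : 0 <= chain_cost c x s.
Proof. by elim: s x => //= y s ih x; rewrite addr_ge0. Qed.

Lemma chain_dist_le_cost x s : chain_dist c x (last x s) <= chain_cost c x s.
Proof.
by apply: ge_inf; [exists 0 => _ [t _ <-]; exact: chain_cost_ge0|exists s].
Qed.

Lemma chain_dist_ge (r : R) x y :
  (forall s, last x s = y -> r <= chain_cost c x s) -> r <= chain_dist c x y.
Proof.
move=> H; apply: lb_le_inf; first by exists (chain_cost c x [:: y]); exists [:: y].
by move=> _ [s /= ls <-]; exact: H.
Qed.

Lemma chain_dist_lt (r : R) x y : chain_dist c x y < r ->
  exists2 s, last x s = y & chain_cost c x s < r.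
Proof.
move=> H; have [] := @inf_lt R _ _ _ H.
  by exists (chain_cost c x [:: y]); exists [:: y].
by move=> _ [s ls <-] ?; exists s.
Qed.

Lemma chain_dist_ge0 x y : 0 <= chain_dist c x y.
Proof. by apply: chain_dist_ge => s _; exact: chain_cost_ge0. Qed.

Lemma chain_distxx x : chain_dist c x x = 0.
Proof.
apply/eqP; rewrite eq_le chain_dist_ge0 andbT.
exact: (chain_dist_le_cost x [::]).
Qed.

Lemma chain_dist_le x y : chain_dist c x y <= c x y.
Proof. by have := chain_dist_le_cost x [:: y]; rewrite /= addr0. Qed.

Lemma chain_cost_cat x s t :
  chain_cost c x (s ++ t) = chain_cost c x s + chain_cost c (last x s) t.
Proof. by elim: s x => [|y s ih] x /=; rewrite ?add0r// ih addrA. Qed.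

Lemma chain_dist_triangle x y z :
  chain_dist c x z <= chain_dist c x y + chain_dist c y z.
Proof.
rewrite -lerBlDr; apply: chain_dist_ge => s ls.
rewrite lerBlDr -lerBlDl; apply: chain_dist_ge => t lt.
by rewrite lerBlDl -{1}ls -chain_cost_cat -lt -ls -last_cat chain_dist_le_cost.
Qed.

(** Duality: the increments of a potential dominated by the cost telescope along each chain. *)
Lemma chain_dist_lower (F : X -> R) x y :
  (forall p q, F q - F p <= c p q) -> F y - F x <= chain_dist c x y.
Proof.
move=> H; apply: chain_dist_ge => s; elim: s x => [|z s ih] x /=.
  by move=> ->; rewrite subrr.
move=> ls; have := ih z ls; have := H x z; lra.
Qed.

(** The chain is run through at unit cost per unit time: z waits at a vertex until the next step is
    paid. The jumps make z discontinuous, whence the error e. *)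
Lemma chain_param (e : R) x s : 0 <= e -> path (fun p q => c p q <= e) x s ->
  exists z : R -> X,
  [/\ forall t, chain_cost c x s <= t -> z t = last x s,
      forall t, 0 <= t -> chain_dist c x (z t) <= t &
      forall t t', 0 <= t -> t <= t' -> chain_dist c (z t) (z t') <= t' - t + e].
Proof.
move=> e0; elim: s x => [|y s ih] x /=.
  exists (fun=> x); split=> // t; first by rewrite chain_distxx.
  by move=> t' t0 tt'; rewrite chain_distxx addr_ge0// subr_ge0.
move=> /andP[ce /ih [z [z1 z2 z3]]].
exists (fun t => if t < c x y then x else z (t - c x y)); split.
- move=> t ht; rewrite ltNge (le_trans _ ht) ?lerDl ?chain_cost_ge0//=.
  by apply: z1; rewrite lerBrDl.
- move=> t t0; case: ltP => tc; first by rewrite chain_distxx.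
  apply: le_trans (chain_dist_triangle _ y _) _.
  apply: le_trans (lerD (chain_dist_le _ _) (z2 (t - c x y) _)) _.
    by rewrite subr_ge0.
  by rewrite addrC subrK.
- move=> t t' t0 tt'; case: ltP => tc; case: ltP => t'c.
  + by rewrite chain_distxx addr_ge0// subr_ge0.
  + apply: le_trans (chain_dist_triangle _ y _) _.
    apply: le_trans (lerD (chain_dist_le _ _) (z2 (t' - c x y) _)) _.
      by rewrite subr_ge0.
    by move: ce tc; lra.
  + by have := lt_le_trans t'c tc; rewrite ltNge tt'.
  + apply: le_trans (z3 (t - c x y) (t' - c x y) _ _) _; rewrite ?subr_ge0//.
      by rewrite lerD2r.
    by lra.
Qed.

End nonneg.

Lemma chain_dist_mono c c' x y : (forall p q, 0 <= c p q) ->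
  (forall p q, c p q <= c' p q) -> chain_dist c x y <= chain_dist c' x y.
Proof.
move=> c0 cc'; apply: chain_dist_ge => s <-.
apply: le_trans (chain_dist_le_cost c0 _ _) _.
by elim: s x => //= z s ih x; rewrite lerD.
Qed.

End chains.

Lemma fmap_ultra (T U : Type) (f : T -> U) (F : set_system T) :
  UltraFilter F -> UltraFilter (f @ F).
Proof.
move=> FU; split=> [|G GF sFG]; first exact: fmap_proper_filter.
apply/seteqP; split => A; last exact: sFG.
move=> GA; have [//|FnA] := in_ultra_setVsetC (f @^-1` A) FU.
by have /filter_ex [? []] : G (A `&` ~` A) by apply: filterI => //; exact: sFG.
Qed.

(** * The cost distance of a weight and its limit curves *)

Section cost_distance.
Context {R : realType} {X : completeMetricType R}.
Variable g : X -> \bar R.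
Hypothesis g0 : forall x, (0 <= g x)%E.
Implicit Types (x y p q : X) (n m : nat).

(* Jumps of length more than (n + 1)^-2 are allowed, but cost at least 1: this
   makes chain distances finite and Lipschitz without any connectedness. *)
Definition step_cost n x y : R :=
  if n.+1%:R ^+ 2 * mdist x y <= 1 then lip_approx g n.+1 x * mdist x y
  else n.+1%:R ^+ 2 * mdist x y.

Definition cost_dist n x y : R := chain_dist (step_cost n) x y.

Let N2_ge n : n.+1%:R <= n.+1%:R ^+ 2 :> R.
Proof. by rewrite expr2 ler_peMl// ler1n. Qed.

Lemma step_cost_ge0 n x y : 0 <= step_cost n x y.
Proof.
by rewrite /step_cost; case: ifP => _;
  rewrite mulr_ge0 ?mdist_ge0 ?lip_approx_ge0 ?exprn_ge0.
Qed.

Lemma step_cost_le n x y : step_cost n x y <= n.+1%:R ^+ 2 * mdist x y.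
Proof.
rewrite /step_cost; case: ifP => // _; rewrite ler_wpM2r ?mdist_ge0//.
exact: le_trans (lip_approx_le_nat _ _ _) (N2_ge _).
Qed.

(** The price (n + 1)^2 per unit distance of a long jump dominates the truncated weight, which keeps
    the costs monotone when a jump becomes long at the higher level. *)
Lemma step_cost_nd n m x y : (n <= m)%N -> step_cost n x y <= step_cost m x y.
Proof.
move=> nm.
have nm2 : n.+1%:R ^+ 2 <= m.+1%:R ^+ 2 :> R.
  by rewrite ler_pXn2r// ?nnegrE// ler_nat.
rewrite [leRHS]/step_cost; case: ifPn => h; last first.
  by apply: le_trans (step_cost_le _ _ _) _; rewrite ler_wpM2r ?mdist_ge0.
rewrite /step_cost ifT; last by rewrite (le_trans _ h)// ler_wpM2r// mdist_ge0.
by rewrite ler_wpM2r ?mdist_ge0// lip_approx_nd.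
Qed.

Lemma step_cost_ge (d : R) n x y : d <= 1 -> (forall z, d%:E <= g z)%E ->
  d * mdist x y <= step_cost n x y.
Proof.
move=> d1 dg; have d1n : d <= n.+1%:R by rewrite (le_trans d1)// ler1n.
rewrite /step_cost; case: ifP => _; rewrite ler_wpM2r ?mdist_ge0//.
  exact: lip_approx_ge.
exact: le_trans (N2_ge _).
Qed.

Lemma cost_dist_ge0 n x y : 0 <= cost_dist n x y.
Proof. by apply: chain_dist_ge0; exact: step_cost_ge0. Qed.

Lemma cost_dist_nd n m x y : (n <= m)%N -> cost_dist n x y <= cost_dist m x y.
Proof.
by move=> nm; apply: chain_dist_mono => *; [exact: step_cost_ge0|exact: step_cost_nd].
Qed.

Lemma cost_dist_triangle n x y z :
  cost_dist n x z <= cost_dist n x y + cost_dist n y z.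
Proof. by apply: chain_dist_triangle; exact: step_cost_ge0. Qed.

Lemma cost_distxx n x : cost_dist n x x = 0.
Proof. by apply: chain_distxx; exact: step_cost_ge0. Qed.

Lemma cost_dist_le_step n x y : cost_dist n x y <= step_cost n x y.
Proof. by apply: chain_dist_le; exact: step_cost_ge0. Qed.

Lemma cost_dist_le n x y : cost_dist n x y <= n.+1%:R ^+ 2 * mdist x y.
Proof. exact: le_trans (cost_dist_le_step _ _ _) (step_cost_le _ _ _). Qed.

Lemma cost_dist_ge (d : R) n x y : 0 <= d -> d <= 1 -> (forall z, d%:E <= g z)%E ->
  d * mdist x y <= cost_dist n x y.
Proof.
move=> d0 d1 dg.
have := @chain_dist_lower _ _ (step_cost n) (fun z => d * mdist x z) x y.
rewrite mdistxx mulr0 subr0; apply => p q.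
apply: le_trans (step_cost_ge _ _ _ d1 dg); rewrite -mulrBr ler_wpM2l//.
by rewrite lerBlDl metric_triangle.
Qed.

(** Chains from p to q may leave the region where the weight is close to its value at p. A radial
    potential around p bounds them all at once. *)
Lemma cost_dist_lower n p q :
  (lip_approx g n.+1 p - n.+1%:R * mdist p q) * mdist p q <= cost_dist n p q.
Proof.
set h := lip_approx g n.+1 p; set l := n.+1%:R.
have l0 : 0 < l by rewrite ltr0n.
have h0 : 0 <= h by exact: lip_approx_ge0.
(* G r is the integral from 0 to r of the positive part of h - l t, the lower bound that the
   Lipschitz condition gives for the weight at distance t from p. *)
pose k r := Num.min r (h / l); pose G r := h * k r - l * (k r) ^+ 2 / 2.
have kl r : l * k r <= h.
  by rewrite mulrC -ler_pdivlMr// ge_min lexx orbT.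
have k0 r : 0 <= r -> 0 <= k r by move=> r0; rewrite le_min r0 divr_ge0// ltW.
have := @chain_dist_lower _ _ (step_cost n) (fun z => G (mdist p z)) p q.
rewrite -/(cost_dist _ _ _) mdistxx => H.
have G0 : G 0 = 0.
  have -> : G 0 = h * k 0 - l * k 0 ^+ 2 / 2 by [].
  have -> : k 0 = 0 by rewrite /k min_l// divr_ge0// ltW.
  by ring.
rewrite G0 subr0 in H; apply: le_trans (H _).
  have d0 := mdist_ge0 p q; rewrite /G /k; move: (mdist p q) d0 => d d0.
  have [dh|dh] := leP d (h / l).
    have : 0 <= l * d ^+ 2 by rewrite mulr_ge0 ?sqr_ge0 ?ltW.
    by rewrite expr2; lra.
  rewrite (@le_trans _ _ 0)//.
    rewrite mulr_le0_ge0// subr_le0 mulrC -ler_pdivrMr//; exact: ltW.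
  have -> : h * (h / l) - l * (h / l) ^+ 2 / 2 = h ^+ 2 / l / 2.
    by field; rewrite gt_eqF.
  by rewrite !divr_ge0// ?sqr_ge0// ltW.
move=> a b.
have ra := mdist_ge0 p a; have rb := mdist_ge0 p b.
have lh := lip_approx_lipschitz g0 n.+1 p a.
have {lh} lh : h - l * mdist p a <= lip_approx g n.+1 a.
  by move: lh; rewrite ler_norml => /andP[_]; rewrite -/h -/l; lra.
have ha0 := lip_approx_ge0 g0 n.+1 a.
have tr : mdist p b <= mdist p a + mdist a b by exact: metric_triangle.
have hd : (h - l * mdist p a) * mdist a b <= step_cost n a b.
  rewrite /step_cost; case: ifP => _; rewrite ler_wpM2r ?mdist_ge0//.
  apply: le_trans (N2_ge _); apply: (@le_trans _ _ h).
    by rewrite gerBl mulr_ge0// ltW.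
  exact: lip_approx_le_nat.
have s0 := step_cost_ge0 n a b.
have km r r' : r <= r' -> k r <= k r' /\ k r' - k r <= r' - r.
  rewrite /k; move: (h / l) => u rr'.
  by case: (leP r u) => h1; case: (leP r' u) => h2; split; lra.
have Gd : G (mdist p b) - G (mdist p a) =
    (k (mdist p b) - k (mdist p a)) *
    (h - l * (k (mdist p b) + k (mdist p a)) / 2).
  by rewrite /G; ring.
have [ba|/ltW ab] := leP (mdist p b) (mdist p a).
  apply: le_trans s0; rewrite Gd; have [h1 _] := km _ _ ba.
  rewrite mulr_le0_ge0 ?subr_le0//.
  by have := kl (mdist p a); have := kl (mdist p b); lra.
have [h1 h2] := km _ _ ab; rewrite Gd.
have [big|small] := leP (h / l) (mdist p a).
  have e1 : k (mdist p a) = h / l by rewrite /k min_r.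
  have e2 : k (mdist p b) = h / l by rewrite /k min_r// (le_trans big).
  by rewrite e1 e2 subrr mul0r.
have e1 : k (mdist p a) = mdist p a by rewrite /k min_l// ltW.
apply: le_trans hd; have lpa := kl (mdist p a); rewrite e1 in h1 h2 lpa *.
have h3 : 0 <= h - l * mdist p a by lra.
apply: (@le_trans _ _ ((k (mdist p b) - mdist p a) * (h - l * mdist p a))).
  rewrite ler_wpM2l ?subr_ge0// lerD2l lerN2.
  have := ler_wpM2l (ltW l0) h1; lra.
rewrite mulrC ler_wpM2l//; lra.
Qed.

Lemma cost_dist_lipschitz n x : lipschitz_with (n.+1%:R ^+ 2) (cost_dist n x).
Proof.
have H y z : cost_dist n x y - cost_dist n x z <= n.+1%:R ^+ 2 * mdist y z.
  rewrite lerBlDl; apply: le_trans (cost_dist_triangle _ _ z _) _.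
  by rewrite lerD2l metric_sym cost_dist_le.
by move=> y z; rewrite ler_norml H andbT lerNl opprB metric_sym; exact: H.
Qed.

Lemma upper_gradient_cost_dist n x :
  upper_gradient (cost_dist n x) (EFin \o lip_approx g n.+1).
Proof.
have N0 : 0 < n.+1%:R ^+ 2 :> R by rewrite exprn_gt0.
apply: (@upper_gradient_lipschitz _ _ _ _ n.+1%:R ((n.+1%:R ^+ 2)^-1)) => //.
- exact: lip_approx_ge0.
- exact: lip_approx_lipschitz.
move=> p q pq; rewrite lerBlDl.
apply: le_trans (cost_dist_triangle _ _ q _) _; rewrite lerD2l.
apply: le_trans (cost_dist_le_step _ _ _) _.
rewrite /step_cost metric_sym ifT; last first.
  by rewrite -ler_pdivlMl// mulr1.
by rewrite ler_wpM2r ?mdist_ge0// le_max lexx orbT.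
Qed.

(** The bound holds for each Lipschitz approximation by [line_integral_le], whose hypotheses come
    from [cost_dist_ge] and [cost_dist_lower], and passes to g by monotone convergence along the
    curve. *)
Lemma line_integral_cost_dist gamma (a b d : R) : 0 < d -> d <= 1 ->
  (forall z, d%:E <= g z)%E -> a <= b -> lower_semicontinuous g ->
  (forall n (t t' : R), a <= t -> t <= t' -> t' <= b ->
     cost_dist n (gamma t) (gamma t') <= t' - t) ->
  rectifiable_curve gamma a b /\ (line_integral g gamma a b <= (b - a)%:E)%E.
Proof.
move=> d0 d1 dg ab lsc H.
have rg : rectifiable_curve gamma a b.
  apply: (rectifiable_lipschitz d0) => // t t' at_ tt' t'b.
  apply: le_trans (H 0%N _ _ at_ tt' t'b).
  by apply: cost_dist_ge => //; exact: ltW.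
split=> //.
have Hn n : (line_integral (EFin \o lip_approx g n.+1) gamma a b <= (b - a)%:E)%E.
  apply: (@line_integral_le _ _ _ _ _ _ n.+1%:R d) => //.
  - exact: lip_approx_ge0.
  - exact: lip_approx_lipschitz.
  - move=> t t' at_ tt' t'b; split; apply: le_trans (H n _ _ at_ tt' t'b).
      by apply: cost_dist_ge => //; exact: ltW.
    exact: cost_dist_lower.
set s1 := arclength_param gamma a b; set L := fine (curve_length gamma a b).
have mk n : measurable_fun `[0, L] (EFin \o lip_approx g n.+1 \o s1).
  have [|i _] := @lipschitz_Rintegral R (lip_approx g n.+1 \o s1) L n.+1%:R (ler0n _ _).
    move=> s s' s0 ss' s'L /=; apply: le_trans (lip_approx_lipschitz g0 _ _ _) _.
    by rewrite ler_wpM2l// metric_sym arclength_param_lip.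
  exact: measurable_int i.
have nd (x : R) : nondecreasing_seq ((fun n => (EFin \o lip_approx g n.+1 \o s1) x)).
  by move=> n m nm; rewrite lee_fin lip_approx_nd.
rewrite /line_integral -/L -/s1.
under eq_integral => x _.
  have /(cvg_lim (@ereal_hausdorff R)) <- :
      ((EFin \o lip_approx g n.+1 \o s1) x @[n --> \oo] --> g (s1 x)).
    by rewrite (cvg_shiftS (fun n => (lip_approx g n (s1 x))%:E)); exact: lip_approx_cvg.
  over.
rewrite monotone_convergence//; last first.
  by move=> n x _; rewrite lee_fin lip_approx_ge0.
apply: lime_le; last by apply: nearW => n; exact: Hn.
apply: ereal_nondecreasing_is_cvgn => n m nm; apply: ge0_le_integral => //.
- by move=> x _; rewrite lee_fin lip_approx_ge0.
- exact: mk.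
- exact: mk.
- by move=> x _; exact: nd.
Qed.

Hypothesis proper : forall x (r : R), compact [set y | mdist x y <= r].

(** An Arzela-Ascoli argument with an ultrafilter in place of subsequences: chains of cost less than
    T at level n, parametrized by cost, remain in a compact ball at each time, and the curve is
    their limit along the ultrafilter, time by time. *)
Lemma exists_cost_curve x y (d T : R) : 0 < d -> d <= 1 ->
  (forall z, d%:E <= g z)%E -> 0 < T <= 1 ->
  (forall n, cost_dist n x y < T) ->
  exists gamma : R -> X, [/\ gamma 0 = x, gamma T = y &
    forall n (t t' : R), 0 <= t -> t <= t' -> t' <= T ->
      cost_dist n (gamma t) (gamma t') <= t' - t].
Proof.
move=> d0 d1 dg /andP[T0 T1] H.
have /choice [z Hz] : forall n, exists zn : R -> X,
    [/\ zn T = y, forall t, 0 <= t -> cost_dist n x (zn t) <= t &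
     forall t t', 0 <= t -> t <= t' ->
       cost_dist n (zn t) (zn t') <= t' - t + n.+1%:R^-1].
  move=> n.
  have [s ls cs] := chain_dist_lt (H n).
  have N0 : 0 < n.+1%:R :> R by rewrite ltr0n.
  (* A jump longer than (n + 1)^-2 costs more than 1 and cannot occur; the others cost at most (n +
     1) (n + 1)^-2. *)
  have small : path (fun p q => step_cost n p q <= n.+1%:R^-1) x s.
    have : chain_cost (step_cost n) x s < 1 by exact: lt_le_trans T1.
    elim: s x {ls cs H} => //= p s ih w cw.
    have c0 := step_cost_ge0 n w p.
    have cs0 : 0 <= chain_cost (step_cost n) p s.
      by apply: chain_cost_ge0; exact: step_cost_ge0.
    rewrite ih ?andbT; last by apply: le_lt_trans cw; rewrite lerDr.
    have : step_cost n w p < 1 by apply: le_lt_trans cw; rewrite lerDl.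
    rewrite /step_cost; case: ifPn => [h _|/negbTE]; last first.
      by rewrite leNgt => /negbFE /ltW; rewrite leNgt => /negbTE ->.
    rewrite -(ler_pM2l N0) mulfV ?gt_eqF// (le_trans _ h)// mulrA expr2.
    rewrite ler_wpM2r ?mdist_ge0// ler_wpM2l ?(ltW N0)//; exact: lip_approx_le_nat.
  have [|z [z1 z2 z3]] := chain_param (step_cost_ge0 n) _ small.
    by rewrite invr_ge0 ltW.
  by exists z; split => //; rewrite z1 ?ls// ltW.
have [U [UU leU]] := ultraFilterLemma (eventually_filter).
have /choice [gamma Hg] : forall t : R, exists p, 0 <= t -> z ^~ t @ U --> p.
  move=> t; have [t0|] := leP 0 t; last by exists x.
  have := @proper x (t / d); rewrite compact_ultra.
  move=> /(_ (z ^~ t @ U) (fmap_ultra _ UU)) [|p [_ zp]]; last by exists p.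
  apply: (@filterS _ U _ setT); last exact: filterT.
  move=> n _ /=; rewrite ler_pdivlMr// mulrC.
  have [_ h _] := Hz n; apply: le_trans (h t t0).
  by apply: cost_dist_ge => //; exact: ltW.
have uniq t p : 0 <= t -> (forall n, z n t = p) -> gamma t = p.
  move=> t0 zt; apply: (@cvg_unique _ (@metric_hausdorff R X) (z ^~ t @ U)).
    exact: Hg.
  have -> : z ^~ t = (fun=> p) by apply/funext.
  exact: cvg_cst.
exists gamma; split.
- apply: uniq => // n; apply/esym/mdist_positivity/eqP.
  rewrite eq_le mdist_ge0 andbT -(pmulr_rle0 _ d0).
  have [_ h _] := Hz n; apply: le_trans (h 0 (lexx _)).
  by apply: cost_dist_ge => //; exact: ltW.
- by apply: uniq => [|n]; [exact: ltW | case: (Hz n)].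
(* For n >= m the cost at level m is at most the cost at level n, so the bound for [z n], whose
   error 1 / (n + 1) vanishes, passes to the limit at the fixed level m, where the cost is Lipschitz
   in the points. *)
move=> m t t' t0 tt' t'T; apply/ler_addgt0Pr => /= e e0.
have e30 : 0 < e / 3 by rewrite divr_gt0.
have M0 : 0 < m.+1%:R ^+ 2 :> R by rewrite exprn_gt0.
have nearU s : 0 <= s -> U [set n | m.+1%:R ^+ 2 * mdist (gamma s) (z n s) < e / 3].
  move=> s0; have Hb : U (z ^~ s @^-1` ball (gamma s) (e / 3 / m.+1%:R ^+ 2)).
    by apply: (Hg s s0); exact: nbhsx_ballx (divr_gt0 e30 M0).
  apply: filterS Hb => n; rewrite /preimage/= ballEmdist/=.
  by rewrite ltr_pdivlMr// mulrC.
have U1 : U [set n | n.+1%:R^-1 < e / 3] by apply: leU; exact: near_infty_natSinv_lt (PosNum e30).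
have U2 : U [set n | (m <= n)%N] by apply: leU; exists m.
have [n [[/= n1 n2] [n3 n4]]] := filter_ex (filterI (filterI (nearU _ t0)
  (nearU _ (le_trans t0 tt'))) (filterI U1 U2)).
have [_ _ h] := Hz n.
have h1 := cost_dist_triangle m (gamma t) (z n t) (gamma t').
have h2 := cost_dist_triangle m (z n t) (z n t') (gamma t').
have h3 := cost_dist_nd (z n t) (z n t') n4.
have h4 := h t t' t0 tt'.
have h5 := cost_dist_le m (gamma t) (z n t).
have h6 := cost_dist_le m (z n t') (gamma t').
rewrite metric_sym in h6.
move: n1 n2 n3 h1 h2 h3 h4 h5 h6 => /=.
move: (_ * mdist _ _) (_ * mdist _ _) (n.+1%:R^-1) => d1' d2' ni.
move: (cost_dist n _ _) (cost_dist m _ _) (cost_dist m _ _) (cost_dist m _ _).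
move: (cost_dist m _ _) => c1 c2 c3 c4 c5; clear; move: t t' e => a b e; lra.
Qed.

End cost_distance.

(** * Balls, Borel sets and separated families *)

Section metric_balls.
Context {R : realType} {X : completeMetricType R}.
Implicit Types (x y z : X) (r e : R).

Lemma mdist_lipschitz x : lipschitz_with 1 (mdist x).
Proof.
move=> y z; rewrite mul1r ler_norml lerBlDr lerNl opprB lerBlDl.
have := metric_triangle x z y; have := metric_triangle x y z.
by rewrite (metric_sym z y); lra.
Qed.

Lemma open_ball x r : open (ball x r : set X).
Proof.
rewrite ballEmdist (_ : [set y | _] = mdist x @^-1` [set t | t < r])//.
apply: open_comp; last exact: open_lt.
by move=> y _; exact: lipschitz_continuous (mdist_lipschitz x) y.
Qed.

Lemma borel_open (A : set X) : open A -> borel A.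
Proof. by move=> oA; exact: sub_sigma_algebra. Qed.

Lemma borel_setC (A : set X) : borel A -> borel (~` A).
Proof. exact: sigma_algebraC. Qed.

Lemma borel_setD (A B : set X) : borel A -> borel B -> borel (A `\` B).
Proof.
by move=> bA bB; apply: (@measurableD _ (g_sigma_algebraType (@open X))).
Qed.

Lemma borel_setI (A B : set X) : borel A -> borel B -> borel (A `&` B).
Proof.
by move=> bA bB; apply: (@measurableI _ (g_sigma_algebraType (@open X))).
Qed.

End metric_balls.

Section disjoint_measurable_sets.
Context d (T : measurableType d) (R : realType) (mu : {measure set T -> \bar R}).

Lemma sum_measure_disjoint (I : eqType) (s : seq I) (B : I -> set T) (U : set T) :
  uniq s -> (forall i, i \in s -> measurable (B i)) -> measurable U ->
  (forall i, i \in s -> B i `<=` U) ->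
  {in s &, forall i j, i != j -> B i `&` B j = set0} ->
  (\sum_(i <- s) mu (B i) <= mu U)%E.
Proof.
elim: s U => [|i s ih] U; first by rewrite big_nil.
move=> /= /andP[ins us] mB mU BU dB; rewrite big_cons.
have mBi := mB i (mem_head _ _).
have iU := BU i (mem_head _ _).
rewrite -[in leRHS](setDUK iU) measureU//; last 2 first.
  exact: measurableD.
  by rewrite setDIK.
rewrite leeD2l//; apply: ih => //.
- by move=> j js; apply: mB; rewrite inE js orbT.
- exact: measurableD.
- move=> j js x Bjx; split; first by apply: BU Bjx; rewrite inE js orbT.
  move=> Bix; have : (B i `&` B j) x by [].
  rewrite dB ?mem_head ?inE ?js ?orbT//.
  by apply/eqP => ij; move: ins; rewrite ij js.
- by move=> j k js ks; apply: dB; rewrite inE ?js ?ks orbT.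
Qed.

End disjoint_measurable_sets.

Section separated_covers.
Context {R : realType} {X : completeMetricType R}.
Implicit Types (P : set X) (s : seq X).

(** If no separated family had covering balls, each could be extended by a point, beyond the bound
    n. *)
Lemma maximal_separated P (e : R) n : 0 < e ->
  (forall s, uniq s -> (forall x, x \in s -> P x) ->
     {in s &, forall x y, x != y -> e <= mdist x y} -> (size s <= n)%N) ->
  exists s, [/\ uniq s, forall x, x \in s -> P x,
    {in s &, forall x y, x != y -> e <= mdist x y} &
    P `<=` \bigcup_(x in [set` s]) ball x e].
Proof.
move=> e0 bound; apply: contrapT => nmax.
have [s [sn us sP ss]] : exists s, [/\ size s = n.+1, uniq s,
    forall x, x \in s -> P x & {in s &, forall x y, x != y -> e <= mdist x y}].
  elim: {bound} n.+1 => [|k [s [sk us sP ss]]]; first by exists [::].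
  have [q Pq qs] : exists2 q, P q & forall x, x \in s -> e <= mdist x q.
    apply: contrapT => nq; apply: nmax; exists s; split => // y Py.
    apply: contrapT => ny; apply: nq; exists y => // x xs; rewrite leNgt.
    by apply/negP => xy; apply: ny; exists x => //; rewrite ballEmdist.
  have qns : q \notin s.
    by apply/negP => /qs; rewrite mdistxx leNgt e0.
  exists (q :: s); split => /=; [by rewrite sk|by rewrite qns| |].
    by move=> y; rewrite inE => /predU1P[->|/sP].
  move=> y z; rewrite !inE => /predU1P[->|ys] /predU1P[->|zs]; rewrite ?eqxx//.
  - by move=> _; rewrite metric_sym; exact: qs.
  - by move=> _; exact: qs.
  - exact: ss.
by have := bound s us sP ss; rewrite sn ltnn.
Qed.

End separated_covers.

(** * Ahlfors regular complete spaces are proper *)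

Section ahlfors.
Context {R : realType} {X : completeMetricType R}.
Variable mu : {outer_measure set X -> \bar R}.
Variables (Q CQ : R).
Hypothesis Q1 : 1 < Q.
Hypothesis CQ1 : 1 <= CQ.
Hypothesis mmu : metric_measure_space mu.
Hypothesis amu : ahlfors_regular mu Q CQ.
Implicit Types (x y z : X) (r e : R).

Local Notation T := (caratheodory_type mu).

Lemma borel_measurable (A : set X) : borel A -> measurable (A : set T).
Proof. by case: (mms_borel_regular mmu) => H _; exact: H. Qed.

Lemma measurable_metric_ball x r : measurable (ball x r : set T).
Proof. by apply: borel_measurable; apply: borel_open; exact: open_ball. Qed.

Lemma borel_measurable_fun d' (T' : measurableType d') (f : X -> T') :
  measurable_fun setT (f : g_sigma_algebraType (@open X) -> T') ->
  measurable_fun setT (f : T -> T').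
Proof.
move=> mf _ B mB; rewrite setTI; apply: borel_measurable.
by have := mf measurableT B mB; rewrite setTI.
Qed.

Lemma measurable_lipschitz (f : X -> R) (l : R) : lipschitz_with l f ->
  measurable_fun setT (f : T -> R).
Proof.
move=> lf; apply: borel_measurable_fun; apply: continuous_borel_measurable.
exact: lipschitz_continuous lf.
Qed.

Lemma measurable_lsc (g : X -> \bar R) : lower_semicontinuous g ->
  measurable_fun setT (g : g_sigma_algebraType (@open X) -> \bar R).
Proof.
move=> /lower_semicontinuousP lsc.
apply: (measurability _ (ErealGenOInfty.measurableE R)).
move=> _ [_ [a ->] <-]; rewrite setTI; apply: sub_sigma_algebra.
rewrite (_ : _ @^-1` _ = [set x | (a%:E < g x)%E])//.
by apply/seteqP; split => x /=; rewrite in_itv/= andbT.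
Qed.

Lemma mu_ball_bounds x r : 0 < r ->
  r `^ Q / CQ <= fine (mu (ball x r)) <= CQ * r `^ Q /\
  mu (ball x r) \is a fin_num.
Proof.
move=> r0; have /andP[h1 h2] := amu x r0.
have fin : mu (ball x r) \is a fin_num.
  by rewrite ge0_fin_numE ?outer_measure_ge0// (le_lt_trans h2)// ltry.
by split => //; rewrite -!lee_fin fineK// h1.
Qed.

Lemma fine_mu_ball_gt0 x r : 0 < r -> 0 < fine (mu (ball x r)).
Proof.
move=> r0; have [/andP[h _] _] := mu_ball_bounds x r0.
by apply: lt_le_trans h; rewrite divr_gt0 ?powR_gt0// (lt_le_trans _ CQ1).
Qed.

Lemma ball_disjoint x y e : e <= mdist x y ->
  ball x (e / 2) `&` ball y (e / 2) = set0.
Proof.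
move=> exy; apply/seteqP; split => // z; rewrite !ballEmdist/= => -[xz yz].
move: exy; have := metric_triangle x z y; rewrite (metric_sym z y).
by move: xz yz; lra.
Qed.

Lemma separated_bound x r e (s : seq X) : 0 < r -> 0 < e ->
  uniq s -> (forall y, y \in s -> mdist x y <= r) ->
  {in s &, forall y z, y != z -> e <= mdist y z} ->
  (size s)%:R * ((e / 2) `^ Q / CQ) <= CQ * (r + e) `^ Q.
Proof.
move=> r0 e0 us sx ss; have re0 : 0 < r + e by rewrite addr_gt0.
have := @sum_measure_disjoint _ T R (cmeasure mu) _ s
  (fun y => ball y (e / 2)) (ball x (r + e)) us.
move=> /(_ (fun y _ => measurable_metric_ball y _) (measurable_metric_ball x _)) H.
have {}H : (\sum_(i <- s) mu (ball i (e / 2)) <= mu (ball x (r + e)))%E.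
  apply: H.
    move=> y ys z; rewrite !ballEmdist/= => yz.
    apply: le_lt_trans (metric_triangle x y z) _.
    by have := sx y ys; move: yz; lra.
  by move=> y z ys zs yz; apply: ball_disjoint; exact: ss.
rewrite -lee_fin; have /andP[_ up] := amu x re0; apply: le_trans up.
apply: le_trans H.
have e20 : 0 < e / 2 by rewrite divr_gt0.
elim: s {us sx ss} => [|y s ih]; first by rewrite big_nil mul0r.
rewrite big_cons /= -natr1 mulrDl mul1r addrC EFinD leeD//.
by have /andP[] := amu y e20.
Qed.

(** An ultrafilter on the closed ball contains a ball of each radius e, since finitely many of these
    cover; it is therefore Cauchy, and completeness yields the limit. *)
Lemma proper_space x r : compact [set y | mdist x y <= r].
Proof.
rewrite compact_ultra => F FU FK; have FF := @ultra_proper _ _ FU.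
suff cF : cauchy_ex F.
  have /cauchy_cvg/cvg_ex[p Fp] : cauchy F by exact: cauchy_exP.
  exists p; split=> //.
  have clK : closed [set y | mdist x y <= r].
    rewrite (_ : [set y | _] = mdist x @^-1` [set t | t <= r])//.
    apply: closed_comp; last exact: closed_le.
    by move=> y _; exact: lipschitz_continuous (mdist_lipschitz x) y.
  apply: clK => V pV; exact: (filter_ex (filterI FK (Fp _ pV))).
move=> e e0; apply: contrapT => nF.
have Fc p : F (~` ball p e).
  by have [Fb|//] := in_ultra_setVsetC (ball p e) FU; case: nF; exists p.
pose r' := `|r| + 1; have r'0 : 0 < r' by rewrite ltr_wpDl.
pose c := (e / 2) `^ Q / CQ; pose D := CQ * (r' + e) `^ Q.
have c0 : 0 < c by rewrite divr_gt0 ?powR_gt0 ?divr_gt0// (lt_le_trans _ CQ1).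
have Dc0 : 0 <= D / c.
  by rewrite divr_ge0 ?(ltW c0)// mulr_ge0 ?powR_ge0// (le_trans _ CQ1).
have [|s [_ _ _ sc]] := @maximal_separated _ _ [set y | mdist x y <= r] e
    (Num.truncn (D / c)) e0.
  move=> s us sx ss; rewrite truncn_ge_nat ?Dc0// ler_pdivlMr//.
  apply: (@separated_bound x) => // y /sx /le_trans; apply.
  by rewrite (le_trans (ler_norm _))// lerDl.
have : F ([set y | mdist x y <= r] `&` \big[setI/setT]_(p <- s) ~` ball p e).
  apply: filterI => //; elim: {sc} s => [|p s ih].
    by rewrite big_nil; exact: filterT.
  by rewrite big_cons; apply: filterI.
move=> /filter_ex [q [/sc[p ps pq]]]; rewrite -bigcap_seq => /(_ p ps); exact.
Qed.

End ahlfors.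

(** * Telescoping the Poincare inequality *)

Section poincare_chaining.
Context {R : realType} {X : completeMetricType R}.
Variable mu : {outer_measure set X -> \bar R}.
Variables (Q CQ CP lam : R).
Hypothesis Q1 : 1 < Q.
Hypothesis CQ1 : 1 <= CQ.
Hypothesis CP0 : 0 < CP.
Hypothesis lam1 : 1 <= lam.
Hypothesis mmu : metric_measure_space mu.
Hypothesis amu : ahlfors_regular mu Q CQ.
Hypothesis pmu : poincare mu Q CP lam.
Implicit Types (x y z : X) (r e W : R).

Local Notation T := (caratheodory_type mu).
Local Notation nu := (cmeasure mu).

Let CQ0 : 0 < CQ. Proof. exact: lt_le_trans CQ1. Qed.
Let Q0 : 0 < Q. Proof. exact: lt_trans Q1. Qed.
Let lam0 : 0 < lam. Proof. exact: lt_le_trans lam1. Qed.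

Lemma integrable_lipschitz_ball (f : X -> R) (l : R) x r : lipschitz_with l f -> 0 < r ->
  nu.-integrable (ball x r) (EFin \o f).
Proof.
move=> lf r0; apply: measurable_bounded_integrable.
- exact: measurable_metric_ball.
- by have /andP[_ h] := amu x r0; apply: le_lt_trans h _; rewrite ltry.
- by apply: measurable_funTS; exact: (measurable_lipschitz mmu lf).
exists (`|f x| + `|l| * r); split; first exact: num_real.
move=> M ltM y; rewrite ballEmdist/= => xy; apply: le_trans (ltW ltM).
have -> : f y = f x + (f y - f x) by ring.
apply: le_trans (ler_normD _ _) _; rewrite lerD2l.
apply: le_trans (lf _ _) _; apply: (@le_trans _ _ (`|l| * mdist y x)).
  by rewrite ler_wpM2r ?mdist_ge0// ler_norm.
by rewrite ler_wpM2l// metric_sym ltW.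
Qed.

Definition ball_avg (f : X -> R) x r : R :=
  \int[nu]_(y in ball x r) f y / fine (mu (ball x r)).

Lemma mean_ball_EFin (f : X -> R) x r : 0 < r ->
  nu.-integrable (ball x r) (EFin \o f) ->
  mean mu (ball x r) (EFin \o f) = (ball_avg f x r)%:E.
Proof.
move=> r0 fi; have m0 := fine_mu_ball_gt0 CQ1 amu x r0.
have [_ mfin] := mu_ball_bounds amu x r0.
rewrite /mean /ball_avg /Rintegral -{1}(fineK mfin) inver gt_eqF//.
rewrite -[in LHS](fineK (integrable_fin_num (measurable_metric_ball mmu x r) fi)).
by rewrite -EFinM mulrC.
Qed.

Lemma ball_avg_sub_le (f : X -> R) x r y r' (a : R) : 0 < r -> 0 < r' ->
  ball y r' `<=` ball x r -> nu.-integrable (ball x r) (EFin \o f) ->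
  `|ball_avg f y r' - a| * fine (mu (ball y r')) <=
  \int[nu]_(z in ball x r) `|f z - a|.
Proof.
move=> r0 r'0 sub fi.
have mB := measurable_metric_ball mmu x r; have mB' := measurable_metric_ball mmu y r'.
have fi' : nu.-integrable (ball y r') (EFin \o f) by exact: integrableS fi.
have ica x1 r1 : 0 < r1 -> nu.-integrable (ball x1 r1) (EFin \o (fun=> a)).
  move=> r10; apply: (@integrable_lipschitz_ball _ 0) => // u v.
  by rewrite subrr normr0 mul0r.
have isub x1 r1 : 0 < r1 -> nu.-integrable (ball x1 r1) (EFin \o f) ->
    nu.-integrable (ball x1 r1) (EFin \o (fun z => f z - a)).
  move=> r10 fi1; have := integrableB (measurable_metric_ball mmu x1 r1) fi1 (ica x1 r1 r10).
  by apply: eq_integrable => //; exact: measurable_metric_ball.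
have m0 := fine_mu_ball_gt0 CQ1 amu y r'0.
have -> : `|ball_avg f y r' - a| * fine (mu (ball y r')) =
    `|\int[nu]_(z in ball y r') (f z - a)|.
  rewrite RintegralB//; last exact: ica.
  rewrite Rintegral_cst// -{1}(gtr0_norm m0) -normrM mulrBl.
  by rewrite /ball_avg divfK// gt_eqF.
apply: le_trans (le_normr_Rintegral mB' (isub _ _ r'0 fi')) _.
have iabs : nu.-integrable (ball x r) (EFin \o (fun z => `|f z - a|)).
  by have := integrable_abse (isub _ _ r0 fi).
rewrite /Rintegral; apply: fine_le.
- by apply: integrable_fin_num => //; exact: integrableS iabs.
- exact: integrable_fin_num.
- by apply: ge0_subset_integral => //; exact: measurable_int iabs.
Qed.

(** The factor before the parentheses bounds the ratio of the measures of two balls when the second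
    has at least half the radius of the first. The factor in parentheses bounds the mean oscillation
    when the energy is at most 1. *)
Definition chain_const : R := CQ ^+ 2 * 2 `^ Q * (CP * CQ `^ Q^-1).

Lemma chain_const_gt0 : 0 < chain_const.
Proof. by rewrite !mulr_gt0 ?exprn_gt0 ?powR_gt0. Qed.

Lemma ball_avg_compare (f h : X -> R) (l : R) x r y r' W :
  lipschitz_with l f -> upper_gradient f (EFin \o h) ->
  0 < r -> r / 2 <= r' -> ball y r' `<=` ball x r -> 0 <= W ->
  (\int[nu]_(z in ball x (lam * r)) ((h z)%:E `^ Q) <= (W `^ Q)%:E)%E ->
  `|ball_avg f y r' - ball_avg f x r| <= chain_const * W.
Proof.
move=> lf ug r0 rr' sub W0 HW.
have r'0 : 0 < r' by apply: lt_le_trans rr'; rewrite divr_gt0.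
have lr0 : 0 < lam * r by rewrite mulr_gt0.
have fi := integrable_lipschitz_ball x lf r0.
have [/andP[mlo _] mfin'] := mu_ball_bounds amu y r'0.
have [/andP[_ mup] mfin] := mu_ball_bounds amu x r0.
have [/andP[llo _] lfin] := mu_ball_bounds amu x lr0.
have m0 := fine_mu_ball_gt0 CQ1 amu x r0.
have m0' := fine_mu_ball_gt0 CQ1 amu y r'0.
have ml0 := fine_mu_ball_gt0 CQ1 amu x lr0.
set a := ball_avg f x r.
have osc : \int[nu]_(z in ball x r) `|f z - a| <=
    fine (mu (ball x r)) * (CP * CQ `^ Q^-1 * W).
  have fint x1 r1 : 0 < r1 -> integrable_on mu (ball x1 r1) f.
    exact: integrable_lipschitz_ball lf.
  have [_ /(_ f (EFin \o h) fint ug x r r0)] := pmu.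
  rewrite mean_ball_EFin// -/a.
  have e0 : (mean mu (ball x r) (fun y0 => `|(f y0)%:E - a%:E|) =
      (ball_avg (fun z => `|f z - a|)%R x r)%:E)%E.
    rewrite -mean_ball_EFin//.
    apply: (@integrable_lipschitz_ball _ l) => // u v.
    by apply: le_trans (ler_dist_dist _ _) _; rewrite opprB addrA subrK.
  rewrite e0 => H.
  have Qi0 : 0 <= Q^-1 by rewrite invr_ge0 ltW.
  (* The exponent of the energy is the dimension, so the 1 / r obtained here cancels the factor r of
     the Poincare inequality: the estimate is scale invariant. *)
  have bnd : (W `^ Q / fine (mu (ball x (lam * r)))) <= (W * CQ `^ Q^-1 / r) `^ Q.
    rewrite !powRM ?mulr_ge0 ?powR_ge0 ?invr_ge0 ?(ltW r0)//.
    rewrite -powRrM mulVf ?gt_eqF// powRr1 ?(ltW CQ0)// -mulrA.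
    rewrite ler_wpM2l ?powR_ge0//.
    rewrite -(powR_inv1 (ltW r0)) -powRrM mulN1r powRN.
    rewrite -[leRHS]invrK lef_pV2 ?posrE ?invr_gt0 ?divr_gt0 ?powR_gt0//.
    rewrite invfM invrK; apply: le_trans llo.
    rewrite [leLHS]mulrC ler_wpM2r ?invr_ge0 ?(ltW CQ0)//.
    by apply: ge0_ler_powR; rewrite ?nnegrE ?(ltW Q0) ?(ltW r0) ?(ltW lr0)// ler_peMl// ltW.
  have {H} : ((ball_avg (fun z => `|f z - a|)%R x r)%:E <=
      (CP * r)%:E * (W * CQ `^ Q^-1 / r)%:E)%E.
    apply: le_trans H _; apply: lee_wpmul2l; first by rewrite lee_fin mulr_ge0// ltW.
    have -> : (W * CQ `^ Q^-1 / r)%:E = (((W * CQ `^ Q^-1 / r) `^ Q)%:E `^ Q^-1)%E.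
      rewrite poweR_EFin -powRrM divff ?gt_eqF// powRr1//.
      by rewrite !mulr_ge0 ?powR_ge0 ?invr_ge0 ?(ltW r0).
    have mean_le : (mean mu (ball x (lam * r)) (fun y0 => (EFin \o h) y0 `^ Q) <=
        ((W * CQ `^ Q^-1 / r) `^ Q)%:E)%E.
      rewrite /mean -(fineK lfin) inver gt_eqF//.
      apply: (@le_trans _ _ ((fine (mu (ball x (lam * r))))^-1%:E * (W `^ Q)%:E)%E).
        by rewrite lee_wpmul2l// lee_fin invr_ge0 ltW.
      by rewrite -EFinM lee_fin mulrC.
    apply: gt0_ler_poweR => //; rewrite in_itv/= ?leey ?andbT.
      rewrite /mean mule_ge0 ?inve_ge0 ?outer_measure_ge0//.
      by apply: integral_ge0 => z _; rewrite lee_fin powR_ge0.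
    by rewrite lee_fin powR_ge0.
  rewrite -EFinM lee_fin /ball_avg ler_pdivrMr// => H.
  apply: le_trans H _; rewrite mulrC ler_wpM2l ?(ltW m0)//.
  have -> // : CP * r * (W * CQ `^ Q^-1 / r) = CP * CQ `^ Q^-1 * W.
  by field; rewrite gt_eqF.
have := le_trans (ball_avg_sub_le a r0 r'0 sub fi) osc.
rewrite -ler_pdivlMr// => /le_trans; apply.
rewrite ler_pdivrMr// mulrC mulrAC /chain_const.
have -> : CQ ^+ 2 * 2 `^ Q * (CP * CQ `^ Q^-1) * W * fine (mu (ball y r')) =
  (CP * CQ `^ Q^-1 * W) * (CQ ^+ 2 * 2 `^ Q * fine (mu (ball y r'))) by ring.
rewrite [leLHS](_ : _ = (CP * CQ `^ Q^-1 * W) * fine (mu (ball x r))); last by ring.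
rewrite ler_wpM2l ?mulr_ge0 ?powR_ge0 ?(ltW CP0)//; apply: le_trans mup _.
rewrite expr2 -!mulrA ler_wpM2l ?(ltW CQ0)//.
apply: (@le_trans _ _ (2 `^ Q * r' `^ Q)).
  rewrite -powRM ?(ltW r'0)//; apply: ge0_ler_powR; rewrite ?nnegrE ?(ltW Q0) ?(ltW r0)//.
    by rewrite mulr_ge0// ltW.
  by rewrite -ler_pdivrMl// mulrC.
rewrite mulrCA ler_wpM2l ?powR_ge0//.
by move: mlo; rewrite ler_pdivrMr// mulrC.
Qed.

(** Summable, so that the oscillations at all scales add up, but slower than any geometric sequence,
    so that the contents of the points violating the energy bound at scale i are summable over i for
    every exponent. *)
Definition chain_weight i : R := i.+1%:R ^- 2.

Lemma chain_weight_gt0 i : 0 < chain_weight i.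
Proof. by rewrite invr_gt0 exprn_gt0. Qed.

Lemma chain_weight_nincr i : chain_weight i.+1 <= chain_weight i.
Proof.
rewrite lef_pV2 ?posrE ?exprn_gt0//.
by rewrite ler_pXn2r ?nnegrE// ler_nat.
Qed.

Lemma sum_chain_weight n : \sum_(0 <= i < n) chain_weight i <= 2.
Proof.
suff H : \sum_(0 <= i < n.+1) chain_weight i <= 2 - n.+1%:R^-1.
  apply: (@le_trans _ _ (2 - n.+1%:R^-1)); last by rewrite gerBl invr_ge0.
  apply: le_trans H; rewrite big_nat_recr//= lerDl; exact/ltW/chain_weight_gt0.
elim: n => [|n ih]; first by rewrite big_nat1 /chain_weight expr1n invr1; lra.
rewrite big_nat_recr//=; apply: le_trans (lerD ih (lexx _)) _.
rewrite /chain_weight.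
have n0 : 0 < n.+1%:R :> R by rewrite ltr0n.
have n1 : 0 < n.+2%:R :> R by rewrite ltr0n.
have : 0 <= n.+1%:R^-1 - n.+2%:R^-1 - n.+2%:R ^- 2 :> R.
  rewrite -[n.+2%:R]natr1 in n1 *.
  have -> : n.+1%:R^-1 - (n.+1%:R + 1)^-1 - (n.+1%:R + 1) ^- 2 =
      (n.+1%:R * (n.+1%:R + 1) ^+ 2)^-1 :> R.
    by field; rewrite !gt_eqF.
  by rewrite invr_ge0 mulr_ge0 ?exprn_ge0 ?ltW.
by move: (n.+1%:R^-1) (n.+2%:R^-1) (n.+2%:R ^- 2) => a b c; lra.
Qed.

Definition dyadic_radius (r : R) i := r / 2 ^+ i.

Lemma dyadic_radius_gt0 r i : 0 < r -> 0 < dyadic_radius r i.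
Proof. by move=> r0; rewrite divr_gt0// exprn_gt0. Qed.

Lemma dyadic_radiusS r i : dyadic_radius r i.+1 = dyadic_radius r i / 2.
Proof. by rewrite /dyadic_radius exprSr invfM mulrA. Qed.

Lemma ball_avg_cvg_point (f : X -> R) (l : R) x r : lipschitz_with l f -> 0 < r ->
  `|ball_avg f x r - f x| <= `|l| * r.
Proof.
move=> lf r0; have m0 := fine_mu_ball_gt0 CQ1 amu x r0.
have fi := integrable_lipschitz_ball x lf r0.
have := ball_avg_sub_le (f x) r0 r0 (@subset_refl _ _) fi.
rewrite -ler_pdivlMr// => /le_trans; apply; rewrite ler_pdivrMr//.
rewrite -[leRHS]Rintegral_cst//; last exact: measurable_metric_ball.
apply: le_Rintegral.
- exact: measurable_metric_ball.
- apply: (@integrable_lipschitz_ball _ l) => // u v.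
  by apply: le_trans (ler_dist_dist _ _) _; rewrite opprB addrA subrK.
- apply: (@integrable_lipschitz_ball _ 0) => // u v.
  by rewrite subrr normr0 mul0r.
move=> y; rewrite ballEmdist/= => xy; apply: le_trans (lf _ _) _.
rewrite metric_sym (@le_trans _ _ (`|l| * mdist x y))//.
  by rewrite ler_wpM2r ?mdist_ge0// ler_norm.
by rewrite ler_wpM2l// ltW.
Qed.

Definition good_at (g : X -> \bar R) (eta : R) x r := forall i,
  (\int[nu]_(z in ball x (lam * dyadic_radius r i)) (g z `^ Q) <=
   ((eta * chain_weight i) `^ Q)%:E)%E.

(** As f is Lipschitz, the averages over dyadic balls tend to the value at x itself, so the estimate
    holds at every good point and not just almost everywhere. *)
Lemma telescope_ball_avg (f h : X -> R) (l eta : R) x r :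
  lipschitz_with l f -> upper_gradient f (EFin \o h) -> 0 < r -> 0 <= eta ->
  good_at (EFin \o h) eta x r ->
  `|f x - ball_avg f x r| <= 2 * chain_const * eta.
Proof.
move=> lf ug r0 eta0 Hg.
have C0 := chain_const_gt0.
have step n : `|ball_avg f x (dyadic_radius r n) - ball_avg f x r| <=
    chain_const * eta * \sum_(0 <= i < n) chain_weight i.
  elim: n => [|n ih].
    by rewrite /dyadic_radius expr0 divr1 subrr normr0 big_geq// mulr0.
  have -> : ball_avg f x (dyadic_radius r n.+1) - ball_avg f x r =
    (ball_avg f x (dyadic_radius r n.+1) - ball_avg f x (dyadic_radius r n)) +
    (ball_avg f x (dyadic_radius r n) - ball_avg f x r) by ring.
  apply: le_trans (ler_normD _ _) _.
  rewrite big_nat_recr//= mulrDr addrC; apply: lerD => //.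
  rewrite -mulrA; apply: (ball_avg_compare lf ug) => //.
  - exact: dyadic_radius_gt0.
  - by rewrite dyadic_radiusS.
  - apply: le_ball; rewrite dyadic_radiusS ler_pdivrMr// ler_peMr//.
      exact/ltW/dyadic_radius_gt0.
    by rewrite ler1n.
  - by rewrite mulr_ge0// ltW// chain_weight_gt0.
apply/ler_addgt0Pr => e e0.
have [n Hn] : exists n, `|l| * dyadic_radius r n <= e.
  pose n := (Num.truncn (`|l| * r / e)).+1; exists n.
  rewrite /dyadic_radius mulrA ler_pdivrMr ?exprn_gt0// -ler_pdivrMl// mulrC.
  apply/ltW; apply: lt_le_trans (truncnS_gt _) _.
  by rewrite -natrX ler_nat ltnW// ltn_expl.
have -> : f x - ball_avg f x r =
   - (ball_avg f x (dyadic_radius r n) - f x) +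
   (ball_avg f x (dyadic_radius r n) - ball_avg f x r) by ring.
apply: le_trans (ler_normD _ _) _; rewrite addrC normrN; apply: lerD.
  apply: le_trans (step n) _; rewrite mulrC mulrA ler_wpM2r//.
  by rewrite ler_wpM2r ?(ltW C0)// sum_chain_weight.
exact: le_trans (ball_avg_cvg_point _ lf (dyadic_radius_gt0 _ r0)) Hn.
Qed.

(** 5 = 2 + 2 + 1: a telescoping sum at each point, and the comparison of B(y, r / 2) with the ball
    B(x, r) that contains it. *)
Lemma two_point_estimate (f h : X -> R) (l eta : R) x y r :
  lipschitz_with l f -> upper_gradient f (EFin \o h) -> 0 < r -> 0 <= eta ->
  mdist x y <= r / 2 ->
  good_at (EFin \o h) eta x r -> good_at (EFin \o h) eta y r ->
  `|f x - f y| <= 5 * chain_const * eta.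
Proof.
move=> lf ug r0 eta0 xy gx gy.
have C0 := chain_const_gt0.
have r20 : 0 < r / 2 by rewrite divr_gt0.
have gy' : good_at (EFin \o h) eta y (r / 2).
  move=> i; have -> : dyadic_radius (r / 2) i = dyadic_radius r i.+1.
    by rewrite /dyadic_radius exprS invfM mulrA.
  apply: le_trans (gy i.+1) _; rewrite lee_fin.
  apply: ge0_ler_powR; rewrite ?nnegrE ?(ltW Q0) ?mulr_ge0// ?(ltW (chain_weight_gt0 _))//.
  by rewrite ler_wpM2l// chain_weight_nincr.
have h1 := telescope_ball_avg lf ug r0 eta0 gx.
have h2 := telescope_ball_avg lf ug r20 eta0 gy'.
have h3 : `|ball_avg f y (r / 2) - ball_avg f x r| <= chain_const * eta.
  apply: (ball_avg_compare lf ug) => //.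
    move=> z; rewrite !ballEmdist/= => yz.
    by apply: le_lt_trans (metric_triangle x y z) _; move: xy yz; lra.
  have := gx 0%N; rewrite /dyadic_radius /chain_weight expr0 divr1.
  by rewrite expr1n invr1 mulr1.
move: h1 h2 h3; rewrite !ler_norml => /andP[a1 a2] /andP[a3 a4] /andP[a5 a6].
by apply/andP; split; lra.
Qed.

Lemma good_at_le (g g' : X -> \bar R) (eta : R) x r :
  (forall z, 0 <= g z)%E -> (forall z, g z <= g' z)%E ->
  measurable_fun setT (g : T -> \bar R) -> measurable_fun setT (g' : T -> \bar R) ->
  good_at g' eta x r -> good_at g eta x r.
Proof.
move=> g0 gg' mg mg' H i; apply: le_trans (H i).
apply: ge0_le_integral => //.
- exact: measurable_metric_ball.
- by move=> z _; exact: poweR_ge0.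
- by apply: measurable_funTS; exact: measurableT_comp (measurable_poweR _) mg.
- by apply: measurable_funTS; exact: measurableT_comp (measurable_poweR _) mg'.
move=> z _; apply: gt0_ler_poweR => //; first exact: ltW.
  by rewrite in_itv/= g0 leey.
by rewrite in_itv/= leey (le_trans (g0 z)).
Qed.

(** The two point estimate is applied to the potential [cost_dist g n x], which vanishes at x and
    has an upper gradient below g. The bound is uniform in n, as the limit over chains requires. *)
Lemma cost_dist_le_good (g : X -> \bar R) (eta : R) n x y r :
  (forall z, 0 <= g z)%E -> lower_semicontinuous g -> 0 < r -> 0 <= eta ->
  mdist x y <= r / 2 -> good_at g eta x r -> good_at g eta y r ->
  cost_dist g n x y <= 5 * chain_const * eta.
Proof.
move=> g0 lsc r0 eta0 xy gx gy.
have mg : measurable_fun setT (g : T -> \bar R).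
  exact: (borel_measurable_fun mmu (measurable_lsc lsc)).
have mh : measurable_fun setT ((EFin \o lip_approx g n.+1) : T -> \bar R).
  apply/measurable_EFinP; apply: (measurable_lipschitz mmu).
  exact: lip_approx_lipschitz.
have H z : good_at g eta z r -> good_at (EFin \o lip_approx g n.+1) eta z r.
  apply: good_at_le => // w; first by rewrite lee_fin lip_approx_ge0.
  exact: lip_approx_le.
have := @two_point_estimate (cost_dist g n x) (lip_approx g n.+1) _ eta x y r
  (cost_dist_lipschitz g0 n x) (upper_gradient_cost_dist g0 n x) r0 eta0 xy
  (H _ gx) (H _ gy).
by rewrite cost_distxx// sub0r normrN ger0_norm// cost_dist_ge0.
Qed.

End poincare_chaining.

Lemma sqrnS_le_expn i : (i.+1 ^ 2 <= 4 * 2 ^ i)%N.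
Proof.
(* The second inequality bounds the increment of (i + 1)^2 and carries the induction. *)
suff /andP[] : (i.+1 ^ 2 <= 4 * 2 ^ i)%N && (2 * i + 3 <= 4 * 2 ^ i)%N by [].
elim: i => // i /andP[h1 h2].
have -> : (i.+2 ^ 2 = i.+1 ^ 2 + (2 * i + 3))%N by rewrite -!mulnn; lia.
have h3 : (0 < 2 ^ i)%N by rewrite expn_gt0.
rewrite (expnS 2 i).
by move: (i.+1 ^ 2)%N (2 ^ i)%N h1 h2 h3 => u v; lia.
Qed.

Lemma expr2V_le_chain_weight {R : realType} i : 2 ^- i <= 4 * chain_weight i :> R.
Proof.
rewrite /chain_weight ler_pdivlMr ?exprn_gt0// mulrC ler_pdivrMr ?exprn_gt0//.
by rewrite -!natrX -natrM ler_nat sqrnS_le_expn.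
Qed.

(** * Measurability and monotonicity of line integrals *)

Section line_integral_monotone.
Context {R : realType} {X : completeMetricType R}.
Implicit Types (gamma : R -> X) (a b t : R) (f g rho : X -> \bar R).

Lemma measurable_fun_arclength gamma a b g : rectifiable_curve gamma a b ->
  measurable_fun setT (g : g_sigma_algebraType (@open X) -> \bar R) ->
  measurable_fun `[0, fine (curve_length gamma a b)]
    (g \o arclength_param gamma a b).
Proof.
move=> rg mg; set L := fine _; set s1 := arclength_param _ _ _.
have L0 : 0 <= L by rewrite fine_ge0// curve_length_ge0//; case: rg.
(* The parametrization is controlled on [0, L] only; clamping its argument gives a continuous
   function on the whole line. *)
pose k t := Num.max 0 (Num.min t L).
have k01 t : 0 <= k t <= L.
  by rewrite /k le_max lexx/= ge_max L0/= ge_min lexx orbT.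
have klip t t' : t <= t' -> k t <= k t' /\ k t' - k t <= t' - t.
  move=> tt'; have [h1 h2] : Num.min t L <= Num.min t' L /\
      Num.min t' L - Num.min t L <= t' - t.
    by case: (leP t L) => h1; case: (leP t' L) => h2; split; lra.
  rewrite /k; move: (Num.min t L) (Num.min t' L) h1 h2 => u v h1 h2.
  by case: (leP 0 u) => h3; case: (leP 0 v) => h4; split; lra.
have kid t : `[0, L]%classic t -> k t = t.
  by rewrite /= in_itv/= /k => /andP[t0 tL]; rewrite min_l// max_r.
have cs : continuous (s1 \o k).
  move=> t A; rewrite /= -nbhs_ballE => -[e /= e0 eA].
  exists e => //= t'; rewrite /ball_ => tt'; apply: eA; rewrite ballEmdist/=.
  have H u v : u <= v -> mdist (s1 (k u)) (s1 (k v)) <= v - u.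
    move=> uv; have [h1 h2] := klip _ _ uv; apply: le_trans h2.
    have /andP[? ?] := k01 u; have /andP[? ?] := k01 v.
    exact: arclength_param_lip.
  have [h|/ltW h] := leP t t'.
    by apply: le_lt_trans (H _ _ h) _; apply: le_lt_trans tt'; rewrite distrC ler_norm.
  rewrite metric_sym; apply: le_lt_trans (H _ _ h) _.
  by apply: le_lt_trans tt'; rewrite ler_norm.
have ms : measurable_fun setT (s1 \o k : R -> g_sigma_algebraType (@open X)).
  apply: (@measurability _ _ (measurableTypeR R) (g_sigma_algebraType (@open X))
    setT (s1 \o k) (@open X)) => //.
  move=> _ [U oU <-]; rewrite setTI; apply: open_measurable.
  by move/continuousP : cs; exact.
have mgs : measurable_fun `[0, L] (g \o (s1 \o k)).
  by apply: measurable_funTS; exact: measurableT_comp mg ms.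
apply: eq_measurable_fun mgs => t; rewrite inE => /kid /= kt.
by rewrite /= kt.
Qed.

Lemma le_line_integral gamma a b rho g : rectifiable_curve gamma a b ->
  measurable_fun setT (rho : g_sigma_algebraType (@open X) -> \bar R) ->
  measurable_fun setT (g : g_sigma_algebraType (@open X) -> \bar R) ->
  (forall x, (0 <= rho x)%E) ->
  (forall t, a <= t <= b -> (rho (gamma t) <= g (gamma t))%E) ->
  (line_integral rho gamma a b <= line_integral g gamma a b)%E.
Proof.
move=> rg mr mg r0 H; rewrite /line_integral; apply: ge0_le_integral => //.
- exact: measurable_fun_arclength mr.
- exact: measurable_fun_arclength mg.
move=> s; rewrite /= in_itv/= => sL.
by have [t [tab _ ->]] := arclength_paramP rg sL; exact: H.
Qed.

Lemma line_integralZ gamma a b rho (c : R) : rectifiable_curve gamma a b ->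
  measurable_fun setT (rho : g_sigma_algebraType (@open X) -> \bar R) ->
  (forall x, (0 <= rho x)%E) -> 0 <= c ->
  line_integral (fun x => c%:E * rho x)%E gamma a b =
  (c%:E * line_integral rho gamma a b)%E.
Proof.
move=> rg mr r0 c0; rewrite /line_integral ge0_integralZl//.
exact: measurable_fun_arclength mr.
Qed.

End line_integral_monotone.

(** * Curves between good points, and the logarithmic penalty *)

Section connect_good_points.
Context {R : realType} {X : completeMetricType R}.
Variable mu : {outer_measure set X -> \bar R}.
Variables (Q CQ CP lam : R).
Hypothesis Q1 : 1 < Q.
Hypothesis CQ1 : 1 <= CQ.
Hypothesis CP0 : 0 < CP.
Hypothesis lam1 : 1 <= lam.
Hypothesis mmu : metric_measure_space mu.
Hypothesis amu : ahlfors_regular mu Q CQ.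
Hypothesis pmu : poincare mu Q CP lam.
Implicit Types (x y z : X) (r e d eta : R).

Local Notation T := (caratheodory_type mu).
Local Notation nu := (cmeasure mu).

Let CQ0 : 0 < CQ. Proof. exact: lt_le_trans CQ1. Qed.
Let Q0 : 0 < Q. Proof. exact: lt_trans Q1. Qed.
Let lam0 : 0 < lam. Proof. exact: lt_le_trans lam1. Qed.

(** Makes the bound [5 * chain_const * eta] equal to 1 / 4, below the cost 1 / 2 allowed to the
    curves. *)
Definition good_level : R := (20 * chain_const Q CQ CP)^-1.

Lemma good_level_gt0 : 0 < good_level.
Proof. by rewrite invr_gt0 mulr_gt0//; exact: chain_const_gt0. Qed.

Lemma good_points_curve (g : X -> \bar R) x y r d :
  (forall z, 0 <= g z)%E -> lower_semicontinuous g -> 0 < d -> d <= 1 ->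
  (forall z, d%:E <= g z)%E -> 0 < r -> mdist x y <= r / 2 ->
  good_at mu Q lam g good_level x r -> good_at mu Q lam g good_level y r ->
  exists gamma : R -> X, [/\ gamma 0 = x, gamma 2^-1 = y,
    forall t t', 0 <= t -> t <= t' -> t' <= 2^-1 ->
      d * mdist (gamma t) (gamma t') <= t' - t &
    forall a b, 0 <= a -> a <= b -> b <= 2^-1 ->
      rectifiable_curve gamma a b /\
      (line_integral g gamma a b <= (b - a)%:E)%E].
Proof.
move=> g0 lsc d0 d1 dg r0 xy gx gy.
have lt n : cost_dist g n x y < 2^-1.
  have := cost_dist_le_good Q1 CQ1 CP0 lam1 mmu amu pmu n g0 lsc r0
    (ltW good_level_gt0) xy gx gy.
  move/le_lt_trans; apply; have C0 := chain_const_gt0 Q CQ1 CP0.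
  rewrite (_ : _ * good_level = 4^-1); first lra.
  by rewrite /good_level; field; rewrite gt_eqF.
have h2 : 0 < (2^-1 : R) <= 1 by rewrite invr_gt0 ltr0n invf_le1 ?ltr0n// ler1n.
have [gamma [g1 g2 Hg]] := exists_cost_curve g0 (proper_space CQ1 mmu amu) d0 d1 dg h2 lt.
exists gamma; split=> // [t t' t0 tt' t'2|a b a0 ab b2].
  apply: le_trans (Hg 0%N t t' t0 tt' t'2).
  by apply: cost_dist_ge => //; exact: ltW.
apply: (line_integral_cost_dist g0 d0 d1 dg ab lsc) => n t t' at_ tt' t'b.
apply: Hg => //; first exact: le_trans at_.
exact: le_trans b2.
Qed.

Lemma integral_powR_le_ball (g : X -> \bar R) (A : set X) x r c :
  measurable (A : set T) -> A `<=` ball x r -> 0 < r -> 0 <= c ->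
  (forall z, 0 <= g z)%E -> measurable_fun setT (g : T -> \bar R) ->
  (forall z, A z -> (g z <= c%:E)%E) ->
  (\int[nu]_(z in A) (g z `^ Q) <= (CQ * (c * r) `^ Q)%:E)%E.
Proof.
move=> mA Ax r0 c0 g0 mg gc.
apply: (@le_trans _ _ (\int[nu]_(z in A) (cst (c `^ Q)%:E z))%E).
  apply: ge0_le_integral => //.
  - by move=> z _; exact: poweR_ge0.
  - by apply: measurable_funTS; exact: measurableT_comp (measurable_poweR _) mg.
  move=> z Az; rewrite /= -poweR_EFin; apply: gt0_ler_poweR; rewrite ?(ltW Q0)//.
  - by rewrite in_itv/= g0 leey.
  - by rewrite in_itv/= lee_fin c0 leey.
  - exact: gc.
rewrite integral_cst//; apply: (@le_trans _ _ ((c `^ Q)%:E * mu (ball x r))%E).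
  apply: lee_wpmul2l; first by rewrite lee_fin powR_ge0.
  exact: le_outer_measure.
have /andP[_ h] := amu x r0.
rewrite powRM ?(ltW r0)// mulrCA EFinM.
by apply: lee_wpmul2l; rewrite ?lee_fin ?powR_ge0.
Qed.

Section log_penalty.
Variables (O : X) (kap rad s : R).
Hypothesis kap0 : 0 < kap.
Hypothesis s0 : 0 < s.
Hypothesis srad : s <= rad.

Let rad0 : 0 < rad. Proof. exact: lt_le_trans srad. Qed.

Definition clamped_norm z : R := Num.min rad (Num.max (mdist O z) s).

(* With kap = 2 / m and s = 2^-m rad, crossing from radius rad / 4 to radius s
   costs more than 1 / 2, whereas the energy is of order m^(1 - Q). *)
Definition log_penalty z : R := kap / clamped_norm z.

Lemma clamped_norm_ge z : s <= clamped_norm z.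
Proof. by rewrite /clamped_norm le_min srad le_max lexx orbT. Qed.

Let cn0 z : 0 < clamped_norm z.
Proof. exact: lt_le_trans (clamped_norm_ge z). Qed.

Lemma log_penalty_ge0 z : 0 <= log_penalty z.
Proof. by rewrite divr_ge0 ?ltW. Qed.

Lemma log_penalty_ge z : kap / rad <= log_penalty z.
Proof.
by rewrite ler_pM2l// lef_pV2 ?posrE// /clamped_norm ge_min lexx.
Qed.

Lemma log_penalty_le z : log_penalty z <= kap / s.
Proof. by rewrite ler_pM2l// lef_pV2 ?posrE// clamped_norm_ge. Qed.

Lemma log_penalty_le_div z q : 0 < q -> q <= rad -> q <= mdist O z ->
  log_penalty z <= kap / q.
Proof.
move=> q0 qr qz; rewrite ler_pM2l// lef_pV2 ?posrE//.
by rewrite /clamped_norm le_min qr le_max qz.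
Qed.

Let max_lip y z : `|Num.max (mdist O y) s - Num.max (mdist O z) s| <= mdist y z.
Proof.
have := mdist_lipschitz O y z; rewrite mul1r.
rewrite !ler_norml => /andP[h1 h2]; move: (mdist_ge0 y z) => h3.
by case: (leP (mdist O y) s) => h4; case: (leP (mdist O z) s) => h5;
  apply/andP; split; lra.
Qed.

Let cn_lip y z : `|clamped_norm y - clamped_norm z| <= mdist y z.
Proof.
have := max_lip y z; rewrite /clamped_norm.
move: (Num.max _ s) (Num.max _ s) (mdist_ge0 y z) => u v h3.
rewrite !ler_norml => /andP[h1 h2].
by case: (leP rad u) => h4; case: (leP rad v) => h5; apply/andP; split; lra.
Qed.

Lemma log_penalty_lipschitz : lipschitz_with (kap / s ^+ 2) log_penalty.
Proof.
move=> y z; have h := cn_lip y z.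
have -> : log_penalty y - log_penalty z =
    kap * ((clamped_norm z - clamped_norm y) / (clamped_norm y * clamped_norm z)).
  by rewrite /log_penalty; field; rewrite !gt_eqF.
rewrite normrM (gtr0_norm kap0) -mulrA ler_pM2l// normrM distrC.
rewrite mulrC; apply: ler_pM => //.
rewrite ger0_norm ?invr_ge0 ?mulr_ge0 ?(ltW (cn0 _))//.
rewrite lef_pV2 ?posrE ?mulr_gt0// expr2.
by apply: ler_pM; rewrite ?(ltW s0) ?clamped_norm_ge.
Qed.

(** The antiderivative in the radius of kap over the norm: its variation between two points bounds
    from below the penalty paid by a curve joining them. *)
Definition log_potential z : R := kap * ln (Num.max (mdist O z) s).

Lemma upper_gradient_log_potential : upper_gradient log_potential (EFin \o log_penalty).
Proof.
apply: (@upper_gradient_lipschitz _ _ _ _ (kap / s ^+ 2) 1) => //.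
- by rewrite divr_ge0 ?exprn_ge0 ?ltW.
- exact: log_penalty_ge0.
- exact: log_penalty_lipschitz.
move=> p q _; set u := Num.max (mdist O p) s; set v := Num.max (mdist O q) s.
have u0 : 0 < u by rewrite lt_max s0 orbT.
have v0 : 0 < v by rewrite lt_max s0 orbT.
have kv : kap / v <= log_penalty q.
  by rewrite ler_pM2l// lef_pV2 ?posrE// /clamped_norm ge_min lexx orbT.
have h : log_potential p - log_potential q <= kap / v * (u - v).
  rewrite /log_potential -/u -/v -mulrBr -mulrA ler_pM2l//.
  rewrite -ln_div ?posrE//.
  have -> : u / v = 1 + v^-1 * (u - v) by field; rewrite gt_eqF.
  apply: le_ln1Dx; rewrite mulrBr mulVf ?gt_eqF// ltrBrDr addrC subrr.
  by rewrite mulr_gt0// invr_gt0.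
have [uv|vu] := leP u v.
  apply: (@le_trans _ _ 0).
    apply: le_trans h _; rewrite mulr_ge0_le0 ?subr_le0//.
    by rewrite divr_ge0// ltW.
  by rewrite mulr_ge0 ?mdist_ge0// le_max log_penalty_ge0.
apply: le_trans h _; apply: ler_pM.
- by rewrite divr_ge0 ?ltW.
- by rewrite subr_ge0 ltW.
- by rewrite le_max kv orbT.
- by apply: le_trans (max_lip p q); exact: ler_norm.
Qed.

Let mpen : measurable_fun setT ((EFin \o log_penalty) : T -> \bar R).
Proof.
by apply/measurable_EFinP; exact: (measurable_lipschitz mmu log_penalty_lipschitz).
Qed.

Let pen_EFin_ge0 z : (0 <= (EFin \o log_penalty) z)%E.
Proof. by rewrite lee_fin log_penalty_ge0. Qed.

Let mpenQ (D : set X) :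
  measurable_fun (D : set T) ((fun z => (EFin \o log_penalty) z `^ Q)%E : T -> \bar R).
Proof.
by apply: measurable_funTS; exact: measurableT_comp (measurable_poweR _) mpen.
Qed.

(** The exponent is the dimension, so each dyadic shell contributes the same amount and the energy
    is linear in the depth k. *)
Lemma integral_log_penalty_core k : 2 ^+ k * s <= rad ->
  (\int[nu]_(z in ball O (2 ^+ k * s)) ((EFin \o log_penalty) z `^ Q) <=
    (CQ * kap `^ Q * (1 + k%:R * 2 `^ Q))%:E)%E.
Proof.
elim: k => [|k ih] hk.
  rewrite expr0 mul1r mul0r addr0 mulr1.
  have := @integral_powR_le_ball (EFin \o log_penalty) (ball O s) O s (kap / s)
    (measurable_metric_ball mmu _ _) (@subset_refl _ _) s0 _ pen_EFin_ge0 mpen _.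
  rewrite divfK ?gt_eqF//; apply; first by rewrite divr_ge0 ?ltW.
  by move=> z _; rewrite lee_fin log_penalty_le.
have k0 : 0 < 2 ^+ k * s by rewrite mulr_gt0 ?exprn_gt0.
have kk : 2 ^+ k * s <= 2 ^+ k.+1 * s.
  by rewrite ler_pM2r// ler_eXn2l ?ltr1n.
have kS : 0 < 2 ^+ k.+1 * s by rewrite mulr_gt0 ?exprn_gt0.
have sub : ball O (2 ^+ k * s) `<=` ball O (2 ^+ k.+1 * s) by exact: le_ball.
rewrite -(setDUK sub) ge0_integral_setU//; last 4 first.
- exact: measurable_metric_ball.
- by apply: measurableD; exact: measurable_metric_ball.
- by move=> z _; exact: poweR_ge0.
- by rewrite disj_set2E setDIK.
have -> : CQ * kap `^ Q * (1 + k.+1%:R * 2 `^ Q) =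
  CQ * kap `^ Q * (1 + k%:R * 2 `^ Q) + CQ * (kap / (2 ^+ k * s) * (2 ^+ k.+1 * s)) `^ Q.
  have -> : kap / (2 ^+ k * s) * (2 ^+ k.+1 * s) = kap * 2.
    by rewrite exprS; field; rewrite !gt_eqF ?exprn_gt0.
  by rewrite powRM ?(ltW kap0)// -natr1; ring.
rewrite EFinD; apply: leeD; first by apply: ih; exact: le_trans hk.
apply: (@integral_powR_le_ball _ _ O) => //.
- by apply: measurableD; exact: measurable_metric_ball.
- by rewrite divr_ge0 ?ltW.
move=> z [_ nz]; rewrite lee_fin; apply: log_penalty_le_div => //.
  exact: le_trans hk.
by move: nz; rewrite ballEmdist/= leNgt => /negP.
Qed.

Lemma integral_log_penalty_ball k c : 2 ^+ k * s = rad -> 1 <= c ->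
  (\int[nu]_(z in ball O (c * rad)) ((EFin \o log_penalty) z `^ Q) <=
    (CQ * (2 * c * kap) `^ Q * (k%:R + 2))%:E)%E.
Proof.
move=> hk c1; have c0 : 0 < c by exact: lt_le_trans c1.
have sub : ball O rad `<=` ball O (c * rad).
  by apply: le_ball; rewrite ler_peMl// ltW.
rewrite -(setDUK sub) ge0_integral_setU//; last 4 first.
- exact: measurable_metric_ball.
- by apply: measurableD; exact: measurable_metric_ball.
- by move=> z _; exact: poweR_ge0.
- by rewrite disj_set2E setDIK.
have := integral_log_penalty_core (_ : 2 ^+ k * s <= rad); rewrite hk => /(_ (lexx _)) H1.
have cr0 : 0 < c * rad by rewrite mulr_gt0.
have H2 : (\int[nu]_(z in ball O (c * rad) `\` ball O rad)
    ((EFin \o log_penalty) z `^ Q) <= (CQ * (kap / rad * (c * rad)) `^ Q)%:E)%E.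
  apply: (@integral_powR_le_ball _ _ O) => //.
  - by apply: measurableD; exact: measurable_metric_ball.
  - by rewrite divr_ge0 ?ltW.
  move=> z [_ nz]; rewrite lee_fin; apply: log_penalty_le_div => //.
  by move: nz; rewrite ballEmdist/= leNgt => /negP.
apply: le_trans (leeD H1 H2) _; rewrite -EFinD lee_fin.
have -> : kap / rad * (c * rad) = kap * c by field; rewrite gt_eqF.
rewrite powRM ?(ltW kap0) ?(ltW c0)//.
rewrite (@powRM _ (2 * c) kap) ?mulr_ge0 ?(ltW kap0) ?(ltW c0)//.
rewrite (@powRM _ 2 c) ?(ltW c0)//.
have c1Q : 1 <= c `^ Q by exact: le_trans c1 (le1r_powR c1 (ltW Q1)).
have two1 : 1 <= 2 `^ Q :> R.
  by rewrite (le_trans _ (le1r_powR _ (ltW Q1)))// ler1n.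
move: c1Q two1 (ler0n R k); set C := c `^ Q; set D := 2 `^ Q; set K := k%:R => c1Q two1 k0.
have P0 : 0 <= CQ * kap `^ Q by rewrite mulr_ge0 ?powR_ge0 ?ltW.
have -> : CQ * kap `^ Q * (1 + K * D) + CQ * (kap `^ Q * C) =
  (CQ * kap `^ Q) * (1 + K * D + C) by ring.
have -> : CQ * (D * C * kap `^ Q) * (K + 2) = (CQ * kap `^ Q) * (D * C * (K + 2)) by ring.
apply: ler_wpM2l => //.
have h1 : 0 <= (D - 1) * (C - 1) by rewrite mulr_ge0 ?subr_ge0.
have h2 : 0 <= K * D * (C - 1) by rewrite !mulr_ge0 ?subr_ge0// (le_trans _ two1).
by lra.
Qed.

(** When the ball has radius at most rad / 8 it stays at distance rad / 8 from O, where the penalty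
    is of order kap / rad. The larger balls are only known to lie in B(O, 5 lam rad), whose energy
    is small by the choice of kap; they occur for boundedly many i, whose weights are at least 1 /
    (128 lam). The division by 2 leaves the other half of the budget to h. *)
Lemma good_at_log_penalty m x eta i : 2 ^+ m * s = rad -> 0 < eta ->
  rad / 4 <= mdist O x <= rad ->
  2 * CQ * (10 * lam * kap * (128 * lam)) `^ Q * (m%:R + 2) <= eta `^ Q ->
  (\int[nu]_(z in ball x (lam * dyadic_radius (4 * rad) i))
     ((EFin \o log_penalty) z `^ Q) <=
   ((eta * chain_weight i) `^ Q / 2)%:E)%E.
Proof.
move=> hm eta0 /andP[xlo xhi] HC.
set r := lam * dyadic_radius (4 * rad) i.
have r0 : 0 < r by rewrite mulr_gt0// dyadic_radius_gt0// mulr_gt0.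
have v0 : 0 < chain_weight i :> R := chain_weight_gt0 i.
have v2 : 2 ^- i <= 4 * chain_weight i :> R := expr2V_le_chain_weight i.
have rE : r = 4 * lam * rad * 2 ^- i by rewrite /r /dyadic_radius; ring.
set B := 10 * lam * kap * (128 * lam) in HC.
have B0 : 0 < B by rewrite !mulr_gt0.
have [rs|rl] := leP r (rad / 8).
  apply: (@le_trans _ _ (CQ * (kap / (rad / 8) * r) `^ Q)%:E).
    apply: (@integral_powR_le_ball _ _ x) => //.
    - exact: measurable_metric_ball.
    - by rewrite divr_ge0 ?divr_ge0 ?ltW.
    move=> z; rewrite ballEmdist/= => xz; rewrite lee_fin.
    apply: log_penalty_le_div; [by rewrite divr_gt0|lra|].
    by have := metric_triangle O z x; rewrite (metric_sym z x); lra.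
  rewrite lee_fin ler_pdivlMr// mulrC.
  have -> : kap / (rad / 8) * r = 32 * lam * kap * 2 ^- i.
    by rewrite rE; field; rewrite !gt_eqF ?exprn_gt0.
  apply: (@le_trans _ _ (2 * CQ * (B * chain_weight i) `^ Q)).
    rewrite mulrA ler_wpM2l ?mulr_ge0 ?(ltW CQ0)//.
    apply: ge0_ler_powR; rewrite ?nnegrE ?(ltW Q0) ?mulr_ge0 ?(ltW lam0) ?(ltW kap0)//.
      exact: ltW.
    apply: (@le_trans _ _ (32 * lam * kap * (4 * chain_weight i))).
      by rewrite ler_wpM2l// !mulr_ge0 ?(ltW lam0) ?(ltW kap0).
    rewrite mulrA ler_wpM2r ?(ltW v0)// /B.
    rewrite (_ : 32 * lam * kap * 4 = 128 * kap * lam); last by ring.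
    rewrite (_ : 10 * lam * kap * (128 * lam) = 128 * kap * lam * (10 * lam)); last by ring.
    have P : 0 <= 128 * kap * lam.
      by apply: mulr_ge0 (ltW lam0); apply: mulr_ge0 (ltW kap0).
    apply: ler_peMr => //; apply: (le_trans lam1).
    by apply: ler_peMl; rewrite ?ler1n// ltW.
  rewrite (powRM Q (ltW B0) (ltW v0)) (powRM Q (ltW eta0) (ltW v0)) mulrA.
  rewrite ler_wpM2r ?powR_ge0//; apply: le_trans HC.
  rewrite ler_peMr ?mulr_ge0 ?powR_ge0 ?(ltW CQ0)//.
  by rewrite (le_trans (_ : 1 <= 2))// ?ler1n// lerDr.
have sub : ball x r `<=` ball O (5 * lam * rad).
  move=> z; rewrite !ballEmdist/= => xz.
  apply: le_lt_trans (metric_triangle O x z) _.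
  have h1 : 2 ^- i <= 1 :> R by rewrite invf_le1 ?exprn_gt0// exprn_ege1// ler1n.
  have h2 : 0 <= lam * rad by rewrite mulr_ge0 ?ltW.
  have h3 := ler_wpM2l h2 h1.
  have h4 := ler_wpM2r (ltW rad0) lam1.
  by move: xz; rewrite rE; lra.
have l5 : 1 <= 5 * lam.
  by apply: (le_trans lam1); apply: ler_peMl; rewrite ?ler1n// ltW.
apply: (@le_trans _ _ (\int[nu]_(z in ball O (5 * lam * rad))
    ((EFin \o log_penalty) z `^ Q))%E).
  apply: ge0_subset_integral => //; try exact: measurable_metric_ball.
  by move=> z _; exact: poweR_ge0.
apply: le_trans (integral_log_penalty_ball hm l5) _.
rewrite lee_fin ler_pdivlMr//.
have -> : 2 * (5 * lam) * kap = B * (128 * lam)^-1.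
  by rewrite /B mulfK ?mulf_neq0 ?gt_eqF//; ring.
have l128 : 0 < (128 * lam)^-1 by rewrite invr_gt0 mulr_gt0.
rewrite (powRM Q (ltW B0) (ltW l128)).
rewrite [leLHS](_ : _ = 2 * CQ * B `^ Q * (m%:R + 2) * (128 * lam)^-1 `^ Q); last by ring.
rewrite (powRM Q (ltW eta0) (ltW v0)); apply: ler_pM => //.
- by rewrite !mulr_ge0 ?powR_ge0 ?addr_ge0 ?(ltW CQ0).
- exact: powR_ge0.
apply: ge0_ler_powR; rewrite ?nnegrE ?(ltW Q0) ?(ltW v0) ?(ltW l128)//.
have h : (32 * lam)^-1 < 2 ^- i.
  rewrite -div1r ltr_pdivrMr ?mulr_gt0//.
  by move: rl; rewrite rE ltr_pdivrMr// => h; rewrite -(ltr_pM2l rad0); lra.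
rewrite -(ler_pM2l (_ : 0 < 4 :> R))//; apply: le_trans v2; apply: le_trans (ltW h).
by rewrite le_eqVlt; apply/orP; left; apply/eqP; field; rewrite gt_eqF.
Qed.

End log_penalty.

End connect_good_points.

(** The left side is of order m^(1 - Q). Taking m >= 8 keeps 1 - 2 / m, a lower bound for the cost
    of a descent, above 1 / 2. *)
Lemma exists_log_depth {R : realType} (Q c : R) : 1 < Q -> 0 < c ->
  exists2 m, (8 <= m)%N & (2 / m%:R) `^ Q * (m%:R + 2) <= c.
Proof.
move=> Q1 c0; pose p := Q - 1; have p0 : 0 < p by rewrite subr_gt0.
pose A := 3 * 2 `^ Q / c.
have A0 : 0 < A by rewrite divr_gt0// mulr_gt0// powR_gt0.
pose m := maxn 8 (Num.truncn (A `^ p^-1)).+1.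
have m8 : (8 <= m)%N by rewrite leq_maxl.
have m0 : 0 < m%:R :> R by rewrite ltr0n (leq_trans _ m8).
exists m => //.
have mA : A <= m%:R `^ p.
  have -> : A = (A `^ p^-1) `^ p by rewrite -powRrM mulVf ?gt_eqF// powRr1// ltW.
  apply: ge0_ler_powR; rewrite ?nnegrE ?powR_ge0 ?(ltW p0) ?(ltW m0)//.
  apply: ltW; apply: lt_le_trans (truncnS_gt _) _.
  by rewrite ler_nat leq_maxr.
have mQ : m%:R `^ Q = m%:R * m%:R `^ p.
  by rewrite mulr_powRB1// ?(ltW m0)// (lt_trans _ Q1).
rewrite powRM ?invr_ge0 ?(ltW m0)// -(powR_inv1 (ltW m0)) -powRrM mulN1r powRN mQ.
have mp0 : 0 < m%:R `^ p by rewrite powR_gt0.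
have : m%:R + 2 <= 3 * m%:R :> R.
  by rewrite -natrD -natrM ler_nat; move: m8; clear; lia.
move=> h; apply: (@le_trans _ _ (2 `^ Q / (m%:R * m%:R `^ p) * (3 * m%:R))).
  by rewrite ler_wpM2l// divr_ge0 ?powR_ge0// mulr_ge0 ?ltW.
have -> : 2 `^ Q / (m%:R * m%:R `^ p) * (3 * m%:R) = A * c / m%:R `^ p.
  by rewrite /A; field; rewrite !gt_eqF.
by rewrite ler_pdivrMr// mulrC ler_wpM2l// ltW.
Qed.

(** * Outer regularity by open sets *)

Section outer_regularity.
Context {R : realType} {X : completeMetricType R}.
Variable mu : {outer_measure set X -> \bar R}.
Hypothesis borel_meas : forall A, borel A -> mu.-cara.-measurable A.
Implicit Types (x y z : X) (r e : R) (A E U F : set X).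

Local Notation T := (caratheodory_type mu).
Local Notation nu := (cmeasure mu).

Lemma measure_bigcap_small (G : (set X)^nat) e : 0 < e ->
  (mu (G 0%N) < +oo)%E -> (forall n, measurable (G n : set T)) ->
  (forall n m, (n <= m)%N -> G m `<=` G n) -> \bigcap_n G n = set0 ->
  exists n, (mu (G n) < e%:E)%E.
Proof.
move=> e0 G0 mG niG cG.
have mcap : measurable (\bigcap_n G n : set T) by rewrite cG; exact: measurable0.
have := @nonincreasing_cvg_mu _ T R nu G G0 mG mcap.
rewrite cG measure0 => /(_ _) H.
have {}H : nu \o G @ \oo --> 0%E.
  by apply: H => n m nm; apply/subsetPset; exact: niG.
have : nbhs (0%E : \bar R) [set t | (t < e%:E)%E] by apply: open_ereal_lt'; rewrite lte_fin.
by move=> /H [n _ /(_ n (leqnn _))]; exists n.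
Qed.

Section restricted.
Variable A : set X.
Hypothesis oA : open A.
Hypothesis fA : (mu A < +oo)%E.

(** Approximation from both sides is stable under complements, which approximation by open sets
    alone is not; this allows an induction over the Borel sigma-algebra. *)
Let approximable E := forall e, 0 < e -> exists F U,
  [/\ closed F, open U, F `<=` E, E `<=` U & (mu (A `&` (U `\` F)) < e%:E)%E].

Let bor F : closed F -> borel F.
Proof.
by move=> cF; rewrite -(setCK F); apply: borel_setC; apply: borel_open; exact: closed_openC.
Qed.

Let meas3 U F : borel U -> borel F -> measurable (A `&` (U `\` F) : set T).
Proof.
move=> bU bF; apply: borel_meas; apply: borel_setI; first exact: borel_open.
exact: borel_setD.
Qed.

Let finite3 B : (mu (A `&` B) < +oo)%E.
Proof. by apply: le_lt_trans fA; apply: le_outer_measure => x []. Qed.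

Lemma approximable_open E : open E -> approximable E.
Proof.
move=> oE e e0.
pose F n := [set x | forall y, ~ E y -> n.+1%:R^-1 <= mdist x y].
have cF n : closed (F n).
  rewrite -openC (_ : ~` F n = \bigcup_(y in ~` E) ball y n.+1%:R^-1); last first.
    apply/seteqP; split => x.
      move=> /existsNP[y /not_implyP[nEy /negP]]; rewrite -ltNge => xy.
      by exists y => //; rewrite ballEmdist/= metric_sym.
    move=> [y nEy]; rewrite ballEmdist/= metric_sym => xy /(_ y nEy).
    by rewrite leNgt xy.
  by apply: bigcup_open => y _; exact: open_ball.
have FE n : F n `<=` E.
  move=> x Fx; apply: contrapT => nEx; have := Fx x nEx.
  by rewrite mdistxx leNgt invr_gt0 ltr0n.
have [|||n Hn] := @measure_bigcap_small (fun n => A `&` (E `\` F n)) e e0 (finite3 _).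
- by move=> n; apply: meas3; [exact: borel_open|exact: bor].
- move=> n m nm x [Ax [Ex nFx]]; split=> //; split=> // Fx; apply: nFx => y nEy.
  by apply: le_trans (Fx y nEy); rewrite lef_pV2 ?posrE// ler_nat.
- apply/seteqP; split=> // x Hx; have [Ax [Ex _]] := Hx 0%N I.
  have : nbhs x E by exact: open_nbhs_nbhs.
  rewrite -nbhs_ballE => -[r /= r0 rE].
  have [n nr] : exists n, n.+1%:R^-1 < r.
    exists (Num.truncn r^-1); rewrite -[ltRHS]invrK ltf_pV2 ?posrE ?invr_gt0//.
    exact: truncnS_gt.
  have [_ [_]] := Hx n I; apply => y nEy; rewrite leNgt; apply/negP => xy.
  by apply: nEy; apply: rE; rewrite ballEmdist/=; exact: lt_trans nr.
by exists (F n), E; split.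
Qed.

Lemma approximable_setC E : approximable E -> approximable (~` E).
Proof.
move=> aE e e0; have [F [U [cF oU FE EU H]]] := aE e e0.
exists (~` U), (~` F); split.
- exact: open_closedC.
- exact: closed_openC.
- exact: subsetC.
- exact: subsetC.
suff -> : ~` F `\` ~` U = U `\` F by [].
by rewrite !setDE setCK setIC.
Qed.

Lemma approximable_bigcup (E : (set X)^nat) : (forall n, approximable (E n)) ->
  approximable (\bigcup_n E n).
Proof.
move=> aE e e0; have e20 : 0 < e / 2 by rewrite divr_gt0.
have /choice [F /choice [U H]] : forall n, exists F U, [/\ closed F, open U,
    F `<=` E n, E n `<=` U & (mu (A `&` (U `\` F)) < (e / 2 / (2 ^ n.+1)%:R)%:E)%E].
  by move=> n; apply: aE; rewrite divr_gt0// ltr0n expn_gt0.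
(* The union of all the F i need not be closed; as A has finite measure, finitely many of them
   suffice up to e / 2. *)
pose FF n := \big[setU/set0]_(i < n) F i; pose UU := \bigcup_n U n.
have cFF n : closed (FF n).
  by apply: closed_bigsetU => i _; case: (H i).
have oUU : open UU by apply: bigcup_open => n _; case: (H n).
have bUU : borel UU by exact: borel_open.
have bF : borel (\bigcup_n F n).
  apply: (@bigcupT_measurable _ (g_sigma_algebraType (@open X))) => n.
  by apply: bor; case: (H n).
have m1 : (mu (A `&` (UU `\` \bigcup_n F n)) <= (e / 2)%:E)%E.
  apply: (@le_trans _ _ (mu (\bigcup_n (A `&` (U n `\` F n))))%E).
    apply: le_outer_measure => x [Ax [[n _ Ux] nF]]; exists n => //; split => //.
    by split=> // Fx; apply: nF; exists n.
  apply: le_trans (outer_measure_sigma_subadditive mu _) _.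
  apply: le_trans (epsilon_trick0 xpredT (ltW e20)).
  by apply: lee_nneseries => n _; rewrite ?outer_measure_ge0//; case: (H n) => _ _ _ _ /ltW.
have [|||n Hn] := @measure_bigcap_small
    (fun n => A `&` ((\bigcup_n F n) `\` FF n)) (e / 2) e20 (finite3 _).
- by move=> n; apply: meas3 => //; exact: bor.
- move=> n m nm x [Ax [Fx nFF]]; split => //; split=> // FFx; apply: nFF.
  by apply: subset_bigsetU FFx.
- apply/seteqP; split=> // x Hx; have [_ [[n _ Fn] _]] := Hx 0%N I.
  have [_ [_]] := Hx n.+1 I; apply.
  by rewrite /FF big_ord_recr; right.
exists (FF n), UU; split => //.
- move=> x; rewrite /FF -bigcup_mkord => -[i _ Fi]; exists i => //.
  by case: (H i) => _ _ + _ _; exact.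
- move=> x [i _ Ei]; exists i => //; by case: (H i) => _ _ _ + _; exact.
apply: (@le_lt_trans _ _ (mu ((A `&` (UU `\` \bigcup_n F n)) `|`
   (A `&` ((\bigcup_n F n) `\` FF n))))).
  apply: le_outer_measure => x [Ax [Ux nFx]].
  have [Fx|nF] := pselect ((\bigcup_n F n) x); first by right; split.
  by left; split.
apply: le_lt_trans (outer_measureU2 mu _ _) _.
rewrite (splitr e) EFinD; apply: lee_ltD => //.
by rewrite ge0_fin_numE ?outer_measure_ge0//; exact: le_lt_trans m1 (ltry _).
Qed.

Lemma approximable_borel E : borel E -> approximable E.
Proof.
apply: smallest_sub; last by move=> U oU; exact: approximable_open.
split.
- by apply: approximable_open; exact: open0.
- by move=> B aB; rewrite setTD; exact: approximable_setC.
- exact: approximable_bigcup.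
Qed.

End restricted.

(** E may have infinite measure: the excess is made at most e / 2^(n + 1) inside each A n, and the
    intersections of A n with U n are glued together. *)
Lemma outer_regular (A : (set X)^nat) E e : (forall n, open (A n)) ->
  (forall n, (mu (A n) < +oo)%E) -> \bigcup_n A n = setT ->
  borel E -> 0 < e ->
  exists U, [/\ open U, E `<=` U & (mu (U `\` E) <= e%:E)%E].
Proof.
move=> oA fA cA bE e0.
have /choice [U H] : forall n, exists U, [/\ open U, E `<=` U &
    (mu (A n `&` (U `\` E)) <= (e / (2 ^ n.+1)%:R)%:E)%E].
  move=> n; have en : 0 < e / (2 ^ n.+1)%:R by rewrite divr_gt0// ltr0n expn_gt0.
  have [F [U [_ oU FE EU H]]] := approximable_borel (oA n) (fA n) bE en.
  exists U; split=> //; apply: le_trans (ltW H); apply: le_outer_measure.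
  by move=> x [Ax [Ux nE]]; split => //; split => // /FE.
exists (\bigcup_n (A n `&` U n)); split.
- by apply: bigcup_open => n _; apply: openI => //; case: (H n).
- move=> x Ex; have : setT x by []. rewrite -cA => -[n _ Ax]; exists n => //.
  by split => //; case: (H n) => _ + _; exact.
apply: (@le_trans _ _ (mu (\bigcup_n (A n `&` (U n `\` E))))).
  by apply: le_outer_measure => x [[n _ [Ax Ux]] nE]; exists n.
apply: le_trans (outer_measure_sigma_subadditive mu _) _.
apply: le_trans (epsilon_trick0 xpredT (ltW e0)).
by apply: lee_nneseries => n _; rewrite ?outer_measure_ge0//; case: (H n).
Qed.

End outer_regularity.

(** * A lower semicontinuous majorant of finite energy *)

Section vitali_caratheodory.
Context {R : realType} {X : completeMetricType R}.
Variable mu : {outer_measure set X -> \bar R}.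
Hypothesis mmu : metric_measure_space mu.
Variables (A : (set X)^nat) (Q : R).
Hypothesis oA : forall n, open (A n).
Hypothesis fA : forall n, (mu (A n) < +oo)%E.
Hypothesis cA : \bigcup_n A n = setT.
Hypothesis Q0 : 0 < Q.

Local Notation T := (caratheodory_type mu).
Local Notation nu := (cmeasure mu).

(** h is the supremum of q times the indicator of U over the rationals q >= 0, where U is an open
    set slightly larger than the set where rho > q. Being a supremum and not a sum, its Q-th power
    exceeds that of rho by at most the sum of q^Q over the sets U to whose excess the point
    belongs. *)
Lemma vitali_caratheodory (rho : X -> \bar R) : (forall x, 0 <= rho x)%E ->
  measurable_fun setT (rho : g_sigma_algebraType (@open X) -> \bar R) ->
  (\int[nu]_x (rho x `^ Q) < +oo)%E ->
  exists h : X -> \bar R, [/\ lower_semicontinuous h, forall x, (0 <= h x)%E,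
    forall x, (rho x <= h x)%E & (\int[nu]_x (h x `^ Q) < +oo)%E].
Proof.
move=> rho0 mrho irho.
have mB := borel_measurable mmu.
pose q n : R := `|ratr (odflt 0 (unpickle n : option rat))|.
have q0 n : 0 <= q n by exact: normr_ge0.
pose E n := [set x | ((q n)%:E < rho x)%E].
have bE n : borel (E n).
  have := mrho measurableT _ (emeasurable_itv `](q n)%:E, +oo[); rewrite setTI.
  congr (measurable _); apply/seteqP; split => x /=; by rewrite in_itv/= andbT.
(* With this excess, the n-th term adds at most 2^-(n + 1) to the energy. *)
pose eps n : R := (1 + q n `^ Q)^-1 / (2 ^ n.+1)%:R.
have eps0 n : 0 < eps n.
  by rewrite divr_gt0 ?ltr0n ?expn_gt0// invr_gt0 ltr_pwDl// powR_ge0.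
have /choice [U HU] : forall n, exists U, [/\ open U, E n `<=` U &
    (mu (U `\` E n) <= (eps n)%:E)%E].
  by move=> n; exact: (outer_regular mB oA fA cA).
have oU n : open (U n) by case: (HU n).
pose f n x : \bar R := (q n * \1_(U n) x)%:E.
pose h x := ereal_sup (range (f ^~ x)).
have fh n x : (f n x <= h x)%E by apply: ereal_sup_ubound; exists n.
have f0 n x : (0 <= f n x)%E by rewrite lee_fin mulr_ge0// indicE.
have h0 x : (0 <= h x)%E by exact: le_trans (f0 0%N x) (fh _ _).
have lsc : lower_semicontinuous h.
  move=> x a /ereal_sup_gt[_ [n _ <-] axn].
  have [a0|a0] := ltP a 0.
    by exists setT => [|y _]; [exact: filterT|exact: lt_le_trans (h0 y)].
  have Ux : U n x.
    move: axn; rewrite /f lte_fin indicE; case: (boolP (x \in U n)) => [/set_mem//|_].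
    by rewrite mulr0 ltNge a0.
  exists (U n) => [|y Uy]; first exact: open_nbhs_nbhs.
  apply: lt_le_trans (fh n y); move: axn.
  by rewrite /f !indicE !mem_set.
have rh x : (rho x <= h x)%E.
  rewrite leNgt; apply/negP => hr.
  have hfin : h x \is a fin_num by rewrite ge0_fin_numE// (lt_le_trans hr)// leey.
  have [b hb br] : exists2 b : R, fine (h x) < b & (b%:E <= rho x)%E.
    case: (rho x) hr => [b| |] // hr.
    - by exists b => //; rewrite -lte_fin fineK.
    - by exists (fine (h x) + 1); rewrite ?ltrDl ?leey.
    by move: hr; rewrite ltNge leNye.
  have [p] := rat_in_itvoo hb; rewrite in_itv/= => /andP[hp pb].
  have qp : q (pickle p) = ratr p.
    by rewrite /q pickleK/= ger0_norm// (le_trans _ (ltW hp))// fine_ge0.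
  have Up : U (pickle p) x.
    case: (HU (pickle p)) => _ + _; apply; rewrite /E /= qp.
    by apply: lt_le_trans br; rewrite lte_fin.
  have := fh (pickle p) x; rewrite leNgt /f qp indicE mem_set// mulr1.
  by rewrite -(fineK hfin) lte_fin hp.
exists h; split => //.
pose w n x : \bar R := ((q n `^ Q)%:E * (\1_(U n `\` E n) x)%:E)%E.
have w0 n x : (0 <= w n x)%E by rewrite mule_ge0 ?lee_fin ?powR_ge0 ?indicE.
have mUE n : measurable (U n `\` E n : set T).
  by apply: mB; apply: borel_setD => //; exact: borel_open.
have mw n : measurable_fun setT (w n : T -> \bar R).
  apply: measurable_funeM; apply/measurable_EFinP; exact: measurable_indic.
have mrhoQ : measurable_fun setT ((fun x => rho x `^ Q)%E : T -> \bar R).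
  by apply: measurableT_comp (measurable_poweR _) _; exact: borel_measurable_fun.
have mh : measurable_fun setT (h : T -> \bar R).
  by apply: borel_measurable_fun => //; exact: measurable_lsc.
have msum : measurable_fun setT ((fun x => \sum_(n <oo) w n x)%E : T -> \bar R).
  by apply: ge0_emeasurable_sum => // n x _ _; exact: w0.
have hS x : (h x `^ Q <= rho x `^ Q + \sum_(n <oo) w n x)%E.
  set S := (X in (_ <= X)%E).
  have S0 : (0 <= S)%E by rewrite adde_ge0 ?poweR_ge0// nneseries_ge0.
  suff hS : (h x <= S `^ Q^-1)%E.
    have -> : S = ((S `^ Q^-1) `^ Q)%E by rewrite -poweRrM mulVf ?gt_eqF// poweRe1.
    by apply: gt0_ler_poweR hS; rewrite ?in_itv/= ?leey ?andbT ?poweR_ge0 ?h0// ltW.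
  apply: ge_ereal_sup => _ [n _ <-]; rewrite /f indicE.
  case: (boolP (x \in U n)) => [/set_mem Ux|_]; last by rewrite mulr0 poweR_ge0.
  rewrite mulr1.
  have -> : (q n)%:E = ((q n `^ Q)%:E `^ Q^-1)%E.
    by rewrite poweR_EFin -powRrM mulfV ?gt_eqF// powRr1.
  apply: gt0_ler_poweR; rewrite ?in_itv/= ?leey ?andbT ?S0 ?lee_fin ?powR_ge0 ?invr_ge0 ?(ltW Q0)//.
  have [Ex|nEx] := pselect (E n x).
    apply: (@le_trans _ _ (rho x `^ Q)%E); last by rewrite leeDl// nneseries_ge0.
    rewrite -poweR_EFin; apply: gt0_ler_poweR;
      rewrite ?in_itv/= ?leey ?andbT ?lee_fin ?rho0 ?q0 ?(ltW Q0) ?(ltW Ex)//; exact: ltW.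
  apply: (@le_trans _ _ (\sum_(n <oo) w n x)%E); last by rewrite leeDr// poweR_ge0.
  apply: (@le_trans _ _ (w n x)).
    by rewrite /w indicE mem_set//= mule1.
  apply: le_trans (@nneseries_lim_ge _ (w ^~ x) xpredT 0%N n.+1 _) => //.
  by rewrite big_nat_recr//= leeDr// sume_ge0.
apply: (@le_lt_trans _ _ (\int[nu]_x (rho x `^ Q + \sum_(n <oo) w n x))%E).
  apply: ge0_le_integral => //.
  - by move=> x _; exact: poweR_ge0.
  - exact: measurableT_comp (measurable_poweR _) mh.
  - exact: emeasurable_funD.
rewrite ge0_integralD//; first last.
- by move=> x _; exact: nneseries_ge0.
- by move=> x _; exact: poweR_ge0.
apply: lte_add_pinfty => //; rewrite integral_nneseries//.
apply: (@le_lt_trans _ _ 1%E); last exact: ltry.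
apply: le_trans (epsilon_trick0 xpredT (ler01 : 0 <= 1 :> R)).
apply: lee_nneseries => n _; first by move=> _; exact: integral_ge0.
rewrite /w ge0_integralZl//; first last.
- by rewrite lee_fin powR_ge0.
- by apply/measurable_EFinP; exact: measurable_indic.
rewrite integral_indic// setIT; have [_ _ h1] := HU n.
apply: (@le_trans _ _ ((q n `^ Q)%:E * (eps n)%:E)%E).
  by apply: lee_wpmul2l h1; rewrite lee_fin powR_ge0.
rewrite -EFinM lee_fin mulrA ler_pM2r ?invr_gt0 ?ltr0n ?expn_gt0//.
by rewrite ler_pdivrMr ?mul1r ?lerDr ?ltr_pwDl// powR_ge0.
Qed.

End vitali_caratheodory.

(** * Lower semicontinuous weights *)

Section lsc_operations.
Context {R : realType} {X : completeMetricType R}.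
Implicit Types (f g : X -> \bar R) (U : set X).

Lemma lsc_maxe f g : lower_semicontinuous f -> lower_semicontinuous g ->
  lower_semicontinuous (fun z => maxe (f z) (g z)).
Proof.
move=> lf lg x a; rewrite lt_max => /orP[/lf|/lg] [V Vx H]; exists V => // y Vy;
  by rewrite lt_max H ?orbT.
Qed.

Lemma lsc_restrict f U : open U -> lower_semicontinuous f ->
  (forall z, 0 <= f z)%E -> lower_semicontinuous (f \_ U).
Proof.
move=> oU lf f0 x a; rewrite patchE; case: ifPn => [/set_mem Ux ax|_ a0].
  have [V Vx HV] := lf x a ax; exists (V `&` U).
    by apply: filterI => //; exact: open_nbhs_nbhs.
  by move=> y [Vy Uy]; rewrite patchE mem_set//; exact: HV.
exists setT => [|y _]; first exact: filterT.
by apply: (lt_le_trans a0); rewrite patchE; case: ifP.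
Qed.

Lemma lsc_scale f (c : R) : 0 < c -> lower_semicontinuous f ->
  lower_semicontinuous (fun z => c%:E * f z)%E.
Proof.
move=> c0 lf x a; rewrite muleC -lte_pdivrMr// -EFinM => /lf[V Vx HV].
exists V => // y /HV; by rewrite EFinM lte_pdivrMr// muleC.
Qed.

Lemma lsc_lipschitz (f : X -> R) l : lipschitz_with l f ->
  lower_semicontinuous (EFin \o f).
Proof.
move=> lf; apply/lower_semicontinuousP => a.
have cf := lipschitz_continuous lf.
rewrite (_ : [set _ | _] = f @^-1` [set` `]a, +oo[%R]).
  by apply: open_comp => [x _|]; [exact: cf|exact: interval_open].
by apply/seteqP; split => x /=; rewrite in_itv/= andbT lte_fin.
Qed.

End lsc_operations.

Definition far_set {R : realType} {X : completeMetricType R} (O : X) (s : R) :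
  set X := [set z | s < mdist O z].

Section far_set.
Context {R : realType} {X : completeMetricType R}.
Implicit Types (O z : X) (r s : R).

Lemma open_far_set O s : open (far_set O s).
Proof.
have l1 : lipschitz_with 1 (mdist O) by exact: mdist_lipschitz.
have cf := lipschitz_continuous l1.
rewrite (_ : far_set O s = mdist O @^-1` [set` `]s, +oo[%R]).
  by apply: open_comp => [x _|]; [exact: cf|exact: interval_open].
by apply/seteqP; split => x /=; rewrite in_itv/= andbT.
Qed.

End far_set.

(** * Joining good points away from the base point *)

Section connect_in_annulus.
Context {R : realType} {X : completeMetricType R}.
Variable mu : {outer_measure set X -> \bar R}.
Variables (Q CQ CP lam : R).
Hypothesis Q1 : 1 < Q.
Hypothesis CQ1 : 1 <= CQ.
Hypothesis CP0 : 0 < CP.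
Hypothesis lam1 : 1 <= lam.
Hypothesis mmu : metric_measure_space mu.
Hypothesis amu : ahlfors_regular mu Q CQ.
Hypothesis pmu : poincare mu Q CP lam.
Variables (O : X) (h : X -> \bar R).
Hypothesis lsch : lower_semicontinuous h.
Hypothesis h0 : forall z, (0 <= h z)%E.
Implicit Types (x y z : X) (r e d s rad theta : R).

Local Notation T := (caratheodory_type mu).
Local Notation nu := (cmeasure mu).
Local Notation lev := (good_level Q CQ CP).

Let Q0 : 0 < Q. Proof. exact: lt_trans Q1. Qed.

(** Energy within distance s of O is not counted, so that the bad points of one scale are charged to
    a bounded number of dyadic shells; the penalty makes up for this by keeping the curves out of
    that region. *)
Definition small_energy s rad theta x := forall i,
  (\int[nu]_(z in ball x (lam * dyadic_radius (4 * rad) i) `&` far_set O s)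
    (h z `^ Q) <= (theta * chain_weight i `^ Q)%:E)%E.

Variable m : nat.
Hypothesis m8 : (8 <= m)%N.
Let kap : R := 2 / m%:R.
Hypothesis mdepth :
  2 * CQ * (10 * lam * kap * (128 * lam)) `^ Q * (m%:R + 2) <= lev `^ Q.

Let lev0 : 0 < lev. Proof. exact: good_level_gt0. Qed.
Let m0 : 0 < m%:R :> R. Proof. by rewrite ltr0n; apply: leq_trans m8. Qed.
Let kap0 : 0 < kap. Proof. by rewrite divr_gt0. Qed.

(** The inverse of the factor L for which L^Q theta is half of lev^Q: the energy of L h then leaves
    room for the penalty below the good level. *)
Definition oscillation_bound theta : R := (2 * theta / lev `^ Q) `^ Q^-1.

Variables (s rad theta : R).
Hypothesis s0 : 0 < s.
Hypothesis hrad : 2 ^+ m * s = rad.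
Hypothesis rad1 : 1 <= rad.
Hypothesis theta0 : 0 < theta.

Let srad : s <= rad.
Proof. by rewrite -hrad ler_peMl ?(ltW s0)// exprn_ege1// ler1n. Qed.

Let pen := log_penalty O kap rad s.
Let L := (oscillation_bound theta)^-1.
Let osc0 : 0 < oscillation_bound theta.
Proof. by rewrite powR_gt0// divr_gt0 ?mulr_gt0 ?powR_gt0. Qed.
Let L0 : 0 < L. Proof. by rewrite invr_gt0. Qed.

Let hs := (fun z => L%:E * h z)%E \_ (far_set O s).
Let ghat z := maxe (hs z) (pen z)%:E.

Let hs0 z : (0 <= hs z)%E.
Proof. by rewrite /hs patchE; case: ifP => // _; rewrite mule_ge0// lee_fin ltW. Qed.

Let Lh0 z : (0 <= L%:E * h z)%E.
Proof. by rewrite mule_ge0// lee_fin ltW. Qed.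

Let pen0 z : 0 <= pen z. Proof. exact: (log_penalty_ge0 O kap0 s0 srad). Qed.

Let lschs : lower_semicontinuous hs.
Proof.
by apply: lsc_restrict => //; [exact: open_far_set|exact: lsc_scale].
Qed.

Let lipen := log_penalty_lipschitz O kap0 s0 srad.

Let lscghat : lower_semicontinuous ghat.
Proof. by apply: lsc_maxe => //; exact: lsc_lipschitz lipen. Qed.

Let mborel g : lower_semicontinuous g -> measurable_fun setT (g : T -> \bar R).
Proof. by move=> lg; apply: borel_measurable_fun => //; exact: measurable_lsc. Qed.

Let mpowQ (g : T -> \bar R) : measurable_fun setT g ->
  measurable_fun setT ((fun z => (g z `^ Q)%E) : T -> \bar R).
Proof. by move=> mg; exact: measurableT_comp (measurable_poweR _) mg. Qed.

Let LQ : L `^ Q * theta = lev `^ Q / 2.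
Proof.
have lQ : 0 < lev `^ Q by rewrite powR_gt0.
have t0 : 0 <= 2 * theta / lev `^ Q.
  by rewrite divr_ge0 ?(ltW lQ)// mulr_ge0// ltW.
have : (L * oscillation_bound theta) `^ Q = 1 by rewrite mulVf ?gt_eqF// powR1.
rewrite powRM ?(ltW L0) ?(ltW osc0)// -powRrM mulVf ?gt_eqF// powRr1// => H.
have -> : lev `^ Q / 2 = (L `^ Q * (2 * theta / lev `^ Q)) * (lev `^ Q / 2) by rewrite H mul1r.
by field; rewrite gt_eqF.
Qed.

(** The Q-th power of a maximum is at most the sum of the Q-th powers; half of the budget goes to L
    h and half to the penalty. *)
Let good_ghat x : rad / 4 <= mdist O x <= rad -> small_energy s rad theta x ->
  good_at mu Q lam ghat lev x (4 * rad).
Proof.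
move=> hx sx i; set B := ball _ _.
have mB : measurable (B : set T) by exact: measurable_metric_ball.
have mfar : measurable (far_set O s : set T).
  by apply: borel_measurable => //; apply: borel_open; exact: open_far_set.
have mhs := mpowQ (mborel lschs).
have mpen := mpowQ (mborel (lsc_lipschitz lipen)).
apply: (@le_trans _ _ (\int[nu]_(z in B) (hs z `^ Q + (EFin \o pen) z `^ Q))%E).
  apply: ge0_le_integral => //.
  - by move=> z _; exact: poweR_ge0.
  - by apply: measurable_funTS; exact: mpowQ (mborel lscghat).
  - by apply: emeasurable_funD; exact: measurable_funTS.
  move=> z _; rewrite /ghat /maxe; case: ifP => _.
    by rewrite leeDr// poweR_ge0.
  by rewrite leeDl// poweR_ge0.
rewrite ge0_integralD//; last 4 first.
- by move=> z _; exact: poweR_ge0.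
- exact: measurable_funTS.
- by move=> z _; exact: poweR_ge0.
- exact: measurable_funTS.
rewrite [leRHS](_ : _ = ((lev * chain_weight i) `^ Q / 2)%:E + ((lev * chain_weight i) `^ Q / 2)%:E)%E; last first.
  by rewrite -EFinD -splitr.
have v0 : 0 < chain_weight i :> R := chain_weight_gt0 i.
apply: leeD; last exact: (good_at_log_penalty Q1 CQ1 lam1 mmu amu kap0 s0 srad i hrad lev0 hx mdepth).
rewrite (_ : (fun z => hs z `^ Q)%E = (fun z => (L `^ Q)%:E * h z `^ Q)%E \_ (far_set O s)); last first.
  apply/funext => z; rewrite /hs !patchE; case: ifP => _.
    by rewrite poweRM ?poweR_EFin// lee_fin ltW.
  by apply: poweR0r; rewrite gt_eqF.
rewrite -integral_mkcondr ge0_integralZl//; last 4 first.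
- exact: measurableI.
- by apply: measurable_funTS; exact: mpowQ (mborel lsch).
- by move=> z _; exact: poweR_ge0.
- by rewrite lee_fin powR_ge0.
apply: le_trans (lee_wpmul2l _ (sx i)) _; first by rewrite lee_fin powR_ge0.
by rewrite -EFinM lee_fin mulrA LQ powRM ?(ltW lev0) ?(ltW v0)// mulrAC.
Qed.

Lemma connect_in_annulus x y :
  rad / 4 <= mdist O x <= rad -> rad / 4 <= mdist O y <= rad ->
  small_energy s rad theta x -> small_energy s rad theta y ->
  exists gamma : R -> X, [/\ gamma 0 = x, gamma 2^-1 = y,
    forall t t' : R, 0 <= t -> t <= t' -> t' <= 2^-1 ->
      kap / rad * mdist (gamma t) (gamma t') <= t' - t,
    forall a b : R, 0 <= a -> a <= b -> b <= 2^-1 -> rectifiable_curve gamma a b &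
    forall t : R, 0 <= t <= 2^-1 -> s < mdist O (gamma t) /\
      (line_integral h gamma 0 t <= (oscillation_bound theta)%:E)%E].
Proof.
move=> hx hy sx sy.
have rad0 : 0 < rad by exact: lt_le_trans rad1.
have d0 : 0 < kap / rad by rewrite divr_gt0.
have d1 : kap / rad <= 1.
  rewrite ler_pdivrMr// mul1r (le_trans _ rad1)// ler_pdivrMr// mul1r.
  by rewrite ler_nat; apply: leq_trans m8.
have dg z : ((kap / rad)%:E <= ghat z)%E.
  by rewrite /ghat le_max lee_fin log_penalty_ge// orbT.
have g0 z : (0 <= ghat z)%E by rewrite /ghat le_max hs0.
(* Both points have norm at most rad; this is why the dyadic balls start at radius 4 rad. *)
have xy : mdist x y <= 4 * rad / 2.
  have := metric_triangle x O y; rewrite (metric_sym x O).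
  by move: hx hy => /andP[_ ?] /andP[_ ?]; lra.
have r40 : 0 < 4 * rad by rewrite mulr_gt0.
have [gamma [ga gb gl gr]] := good_points_curve Q1 CQ1 CP0 lam1 mmu amu pmu g0 lscghat
  d0 d1 dg r40 xy (good_ghat hx sx) (good_ghat hy sy).
exists gamma; split => //; first by move=> a b a0 ab b2; case: (gr a b a0 ab b2).
have mg : measurable_fun setT (ghat : g_sigma_algebraType (@open X) -> \bar R).
  exact: measurable_lsc.
(* Descending from |x| >= 2^(m - 2) s to radius s would cost at least kap (m - 2) ln 2 >= 1 - 2 / m
   >= 3 / 4, more than the available 1 / 2. *)
have far t : 0 <= t <= 2^-1 -> s < mdist O (gamma t).
  move=> /andP[t0 t2]; rewrite ltNge; apply/negP => ts.
  have [rg ig] := gr 0 t (lexx _) t0 t2.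
  have [pen0' mpen /(_ _ _ _ rg)] := upper_gradient_log_potential O kap0 s0 srad.
  have pg z : ((EFin \o log_penalty O kap rad s) z <= ghat z)%E.
    by rewrite /ghat le_max lexx orbT.
  have h1 := le_line_integral rg mpen mg pen0' (fun t' _ => pg (gamma t')).
  move=> /le_trans /(_ h1) /le_trans /(_ ig) H.
  have {}H : `|log_potential O kap s (gamma 0) - log_potential O kap s (gamma t)| <= t.
    by rewrite -[leRHS]subr0 -lee_fin.
  have sx' : s * 2 ^+ (m - 2) <= mdist O x.
    move: hx => /andP[+ _]; apply: le_trans; rewrite -hrad.
    rewrite -{2}(subnK (leq_trans (isT : (2 <= 8)%N) m8)) exprD; nra.
  move: H; rewrite /log_potential ga (max_r ts) max_l; last first.
    by apply: le_trans sx'; rewrite ler_peMr ?(ltW s0)// exprn_ege1// ler1n.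
  rewrite -mulrBr -ln_div ?posrE//; last by rewrite (lt_le_trans _ sx')// mulr_gt0// exprn_gt0.
  have : ln (2 ^+ (m - 2)) <= ln (mdist O x / s).
    rewrite ler_ln ?posrE ?exprn_gt0 ?divr_gt0//; last by rewrite (lt_le_trans _ sx')// mulr_gt0// exprn_gt0.
    by rewrite ler_pdivlMr// mulrC.
  rewrite lnXn//.
  have l2 : 2^-1 <= ln 2 :> R.
    have : ln (1 + - 2^-1) <= - 2^-1 :> R by apply: le_ln1Dx; lra.
    rewrite (_ : 1 + - 2^-1 = 2^-1 :> R); last lra.
    by rewrite lnV ?posrE//; lra.
  move=> h2 h3.
  have h4 : kap * (ln (mdist O x / s)) <= 2^-1.
    by apply: le_trans t2; apply: le_trans h3; exact: ler_norm.
  have h5 : (m - 2)%:R * 2^-1 <= ln (mdist O x / s).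
    by apply: le_trans h2; rewrite -[leRHS]mulr_natl ler_wpM2l.
  have : kap * ((m - 2)%:R * 2^-1) <= 2^-1.
    by apply: le_trans h4; rewrite ler_pM2l.
  rewrite /kap natrB; last by apply: leq_trans m8.
  rewrite (_ : 2 / m%:R * _ = 1 - 2 / m%:R); last by field; rewrite gt_eqF.
  have : 2 / m%:R <= 4^-1 :> R.
    by rewrite ler_pdivrMr// mulrC ler_pdivlMr// -natrM ler_nat.
  lra.
move=> t tt; split; first exact: far.
move: (tt) => /andP[t0 t2]; have [rg ig] := gr 0 t (lexx _) t0 t2.
have mh : measurable_fun setT (h : g_sigma_algebraType (@open X) -> \bar R).
  exact: measurable_lsc.
have mLh : measurable_fun setT ((fun z => L%:E * h z)%E : g_sigma_algebraType (@open X) -> \bar R).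
  by apply: measurable_lsc; exact: lsc_scale.
(* [ghat] dominates L h only away from O, where the curve has just been shown to stay. *)
have H : (line_integral (fun z => L%:E * h z)%E gamma 0 t <= (2^-1)%:E)%E.
  apply: le_trans (_ : t%:E <= _)%E; last by rewrite lee_fin.
  rewrite -[t in (_ <= t%:E)%E]subr0; apply: le_trans ig; apply: le_line_integral => // t' /andP[t'0 t't].
  rewrite /ghat le_max; apply/orP; left; rewrite /hs patchE mem_set//.
  by apply: far; rewrite t'0 (le_trans t't).
move: H; rewrite line_integralZ// ?(ltW L0)// muleC -lee_pdivlMr// => /le_trans; apply.
rewrite lee_fin /L invrK ler_piMl ?(ltW osc0)//; lra.
Qed.

End connect_in_annulus.

(** * Hausdorff content *)

Section hausdorff_content.
Context {R : realType} {X : completeMetricType R}.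
Implicit Types (beta r : R) (x : X) (E F : set X) (J : set nat).

Lemma hausdorff_content_ge0 beta E : (0 <= hausdorff_content beta E)%E.
Proof.
apply: le_ereal_inf_tmp => _ [J [x [r [_ _ ->]]]]; apply: esum_ge0 => k _.
by rewrite lee_fin powR_ge0.
Qed.

Lemma hausdorff_content_le beta :
  {homo @hausdorff_content R X beta : E F / E `<=` F >-> (E <= F)%E}.
Proof.
move=> E F EF; apply: le_ereal_inf => _ [J [x [r [r0 Fc ->]]]].
by exists J, x, r; split => //; exact: subset_trans Fc.
Qed.

Lemma hausdorff_content0 beta : @hausdorff_content R X beta set0 = 0%E.
Proof.
apply/eqP; rewrite eq_le hausdorff_content_ge0 andbT.
apply: ereal_inf_lbound; exists set0, (fun=> point), (fun=> 0); split => //.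
by rewrite esum_set0.
Qed.

Lemma hausdorff_content_sigma_subadditive beta :
  sigma_subadditive (@hausdorff_content R X beta).
Proof.
move=> E; have H0 n := hausdorff_content_ge0 beta (E n).
have [fin|] := pselect (forall n, hausdorff_content beta (E n) \is a fin_num); last first.
  move=> /existsNP[n]; rewrite ge0_fin_numE// => /negP; rewrite -leNgt leye_eq => /eqP nE.
  apply: (@le_trans _ _ +oo%E); first exact: leey.
  rewrite -nE; apply: le_trans (@nneseries_lim_ge _ _ xpredT 0%N n.+1 _) => //.
  by rewrite big_nat_recr//= leeDr// sume_ge0.
apply/lee_addgt0Pr => e e0.
apply: le_trans (epsilon_trick _ _ (ltW e0)) => //.
have : forall n, exists p : set nat * ((nat -> X) * (nat -> R)),
    [/\ forall k, p.1 k -> 0 < p.2.2 k, E n `<=` \bigcup_(k in p.1) ball (p.2.1 k) (p.2.2 k)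
    & (\esum_(k in p.1) (p.2.2 k `^ beta)%:E <=
       hausdorff_content beta (E n) + (e / (2 ^ n.+1)%:R)%:E)%E].
  move=> n; have en : 0 < e / (2 ^ n.+1)%:R by rewrite divr_gt0// ltr0n expn_gt0.
  have [_ [J [x [r [r0 Ec ->]]]] /ltW H] := lb_ereal_inf_adherent en (fin n).
  by exists (J, (x, r)).
move=> /choice[p Hp].
(* Covers are indexed by naturals, so the pairs of indices are coded by [pickle]; the default of [d]
   occurs only off the index set. *)
pose d n := odflt (0%N, 0%N) (unpickle n).
have dK k : d (pickle k) = k by rewrite /d pickleK.
pose P := [set: nat] `*`` (fun n => (p n).1).
have bij : set_bij P (pickle @` P) (pickle : nat * nat -> nat).
  split => //.
  by move=> a b _ _ /(congr1 d); rewrite !dK.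
apply: (@le_trans _ _ (\esum_(k in P) ((p k.1).2.2 k.2 `^ beta)%:E)).
  apply: ereal_inf_lbound; exists (pickle @` P),
    (fun n => (p (d n).1).2.1 (d n).2), (fun n => (p (d n).1).2.2 (d n).2); split.
  - by move=> _ [k [_ Jk] <-]; rewrite dK; case: (Hp k.1) => + _ _; exact.
  - move=> x [n _ Ex]; case: (Hp n) => _ /(_ x Ex)[k Jk xk] _.
    by exists (pickle (n, k)); [exists (n, k)|rewrite dK].
  - by rewrite (@reindex_esum _ _ _ P _ pickle _ bij); apply: eq_esum => k _; rewrite dK.
rewrite -(@esum_esum _ _ _ _ _ (fun n k => ((p n).2.2 k `^ beta)%:E)); last first.
  by move=> n k _ _; rewrite lee_fin powR_ge0.
rewrite nneseries_esumT => [|n]; last first.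
  by rewrite adde_ge0// lee_fin divr_ge0 ?(ltW e0)// ler0n.
by apply: le_esum => n _; case: (Hp n).
Qed.

HB.instance Definition _ beta := isOuterMeasure.Build R X (hausdorff_content beta)
  (hausdorff_content0 beta) (hausdorff_content_ge0 beta)
  (@hausdorff_content_le beta) (hausdorff_content_sigma_subadditive beta).

Lemma hausdorff_contentU beta E F :
  (hausdorff_content beta (E `|` F) <= hausdorff_content beta E + hausdorff_content beta F)%E.
Proof. exact: outer_measureU2. Qed.

Lemma hausdorff_content_ball beta x r : 0 < r ->
  (hausdorff_content beta (ball x r) <= (r `^ beta)%:E)%E.
Proof.
move=> r0; apply: ereal_inf_lbound.
exists [set 0%N], (fun=> x), (fun=> r); split => //.
  by move=> y xy; exists 0%N.
by rewrite esum_set1// lee_fin powR_ge0.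
Qed.

Lemma hausdorff_content_seq beta (s : seq X) r : 0 < r ->
  (hausdorff_content beta (\bigcup_(x in [set` s]) ball x r) <=
   ((size s)%:R * r `^ beta)%:E)%E.
Proof.
move=> r0; elim: s => [|x s ih]; first by rewrite bigcup0// hausdorff_content0 mul0r.
rewrite (_ : [set` x :: s] = x |` [set` s]); last first.
  apply/seteqP; split => y /=; rewrite inE; first by move=> /predU1P[->|]; [left|right].
  by move=> [->|ys]; rewrite ?eqxx ?ys ?orbT.
rewrite bigcup_setU1; apply: le_trans (hausdorff_contentU _ _ _) _.
rewrite /= -natr1 mulrDl mul1r addrC EFinD.
by apply: leeD => //; exact: hausdorff_content_ball.
Qed.

End hausdorff_content.

(** Subadditivity is assumed only for sequences of the sets B n and [set0], so that phi can be
    Lebesgue measure on measurable sets as well as an outer measure; [set0] fills the indices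
    outside J. *)
Lemma le_esum_cover {R : realType} {T : Type} (phi : set T -> \bar R) (E : set T)
    (J : set nat) (B : nat -> set T) (b : nat -> \bar R) : phi set0 = 0%E ->
  (forall A, (0 <= phi A)%E) ->
  (forall F : (set T)^nat, (forall n, F n = B n \/ F n = set0) ->
     E `<=` \bigcup_n F n -> (phi E <= \sum_(n <oo) phi (F n))%E) ->
  E `<=` \bigcup_(k in J) B k -> (forall k, J k -> phi (B k) <= b k)%E ->
  (phi E <= \esum_(k in J) b k)%E.
Proof.
move=> phi0 phige sub EJ phib.
pose F n := if n \in J then B n else set0.
apply: le_trans (sub F _ _) _.
- by move=> n; rewrite /F; case: ifP; [left|right].
- by move=> x /EJ[n Jn Bx]; exists n => //; rewrite /F mem_set.
rewrite nneseries_esumT// [leRHS]esum_mkcond; apply: le_esum => n _.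
by rewrite /F; case: ifP => [/set_mem/phib|]//; rewrite phi0.
Qed.

Lemma esumZl {R : realType} (J : set nat) (a : nat -> \bar R) (c : R) :
  0 <= c -> (forall k, (0 <= a k)%E) ->
  \esum_(k in J) (c%:E * a k)%E = (c%:E * \esum_(k in J) a k)%E.
Proof.
move=> c0 a0; rewrite !(esum_mkcond J).
rewrite -!nneseries_esumT; last 2 first.
- by move=> n; case: ifP.
- by move=> n; case: ifP => // _; rewrite mule_ge0.
rewrite -nneseriesZl//; last by move=> n _; case: ifP.
by apply: eq_eseriesr => n _; case: ifP => // _; rewrite mule0.
Qed.

(** The image of a ball lies in an interval of twice its radius, so a cover of E yields a cover of
    the interval from a to b. *)
Lemma hausdorff_content1_ge {R : realType} {X : completeMetricType R} (f : X -> R)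
    (E : set X) (a b : R) : (forall x y, `|f x - f y| <= mdist x y) ->
  (forall v, a < v < b -> exists2 x, E x & f x = v) ->
  (((b - a) / 2)%:E <= hausdorff_content 1 E)%E.
Proof.
move=> lf Ef; apply: le_ereal_inf_tmp => _ [J [x [r [r0 Ec ->]]]].
have [ba|ab] := leP b a.
  apply: (@le_trans _ _ 0%E); first by rewrite lee_fin; lra.
  by apply: esum_ge0 => k _; rewrite lee_fin powR_ge0.
have : ((b - a)%:E <= \esum_(k in J) (2%:E * (r k `^ 1)%:E))%E.
  rewrite (_ : (b - a)%:E = lebesgue_measure `]a, b[%classic); last first.
    by rewrite lebesgue_measure_itv/= lte_fin ab EFinB.
  apply: (@le_esum_cover _ _ _ _ _ (fun k => `](f (x k) - r k), (f (x k) + r k)[%classic)) => //.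
  - move=> F HF abF; apply: measure_sigma_subadditive => // n.
    by case: (HF n) => ->; [exact: measurable_itv|exact: measurable0].
  - move=> v /=; rewrite in_itv/= => /Ef[y Ey <-].
    have [k Jk] := Ec y Ey; rewrite ballEmdist/= => xy; exists k => //=.
    rewrite in_itv/= -ltr_distlC; exact: le_lt_trans (lf _ _) xy.
  move=> k Jk; rewrite lebesgue_measure_itv/= lte_fin.
  have rk := r0 k Jk; rewrite ifT; last by lra.
  by rewrite -EFinB -EFinM lee_fin powRr1 ?(ltW rk)//; lra.
rewrite esumZl// => [H|k]; last by rewrite lee_fin powR_ge0.
by rewrite EFinM muleC lee_pdivrMl.
Qed.

(** * Measure bounded by content *)

Section content_and_measure.
Context {R : realType} {X : completeMetricType R}.
Variable mu : {outer_measure set X -> \bar R}.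
Variables (Q CQ : R).
Hypothesis CQ1 : 1 <= CQ.
Hypothesis amu : ahlfors_regular mu Q CQ.

(** A cover of sum below rad^alpha uses balls of radius r <= rad, for which r^Q <= rad^(Q - alpha)
    r^alpha. *)
Lemma mu_le_hausdorff_content (E : set X) (alpha rad : R) :
  0 < alpha <= Q -> 0 < rad ->
  (hausdorff_content alpha E < (rad `^ alpha)%:E)%E ->
  (mu E <= (CQ * rad `^ (Q - alpha))%:E * hausdorff_content alpha E)%E.
Proof.
move=> /andP[al0 alQ] rad0 small.
have K0 : 0 < CQ * rad `^ (Q - alpha) by rewrite mulr_gt0 ?powR_gt0// (lt_le_trans _ CQ1).
rewrite -lee_pdivrMl//; apply/lee_addgt0Pr => e e0.
have fin : hausdorff_content alpha E \is a fin_num.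
  by rewrite ge0_fin_numE ?hausdorff_content_ge0// (lt_trans small)// ltry.
pose e' := Num.min e (rad `^ alpha - fine (hausdorff_content alpha E)).
have e'0 : 0 < e' by rewrite lt_min e0 subr_gt0 -lte_fin fineK.
have [_ [J [x [r [r0 Ec ->]]]] Hlt] := lb_ereal_inf_adherent e'0 fin.
apply: (@le_trans _ _ (\esum_(k in J) (r k `^ alpha)%:E)); last first.
  by apply: le_trans (ltW Hlt) _; rewrite leeD2l// lee_fin ge_min lexx.
have rk k : J k -> r k <= rad.
  move=> Jk; rewrite leNgt; apply/negP => radr.
  have : (\esum_(k in J) (r k `^ alpha)%:E < (rad `^ alpha)%:E)%E.
    apply: lt_le_trans Hlt _; rewrite -[X in (X + _)%E](fineK fin) -EFinD lee_fin.
    by rewrite -lerBrDl ge_min lexx orbT.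
  rewrite ltNge => /negP; apply; apply: esum_ge; exists [set k].
    by split; [exact: finite_set1|move=> _ ->].
  rewrite fsbig_set1 lee_fin; apply: ge0_ler_powR; rewrite ?nnegrE ?(ltW al0) ?(ltW rad0) ?(ltW radr)//.
  by rewrite ltW// r0.
rewrite lee_pdivrMl// -esumZl ?(ltW K0)// => [|k]; last by rewrite lee_fin powR_ge0.
apply: (@le_esum_cover _ _ _ _ _ (fun k => ball (x k) (r k))) => //.
- by move=> F HF EF; apply: le_trans (outer_measure_sigma_subadditive mu F); exact: le_outer_measure.
move=> k Jk; have [rk0 rkr] := (r0 k Jk, rk k Jk).
have /andP[_ h] := amu (x k) rk0; apply: le_trans h _; rewrite -EFinM lee_fin -mulrA.
rewrite ler_pM2l ?(lt_le_trans _ CQ1)//.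
have -> : r k `^ Q = r k `^ (Q - alpha) * r k `^ alpha.
  by rewrite -powRD ?subrK//; apply/implyP => _; rewrite gt_eqF.
rewrite ler_pM2r ?powR_gt0//.
by apply: ge0_ler_powR; rewrite ?nnegrE ?subr_ge0 ?(ltW rk0) ?(ltW rad0).
Qed.

End content_and_measure.

(** * Summability of the weights and choice of the levels *)

Section real_sequences.
Context {R : realType}.

Lemma le_one_bernoulli (d : R) i : 0 <= d -> 1 + i%:R * d <= (1 + d) ^+ i.
Proof.
move=> d0; elim: i => [|i ih]; first by rewrite mul0r addr0 expr0.
rewrite exprS; apply: (@le_trans _ _ ((1 + d) * (1 + i%:R * d))).
  rewrite -natr1; have : 0 <= d * (i%:R * d) by rewrite !mulr_ge0.
  lra.
by rewrite ler_wpM2l// addr_ge0.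
Qed.

Lemma geometric_sum_le (g : R) n : 0 < g < 1 -> \sum_(i < n) g ^+ i <= (1 - g)^-1.
Proof.
move=> /andP[g0 g1]; have g1' : 0 < 1 - g by rewrite subr_gt0.
suff -> : \sum_(i < n) g ^+ i = (1 - g ^+ n) / (1 - g).
  by rewrite ler_piMl ?invr_ge0 ?(ltW g1')// gerBl exprn_ge0 ?(ltW g0).
elim: n => [|n ih]; first by rewrite big_ord0 expr0 subrr mul0r.
by rewrite big_ord_recr/= ih exprS; field; rewrite gt_eqF.
Qed.

Lemma nneseries_le_bound (f : nat -> R) M : (forall n, 0 <= f n) ->
  (forall n, \sum_(i < n) f i <= M) -> (\sum_(i <oo) (f i)%:E <= M%:E)%E.
Proof.
move=> f0 fM; apply: lime_le.
  by apply: is_cvg_nneseries => i _ _; rewrite lee_fin.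
by apply: nearW => n; rewrite big_mkord sumEFin lee_fin.
Qed.

Lemma exists_weight_sum (Q alpha : R) : 0 < Q -> 0 < alpha ->
  exists2 K : R, 0 < K &
    forall n, \sum_(i < n) (2 ^- i) `^ alpha / (chain_weight i : R) `^ Q <= K.
Proof.
(* Chosen so that (i + 1)^(2 Q) is at most a constant times 2^(i alpha / 2), half of the available
   decay. *)
move=> Q0 al0; pose b := alpha / (4 * Q).
have b0 : 0 < b by rewrite divr_gt0 ?mulr_gt0.
pose d : R := 2 `^ b - 1.
have d0 : 0 < d.
  rewrite subr_gt0 -[ltLHS](powRr0 2) /powR gt_eqF// ltr_expR ltr_pM2r//.
  by rewrite ln_gt0// ltr1n.
pose A := 1 + d^-1; have A0 : 0 < A by rewrite addr_gt0 ?invr_gt0.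
pose g : R := 2 `^ (- (alpha / 2)).
have g01 : 0 < g < 1.
  rewrite powR_gt0//= -[ltRHS](powRr0 2) /g /powR gt_eqF// ltr_expR ltr_pM2r ?ln_gt0 ?ltr1n//.
  by rewrite oppr_lt0 divr_gt0.
have lin i : i.+1%:R <= A * 2 `^ (b * i%:R).
  rewrite powRrM powR_mulrn ?powR_ge0//.
  have -> : 2 `^ b = 1 + d by rewrite /d addrC subrK.
  apply: le_trans (ler_wpM2l (ltW A0) (le_one_bernoulli i (ltW d0))).
  rewrite /A -natr1 [leRHS](_ : _ = i%:R + 1 + (d^-1 + i%:R * d)).
    by rewrite lerDl addr_ge0 ?invr_ge0 ?(ltW d0)// mulr_ge0// ltW.
  by field; rewrite gt_eqF.
have g0 : 0 < g by case/andP: g01.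
have term i : (2 ^- i) `^ alpha / (chain_weight i : R) `^ Q <= A `^ (2 * Q) * g ^+ i.
  rewrite /chain_weight -!powR_invn// -!powRrM.
  have -> : (i.+1%:R : R) `^ (- 2 * Q) = (i.+1%:R `^ (2 * Q))^-1 by rewrite mulNr powRN.
  rewrite invrK; have Q2 : 0 <= 2 * Q by rewrite mulr_ge0// ltW.
  apply: (@le_trans _ _ (2 `^ (- i%:R * alpha) * (A * 2 `^ (b * i%:R)) `^ (2 * Q))).
    rewrite ler_wpM2l ?powR_ge0//; apply: ge0_ler_powR => //.
      by rewrite nnegrE.
    by rewrite nnegrE mulr_ge0 ?powR_ge0// ltW.
  rewrite powRM ?powR_ge0 ?(ltW A0)// mulrCA ler_pM2l ?powR_gt0//.
  rewrite -powRrM -powRD; last by apply/implyP => _; rewrite pnatr_eq0.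
  rewrite -powR_mulrn ?(ltW g0)// /g -powRrM (_ : _ + _ = - (alpha / 2) * i%:R)//.
  by rewrite /b; field; rewrite gt_eqF.
exists (A `^ (2 * Q) * (1 - g)^-1).
  by rewrite mulr_gt0 ?powR_gt0// invr_gt0 subr_gt0; case/andP: g01.
move=> n; apply: (@le_trans _ _ (\sum_(i < n) A `^ (2 * Q) * g ^+ i)).
  exact: ler_sum.
by rewrite -mulr_sumr ler_wpM2l ?powR_ge0//; exact: geometric_sum_le.
Qed.

(* The levels are the square roots of the remainders, so that the increments of
   N divided by the levels telescope. *)
Lemma exists_levels (N : nat -> R) l : (forall j, 0 <= N j) ->
  (forall j, N j.+1 <= N j) -> N @ \oo --> 0 ->
  exists theta : nat -> R, [/\ forall j, 0 < theta j,
    forall j, theta j.+1 <= theta j, theta @ \oo --> 0 &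
    forall j, N j - N (j + l)%N <= 2 * theta j * (theta j - theta j.+1)].
Proof.
(* T sums l consecutive remainders, so its decrement is exactly N j - N (j + l); the geometric term
   makes e positive. *)
move=> N0 dN Nlim; pose T j := \sum_(i < l) N (j + i)%N; pose e j := T j + 2^-1 ^+ j.
have Tdiff j : T j - T j.+1 = N j - N (j + l)%N.
  rewrite /T; elim: (l) => [|k ih]; first by rewrite !big_ord0 addn0 !subrr.
  by rewrite !big_ord_recr/= addSnnS; move: ih; set a := \sum_(i < k) _; set c := \sum_(i < k) _; lra.
have Tlim : T @ \oo --> 0.
  rewrite /T; elim: (l) => [|k ih].
    by under eq_fun do rewrite big_ord0; exact: cvg_cst.
  have h1 : (fun j => N (j + k)%N) @ \oo --> 0 by rewrite cvg_shiftn.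
  rewrite (_ : (fun j => _) = (fun j => \sum_(i < k) N (j + i)%N + N (j + k)%N)).
    by rewrite -[X in _ --> X]addr0; exact: cvgD.
  by apply/funext => j; rewrite big_ord_recr.
have elim0 : e @ \oo --> 0.
  rewrite -[X in _ --> X]addr0; apply: cvgD Tlim _; apply: cvg_expr.
  by rewrite ger0_norm// invf_lt1// ltr1n.
have e0 j : 0 < e j by rewrite ltr_wpDl ?sumr_ge0// exprn_gt0.
have Ndec j k : N (j + k)%N <= N j.
  by elim: k => [|k ih]; rewrite ?addn0// addnS; exact: le_trans ih.
have de j : N j - N (j + l)%N <= e j - e j.+1.
  rewrite -Tdiff /e; have : 2^-1 ^+ j.+1 <= 2^-1 ^+ j :> R.
    by rewrite exprS ler_piMl ?exprn_ge0// invf_le1// ler1n.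
  lra.
have ee j : e j.+1 <= e j by have := de j; have := Ndec j l; lra.
exists (fun j => Num.sqrt (e j)); split.
- by move=> j; rewrite sqrtr_gt0.
- by move=> j; exact: ler_wsqrtr.
- rewrite -sqrtr0; apply: continuous_cvg => //; exact: sqrt_continuous.
move=> j; apply: le_trans (de j) _.
have a2 : Num.sqrt (e j) ^+ 2 = e j by rewrite sqr_sqrtr// ltW.
have b2 : Num.sqrt (e j.+1) ^+ 2 = e j.+1 by rewrite sqr_sqrtr// ltW.
have pq : Num.sqrt (e j.+1) <= Num.sqrt (e j) by exact: ler_wsqrtr.
have p0 := sqrtr_ge0 (e j.+1).
have -> : e j - e j.+1 = Num.sqrt (e j) ^+ 2 - Num.sqrt (e j.+1) ^+ 2 by rewrite a2 b2.
by move: (Num.sqrt (e j)) (Num.sqrt (e j.+1)) pq p0 => q p pq p0; rewrite !expr2; nra.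
Qed.

End real_sequences.

(** * Content of the bad points of one scale *)

Section bad_points.
Context {R : realType} {X : completeMetricType R}.
Variable mu : {outer_measure set X -> \bar R}.
Variables (Q lam : R).
Hypothesis Q0 : 0 < Q.
Hypothesis lam1 : 1 <= lam.
Hypothesis mmu : metric_measure_space mu.
Variables (O : X) (h : X -> \bar R).
Hypothesis lsch : lower_semicontinuous h.
Implicit Types (x y z : X) (s rad theta alpha : R).

Local Notation T := (caratheodory_type mu).
Local Notation nu := (cmeasure mu).

Hypothesis ih : (\int[nu]_z (h z `^ Q) < +oo)%E.

Definition energy (A : set X) : \bar R := (\int[nu]_(z in A) (h z `^ Q))%E.

Let mh : measurable_fun setT ((fun z => h z `^ Q)%E : T -> \bar R).
Proof.
apply: measurableT_comp (measurable_poweR _) _.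
by apply: borel_measurable_fun => //; exact: measurable_lsc.
Qed.

Lemma energy_ge0 A : (0 <= energy A)%E.
Proof. by apply: integral_ge0 => z _; exact: poweR_ge0. Qed.

Lemma energy_le A B : measurable (A : set T) -> measurable (B : set T) ->
  A `<=` B -> (energy A <= energy B)%E.
Proof.
move=> mA mB AB; apply: ge0_subset_integral => //; first exact: measurable_funTS.
by move=> z _; exact: poweR_ge0.
Qed.

Lemma energy_fin A : measurable (A : set T) -> energy A \is a fin_num.
Proof.
move=> mA; rewrite ge0_fin_numE ?energy_ge0//; apply: le_lt_trans ih.
exact: energy_le.
Qed.

Lemma measurable_far_set s : measurable (far_set O s : set T).
Proof. by apply: borel_measurable => //; apply: borel_open; exact: open_far_set. Qed.

Let lam0 : 0 < lam. Proof. exact: lt_le_trans lam1. Qed.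

Lemma hausdorff_content_bad alpha : 0 < alpha -> exists2 K : R, 0 < K &
  forall s rad theta, 0 < rad -> 0 < theta ->
  (hausdorff_content alpha
    [set x | ball O rad x /\ ~ small_energy mu Q lam O h s rad theta x] <=
   (K * rad `^ alpha / theta)%:E *
   energy (ball O ((1 + 4 * lam) * rad) `&` far_set O s))%E.
Proof.
move=> al0; have [K K0 HK] := exists_weight_sum Q0 al0.
exists ((8 * lam) `^ alpha * K); first by rewrite mulr_gt0// powR_gt0 ?mulr_gt0.
move=> s rad theta rad0 th0.
set S := _ `&` far_set O s.
have mS : measurable (S : set T).
  by apply: measurableI; [exact: measurable_metric_ball|exact: measurable_far_set].
pose W := fine (energy S).
have W0 : 0 <= W by rewrite fine_ge0// energy_ge0.
have WE : energy S = W%:E by rewrite fineK// energy_fin.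
pose e i : R := lam * dyadic_radius (4 * rad) i.
have e0 i : 0 < e i by rewrite mulr_gt0// dyadic_radius_gt0// mulr_gt0.
have eE i : e i = 4 * lam * rad * 2 ^- i by rewrite /e /dyadic_radius; ring.
have v0 i : 0 < chain_weight i :> R := chain_weight_gt0 i.
pose t i : R := theta * chain_weight i `^ Q.
have t0 i : 0 < t i by rewrite mulr_gt0// powR_gt0.
pose M i := [set x | ball O rad x /\ ((t i)%:E < energy (ball x (e i) `&` far_set O s))%E].
have mBF x i : measurable (ball x (e i) `&` far_set O s : set T).
  by apply: measurableI; [exact: measurable_metric_ball|exact: measurable_far_set].
(* The balls of radius e i around these points are disjoint and lie in the large ball; each carries
   energy above t i out of the total W. *)
have count i (q : seq X) : uniq q -> (forall x, x \in q -> M i x) ->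
    {in q &, forall x y, x != y -> 2 * e i <= mdist x y} -> (size q)%:R * t i <= W.
  move=> uq qM qs; rewrite -lee_fin -WE.
  pose F x := ball x (e i) `&` far_set O s.
  apply: (@le_trans _ _ (\sum_(x <- q) energy (F x))).
    elim: q {uq qs} qM => [|x q IH] qM; first by rewrite big_nil mul0r.
    rewrite big_cons /= -natr1 mulrDl mul1r addrC EFinD leeD//.
      by apply/ltW; case: (qM x (mem_head _ _)).
    by apply: IH => y yq; apply: qM; rewrite inE yq orbT.
  rewrite /energy -(@ge0_integral_bigsetU _ T R nu _ F)//; last 4 first.
  - by move=> x; exact: mBF.
  - move=> x y /= xq yq [z [[xz _] [yz _]]]; apply/eqP/negP => /negP xy.
    have := ball_disjoint (qs x y xq yq xy); rewrite (mulrC 2) mulfK// => D.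
    have : (ball x (e i) `&` ball y (e i)) z by [].
    by rewrite D.
  - exact: measurable_funTS.
  - by move=> z _; exact: poweR_ge0.
  apply: ge0_subset_integral => //.
  - by apply: bigsetU_measurable => x _; exact: mBF.
  - exact: measurable_funTS.
  - by move=> z _; exact: poweR_ge0.
  rewrite -bigcup_seq => z [x /= xq [xz fz]]; split => //.
  have [Ox _] := qM x xq; move: xz Ox; rewrite !ballEmdist/= => xz Ox.
  apply: le_lt_trans (metric_triangle O x z) _.
  have ei : e i <= 4 * lam * rad.
    rewrite eE ler_piMr ?mulr_ge0 ?(ltW lam0) ?(ltW rad0)//.
    by rewrite invf_le1 ?exprn_gt0// exprn_ege1// ler1n.
  by rewrite mulrDl mul1r; apply: ltrD => //; exact: lt_le_trans ei.
have HM i : (hausdorff_content alpha (M i) <=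
    (W / theta * (8 * lam * rad) `^ alpha *
      ((2 ^- i) `^ alpha / (chain_weight i : R) `^ Q))%:E)%E.
  have [||q [uq qM qs qc]] := @maximal_separated _ _ (M i) (2 * e i) (Num.truncn (W / t i)).
  - by rewrite mulr_gt0.
  - move=> q uq qM qs; rewrite truncn_ge_nat ?divr_ge0 ?(ltW (t0 i))//.
    by rewrite ler_pdivlMr//; exact: count.
  apply: le_trans (hausdorff_content_le alpha qc) _.
  apply: le_trans (hausdorff_content_seq _ _ _) _; first by rewrite mulr_gt0.
  rewrite lee_fin (_ : 2 * e i = 8 * lam * rad * 2 ^- i); last by rewrite eE; ring.
  rewrite powRM ?mulr_ge0 ?(ltW lam0) ?(ltW rad0) ?invr_ge0 ?exprn_ge0//.
  have : (size q)%:R <= W / t i by rewrite ler_pdivlMr//; exact: count.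
  have c0 : 0 <= (8 * lam * rad) `^ alpha * (2 ^- i) `^ alpha by rewrite mulr_ge0 ?powR_ge0.
  move=> /(ler_wpM2r c0) /le_trans; apply.
  rewrite le_eqVlt; apply/orP; left; apply/eqP.
  by rewrite /t; field; rewrite !gt_eqF ?powR_gt0.
apply: (@le_trans _ _ (hausdorff_content alpha (\bigcup_i M i))).
  apply: hausdorff_content_le => x [Ox /existsNP[i /negP]].
  by rewrite -ltNge => Hi; exists i.
apply: le_trans (hausdorff_content_sigma_subadditive _ _) _.
apply: (@le_trans _ _ (\sum_(i <oo) (W / theta * (8 * lam * rad) `^ alpha *
      ((2 ^- i) `^ alpha / (chain_weight i : R) `^ Q))%:E)%E).
  by apply: lee_nneseries => i _; [move=> _; exact: hausdorff_content_ge0|exact: HM].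
have c0 : 0 <= W / theta * (8 * lam * rad) `^ alpha.
  by rewrite mulr_ge0 ?powR_ge0// divr_ge0// ltW.
rewrite WE -EFinM.
apply: (@le_trans _ _ (W / theta * (8 * lam * rad) `^ alpha * K)%:E).
  apply: nneseries_le_bound => [i|n].
    by rewrite !mulr_ge0 ?invr_ge0 ?powR_ge0// ltW.
  by rewrite -mulr_sumr ler_wpM2l.
rewrite lee_fin (powRM _ _ (ltW rad0)) ?mulr_ge0 ?(ltW lam0)//.
rewrite le_eqVlt; apply/orP; left; apply/eqP; ring.
Qed.

End bad_points.

Lemma exists_expr2_gt {R : realType} (x : R) : exists n, x < 2 ^+ n.
Proof.
exists (Num.truncn x).+1; apply: lt_trans (truncnS_gt x) _.
by rewrite -natrX ltr_nat ltn_expl.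
Qed.

(** All that the rest of the proof uses of the energy estimates. The annuli carry the factor 2^m
    because the joining curves may descend by about m dyadic scales: those of scale j start near
    radius 2^m 2^(j+1) and stay outside radius 2^(j+3). The bound on their speed will control
    lengths. *)
Record exceptional_set {R : realType} {X : completeMetricType R} (O : X) (u : X -> R)
    (m : nat) (E : set X) (omega : nat -> R) : Prop := ExceptionalSet {
  exceptional_cvg0 : omega @ \oo --> 0 ;
  exceptional_thin : forall alpha : R, 0 < alpha -> (fun k : nat => \sum_(k <= j <oo)
       (hausdorff_content alpha (E `&` outer_annulus O (2 ^+ m * 2 ^+ j.+1))
        * (((2 ^+ m * 2 ^+ j.+1) `^ alpha)%R^-1)%:E))%E @ \oo --> 0%E ;
  exceptional_join : forall j x y,
    (outer_annulus O (2 ^+ m * 2 ^+ j.+1) `|` outer_annulus O (2 ^+ m * 2 ^+ j.+2)) x ->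
    (outer_annulus O (2 ^+ m * 2 ^+ j.+1) `|` outer_annulus O (2 ^+ m * 2 ^+ j.+2)) y ->
    ~ E x -> ~ E y ->
    exists gamma : R -> X, [/\ gamma 0 = x, gamma 2^-1 = y,
    forall t t' : R, 0 <= t -> t <= t' -> t' <= 2^-1 ->
      2 / m%:R / (2 ^+ m * 2 ^+ j.+3) * mdist (gamma t) (gamma t') <= t' - t &
    forall t : R, 0 <= t <= 2^-1 -> 2 ^+ j.+3 < mdist O (gamma t) /\
      `|u x - u (gamma t)| <= omega j] }.

(** * Construction of the exceptional set *)

Section exceptional_set.
Context {R : realType} {X : completeMetricType R}.
Variable mu : {outer_measure set X -> \bar R}.
Variables (Q CQ CP lam : R).
Hypothesis Q1 : 1 < Q.
Hypothesis CQ1 : 1 <= CQ.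
Hypothesis CP0 : 0 < CP.
Hypothesis lam1 : 1 <= lam.
Hypothesis mmu : metric_measure_space mu.
Hypothesis amu : ahlfors_regular mu Q CQ.
Hypothesis pmu : poincare mu Q CP lam.
Variable O : X.
Implicit Types (x y z : X) (r e d s rad theta : R) (A B : set X).

Local Notation T := (caratheodory_type mu).
Local Notation nu := (cmeasure mu).
Local Notation lev := (good_level Q CQ CP).

Let Q0 : 0 < Q. Proof. exact: lt_trans Q1. Qed.
Let lev0 : 0 < lev. Proof. exact: good_level_gt0. Qed.
Let lam0 : 0 < lam. Proof. exact: lt_le_trans lam1. Qed.

Lemma oscillation_bound_cvg0 (theta : nat -> R) : (forall j, 0 < theta j) ->
  theta @ \oo --> 0 -> (fun j => oscillation_bound Q CQ CP (theta j)) @ \oo --> 0.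
Proof.
move=> th0 thlim; apply/cvgr0Pnorm_lt => e e0.
have lQ : 0 < lev `^ Q by rewrite powR_gt0.
have c0 : 0 < e `^ Q * lev `^ Q / 2 by rewrite divr_gt0 ?mulr_gt0 ?powR_gt0.
move/cvgr0Pnorm_lt : thlim => /(_ _ c0); apply: filterS => j.
rewrite !ger0_norm ?powR_ge0 ?(ltW (th0 j))// => thj.
have -> : e = (e `^ Q) `^ Q^-1 by rewrite -powRrM mulfV ?gt_eqF// powRr1// ltW.
apply: gt0_ltr_powR; rewrite ?invr_gt0 ?nnegrE ?powR_ge0//.
  by rewrite divr_ge0 ?mulr_ge0 ?(ltW lQ) ?(ltW (th0 j)).
by rewrite ltr_pdivrMr// mulrC -ltr_pdivlMr.
Qed.

Section energy.
Variable h : X -> \bar R.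
Hypothesis lsch : lower_semicontinuous h.
Hypothesis ih : (\int[nu]_z (h z `^ Q) < +oo)%E.

Local Notation energy := (energy mu Q h).
Let efin A := @energy_fin _ _ mu Q mmu h lsch ih A.

Let mh (D : set T) : measurable_fun D ((fun z => h z `^ Q)%E : T -> \bar R).
Proof.
apply: measurable_funTS; apply: measurableT_comp (measurable_poweR _) _.
by apply: borel_measurable_fun => //; exact: measurable_lsc.
Qed.

Lemma energyU A B : measurable (A : set T) -> measurable (B : set T) ->
  A `&` B = set0 -> energy (A `|` B) = (energy A + energy B)%E.
Proof.
move=> mA mB AB; apply: ge0_integral_setU => //; last exact/disj_set2P.
by move=> z _; exact: poweR_ge0.
Qed.

Lemma energy_far_cvg0 : (fun j => fine (energy (far_set O (2 ^+ j)))) @ \oo --> 0.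
Proof.
pose F j := ~` far_set O (2 ^+ j) : set X.
have mfar j := measurable_far_set mmu O (2 ^+ j).
have mF j : measurable (F j : set T) by exact: measurableC.
have FT : \bigcup_j F j = setT.
  apply/seteqP; split => // z _; have [j hj] := exists_expr2_gt (mdist O z).
  by exists j => //; apply/negP; rewrite -leNgt ltW.
have : energy (F j) @[j --> \oo] --> energy setT.
  rewrite -FT; apply: (@ge0_nondecreasing_set_cvg_integral _ T R F _ nu) => //.
  - apply/nondecreasing_seqP => j; apply/subsetPset => z /negP; rewrite -leNgt => zj.
    apply/negP; rewrite -leNgt (le_trans zj)// exprS ler_peMl ?exprn_ge0//.
    by rewrite ler1n.
  - by move=> j z _; exact: poweR_ge0.
have fT : energy setT \is a fin_num by exact: efin.
rewrite -(fineK fT) => /fine_cvg H.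
rewrite (_ : (fun _ => _) = (fun j => fine (energy setT) - fine (energy (F j)))); last first.
  apply/funext => j; have -> : energy setT = (energy (far_set O (2 ^+ j)) + energy (F j))%E.
    by rewrite -energyU ?setICr// setUv.
  by rewrite (fineD (efin (mfar j)) (efin (mF j))) addrK.
rewrite -(subrr (fine (energy setT))); apply: cvgB H; exact: cvg_cst.
Qed.

End energy.

Lemma small_energy_le (h : X -> \bar R) s s' rad rad' theta theta' x :
  lower_semicontinuous h ->
  s' <= s -> 0 < rad -> rad <= rad' -> theta' <= theta ->
  small_energy mu Q lam O h s' rad' theta' x -> small_energy mu Q lam O h s rad theta x.
Proof.
move=> lsch ss r0 rr tt H i; apply: (@le_trans _ _ (theta' * chain_weight i `^ Q)%:E); last first.
  by rewrite lee_fin ler_wpM2r// powR_ge0.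
apply: le_trans (H i); apply: energy_le => //.
- by apply: measurableI; [exact: measurable_metric_ball|exact: measurable_far_set].
- by apply: measurableI; [exact: measurable_metric_ball|exact: measurable_far_set].
apply: setISS => z; last exact: le_lt_trans.
rewrite !ballEmdist/= => /lt_le_trans; apply; rewrite ler_pM2l//.
by rewrite /dyadic_radius ler_wpM2r ?invr_ge0 ?exprn_ge0// ler_pM2l.
Qed.

Lemma outer_annulus_dyadic (C : R) i j x : 0 < C ->
  outer_annulus O (C * 2 ^+ i) x -> outer_annulus O (C * 2 ^+ j) x -> i = j.
Proof.
move=> C0; rewrite /outer_annulus !ballEmdist/= => -[iu /negP]; rewrite -leNgt => il.
move=> [ju /negP]; rewrite -leNgt => jl.
have H k l : C * 2 ^+ k <= mdist O x -> mdist O x < 2 * (C * 2 ^+ l) -> (k <= l)%N.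
  move=> h1 h2; have := le_lt_trans h1 h2; rewrite mulrCA -exprS ltr_pM2l//.
  by rewrite ltr_eXn2l ?ltr1n.
by apply/eqP; rewrite eqn_leq !H.
Qed.

Variable m : nat.
Hypothesis m8 : (8 <= m)%N.
Let kap : R := 2 / m%:R.
Hypothesis mdepth :
  2 * CQ * (10 * lam * kap * (128 * lam)) `^ Q * (m%:R + 2) <= lev `^ Q.

Local Notation An := (fun j : nat => outer_annulus O (2 ^+ m * 2 ^+ j.+1)).

Lemma exists_exceptional_set (u : X -> R) : homogeneous_newtonian mu Q u ->
  exists (E : set X) (omega : nat -> R), exceptional_set O u m E omega.
Proof.
move=> [_ [rho [rho0 mrho urho] irho]].
have oA n : open (ball O n.+1%:R : set X) by exact: open_ball.
have fA n : (mu (ball O n.+1%:R) < +oo)%E.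
  by have := pmu.1 O n.+1%:R (ltr0Sn _ _) => /andP[].
have cA : \bigcup_n ball O n.+1%:R = setT :> set X.
  apply/seteqP; split => // z _; exists (Num.truncn (mdist O z)) => //.
  by rewrite ballEmdist; exact: truncnS_gt.
have [h [lsch h0 rhoh ih]] := vitali_caratheodory mmu oA fA cA Q0 rho0 mrho irho.
have efin A := @energy_fin _ _ mu Q mmu h lsch ih A.
pose far j := far_set O (2 ^+ j.+2) : set X.
have mfar j : measurable (far j : set T) by exact: measurable_far_set.
pose N j := fine (energy mu Q h (far j)).
have N0 j : 0 <= N j by rewrite fine_ge0// energy_ge0.
have farS j k : (j <= k)%N -> far k `<=` far j.
  by move=> jk z; apply: le_lt_trans; rewrite ler_eXn2l ?ltr1n// !ltnS.
have dN j : N j.+1 <= N j.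
  by rewrite fine_le ?efin// energy_le//; exact: farS.
have Nlim : N @ \oo --> 0.
  rewrite (_ : N = (fun j => fine (energy mu Q h (far_set O (2 ^+ (j + 2)))))); last first.
    by apply/funext => j; rewrite addn2.
  rewrite (@cvg_shiftn 2 _ (fun j => fine (energy mu Q h (far_set O (2 ^+ j))))).
  exact: energy_far_cvg0.
(* The balls used at scale j lie in B(O, (1 + 4 lam) rad j), which does not meet [far (j + l)]; so
   the energy involved is at most N j - N (j + l). *)
have [l hl] := exists_expr2_gt ((1 + 4 * lam) * 2 ^+ m * 2).
have [theta [th0 dth thlim thN]] := exists_levels l N0 dN Nlim.
pose rad j : R := 2 ^+ m * 2 ^+ j.+3.
have rad0 j : 0 < rad j by rewrite mulr_gt0 ?exprn_gt0.
(* A point of the j-th annulus is joined to both neighbouring annuli, at scales j - 1 and j. The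
   radius 2^(j+2) is the inner one of scale j - 1, while [rad j] and [theta j] belong to scale j:
   each is the stricter choice, so a point off E serves at both scales. *)
pose E := \bigcup_j (An j `&` ~` small_energy mu Q lam O h (2 ^+ j.+2) (rad j) (theta j)).
exists E, (fun j => oscillation_bound Q CQ CP (theta j)); split.
- exact: oscillation_bound_cvg0.
- move=> al al0; have [K K0 HK] := hausdorff_content_bad Q0 lam1 mmu O lsch ih al0.
  (* The 2 comes from the levels, the power of 4 from [rad j] being 4 times the inner radius of the
     annulus. *)
  pose D := 2 * K * 4 `^ al.
  have D0 : 0 < D by rewrite !mulr_gt0 ?powR_gt0.
  have term j : (hausdorff_content al (E `&` An j) *
      (((2 ^+ m * 2 ^+ j.+1) `^ al)%R^-1)%:E <= (D * (theta j - theta j.+1))%:E)%E.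
    have b0 : 0 < 2 ^+ m * 2 ^+ j.+1 :> R by rewrite mulr_gt0 ?exprn_gt0.
    rewrite muleC lee_pdivrMl ?powR_gt0//.
    pose S := ball O ((1 + 4 * lam) * rad j) `&` far j.
    have mS : measurable (S : set T).
      by apply: measurableI => //; exact: measurable_metric_ball.
    apply: (@le_trans _ _ ((K * rad j `^ al / theta j)%:E * energy mu Q h S)%E).
      apply: le_trans (HK (2 ^+ j.+2) (rad j) (theta j) (rad0 j) (th0 j)).
      apply: hausdorff_content_le => x [[i _ [Ai Hi]] Aj].
      have [] : i.+1 = j.+1 by apply: outer_annulus_dyadic Ai Aj; rewrite exprn_gt0.
      move=> ij; rewrite -ij; split => //; case: Ai => + _.
      by rewrite !ballEmdist/= => /lt_le_trans; apply; rewrite mulrCA /rad -exprS ler_pM2l ?exprn_gt0// ler_eXn2l ?ltr1n.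
    have eS : fine (energy mu Q h S) <= N j - N (j + l)%N.
      rewrite lerBrDr -fineD ?efin// -energyU//; last first.
        apply/seteqP; split => // z [[]]; rewrite ballEmdist/= => zb _ zf.
        have := lt_trans zf zb; rewrite ltNge => /negP; apply.
        rewrite [leRHS](_ : _ = 2 ^+ l * 2 ^+ j.+2); last first.
          by rewrite -exprD; congr (2 ^+ _); rewrite addnC !addnS.
        rewrite [leLHS](_ : _ = (1 + 4 * lam) * 2 ^+ m * 2 * 2 ^+ j.+2); last first.
          by rewrite /rad (exprS 2 j.+2); ring.
        by apply: ler_wpM2r; [rewrite exprn_ge0|exact: ltW].
      rewrite fine_le ?efin//; first exact: measurableU.
      apply: energy_le => //; first exact: measurableU.
      by move=> z [[]|] //; apply: farS; exact: leq_addr.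
    rewrite -(fineK (efin _ mS)) -!EFinM lee_fin.
    have h1 : fine (energy mu Q h S) <= 2 * theta j * (theta j - theta j.+1).
      exact: le_trans eS (thN j).
    have c0 : 0 <= K * rad j `^ al / theta j.
      by rewrite divr_ge0 ?mulr_ge0 ?powR_ge0 ?(ltW K0) ?(ltW (th0 j)).
    apply: le_trans (ler_wpM2l c0 h1) _; rewrite le_eqVlt; apply/orP; left; apply/eqP.
    have -> : rad j = 4 * (2 ^+ m * 2 ^+ j.+1) by rewrite /rad !exprS; ring.
    rewrite powRM ?(ltW b0)// /D; field; rewrite gt_eqF//.
  have pos j : (0 <= hausdorff_content al (E `&` An j) *
      (((2 ^+ m * 2 ^+ j.+1) `^ al)%R^-1)%:E)%E.
    by rewrite mule_ge0 ?hausdorff_content_ge0// lee_fin invr_ge0 powR_ge0.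
  apply: (@squeeze_cvge _ _ _ _ (fun=> 0%E) _ (fun k => (D * theta k)%:E)).
  + apply: nearW => k; apply/andP; split; first exact: nneseries_ge0.
    apply: (@le_trans _ _ (\sum_(k <= j <oo) (D * (theta j - theta j.+1))%:E)%E).
      by apply: lee_nneseries => j _.
    apply: lime_le.
      apply: is_cvg_nneseries => j _ _.
      by rewrite lee_fin mulr_ge0 ?(ltW D0)// subr_ge0.
    apply: nearW => n; rewrite sumEFin lee_fin.
    have [kn|nk] := leqP k n; last by rewrite big_geq ?(ltnW nk)// mulr_ge0 ?(ltW D0) ?(ltW (th0 k)).
    rewrite -mulr_sumr ler_pM2l// (eq_bigr (fun j => - theta j.+1 - - theta j)); last first.
      by move=> j _; ring.
    by rewrite (telescope_sumr (fun j => - theta j))// opprK gerDr oppr_le0 ltW.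
  + exact: cvg_cst.
  apply: cvg_EFin; first by apply: nearW.
  by rewrite -(mulr0 D); apply: cvgM => //; exact: cvg_cst.
move=> j x y Ax Ay nEx nEy.
have C0 : 0 < 2 ^+ m :> R by rewrite exprn_gt0.
have good z : (An j `|` An j.+1) z -> ~ E z ->
    rad j / 4 <= mdist O z <= rad j /\ small_energy mu Q lam O h (2 ^+ j.+3) (rad j) (theta j) z.
  move=> Az nEz.
  have Hs i : An i z -> small_energy mu Q lam O h (2 ^+ i.+2) (rad i) (theta i) z.
    by move=> Ai; apply: contrapT => ns; apply: nEz; exists i.
  have rE : rad j = 4 * (2 ^+ m * 2 ^+ j.+1) by rewrite /rad !exprS; ring.
  have r2 : rad j = 2 * (2 ^+ m * 2 ^+ j.+2) by rewrite /rad !exprS; ring.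
  split.
    case: Az; rewrite /outer_annulus !ballEmdist/= => -[hu /negP]; rewrite -leNgt => hl'.
      have : 0 < 2 ^+ m * 2 ^+ j.+1 :> R by rewrite mulr_gt0 ?exprn_gt0.
      by rewrite rE; lra.
    have : 2 ^+ m * 2 ^+ j.+2 = 2 * (2 ^+ m * 2 ^+ j.+1) :> R by rewrite exprS; ring.
    have : 0 < 2 ^+ m * 2 ^+ j.+1 :> R by rewrite mulr_gt0 ?exprn_gt0.
    by rewrite rE; lra.
  case: Az => /Hs; apply: small_energy_le => //.
    by rewrite ler_eXn2l ?ltr1n.
  by rewrite ler_pM2l// ler_eXn2l ?ltr1n.
have [hx sx] := good x Ax nEx; have [hy sy] := good y Ay nEy.
have s0 : 0 < 2 ^+ j.+3 :> R by rewrite exprn_gt0.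
have rad1 : 1 <= rad j by rewrite mulr_ege1 ?exprn_ege1 ?ler1n.
have [g [ga gb gl gr gh]] := connect_in_annulus Q1 CQ1 CP0 lam1 mmu amu pmu lsch h0 m8 mdepth
  s0 (erefl : 2 ^+ m * 2 ^+ j.+3 = rad j) rad1 (th0 j) hx hy sx sy.
exists g; split => // t tt; have [far_t ht] := gh t tt; split => //.
have /andP[t0 t2] := tt; have rg := gr 0 t (lexx _) t0 t2.
rewrite -lee_fin -ga; apply: le_trans (urho _ _ _ rg) _; apply: le_trans ht.
by apply: le_line_integral => //; exact: measurable_lsc.
Qed.

End exceptional_set.

Lemma dyadic_floor {R : realType} (a b : R) : 0 < a -> a <= b ->
  exists n, a * 2 ^+ n <= b < a * 2 ^+ n.+1.
Proof.
move=> a0 ab; have [N hN] := exists_expr2_gt (b / a).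
have Nb : b < a * 2 ^+ N by rewrite mulrC -ltr_pdivrMr.
elim: N {hN} Nb => [|N ih] Nb; first by move: Nb; rewrite expr0 mulr1 ltNge ab.
by have [|Nb'] := ltP b (a * 2 ^+ N); [exact: ih|exists N; rewrite Nb' Nb].
Qed.

(** Turns a small oscillation into closeness to c, finite or not: for infinite c, a half-line is
    moved by 1. *)
Lemma nbhs_ereal_shrink {R : realType} (c : \bar R) (V : set (\bar R)) : nbhs c V ->
  exists (W : set (\bar R)) (d : R), [/\ 0 < d, nbhs c W &
    forall a b : R, W a%:E -> `|a - b| <= d -> V b%:E].
Proof.
case: c => [r| |].
- move=> Vr; have /nbhs_ballP[e /= e0 re] : nbhs r (fun x : R => V x%:E) := Vr; exists (EFin @` ball r (e / 2)), (e / 3).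
  split; first by rewrite divr_gt0.
    apply: filterS (nbhsx_ballx r (e / 2) _); last by rewrite divr_gt0.
    by move=> a ra; exists a.
  move=> a b [a' ra [aa']] ab; apply: re; move: ra; rewrite aa' /ball/= => ra.
  have -> : r - b = (r - a) + (a - b) by ring.
  apply: le_lt_trans (ler_normD _ _) _; lra.
- move=> [M [_ MV]]; exists [set y | ((M + 1)%:E < y)%E], 1; split => //.
    by exists (M + 1); split => //; exact: num_real.
  move=> a b /=; rewrite lte_fin => Ma ab; apply: MV; rewrite lte_fin.
  by move: ab; rewrite ler_norml => /andP[_]; lra.
move=> [M [_ MV]]; exists [set y | (y < (M - 1)%:E)%E], 1; split => //.
  by exists (M - 1); split => //; exact: num_real.
move=> a b /=; rewrite lte_fin => Ma ab; apply: MV; rewrite lte_fin.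
by move: ab; rewrite ler_norml => /andP[+ _]; lra.
Qed.

Lemma eseries_term_small {R : realType} (f : nat -> \bar R) (e : R) :
  (forall j, 0 <= f j)%E -> (fun k => \sum_(k <= j <oo) f j)%E @ \oo --> 0%E -> 0 < e ->
  exists k, forall j, (k <= j)%N -> (f j <= e%:E)%E.
Proof.
move=> f0 flim e0.
have : nbhs (0%E : \bar R) [set t | (t < e%:E)%E] by apply: open_ereal_lt'; rewrite lte_fin.
move=> /flim [k _ H]; exists k => j kj; apply: le_trans (ltW (H j kj)).
apply: le_trans (@nneseries_lim_ge _ f xpredT j j.+1 _) => //.
by rewrite big_nat1.
Qed.

(** * Annuli and the curves that cross them *)

Section annuli.
Context {R : realType} {X : completeMetricType R}.
Implicit Types (O x y z : X) (gamma : R -> X) (r q : R).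

Lemma outer_annulusP O q x : outer_annulus O q x <-> q <= mdist O x < 2 * q.
Proof.
rewrite /outer_annulus !ballEmdist/=; split; first by move=> [-> /negP]; rewrite -leNgt => ->.
by move=> /andP[qx ->]; split => //; apply/negP; rewrite -leNgt.
Qed.

Lemma curve_norm_ivt O gamma (a b v : R) : a <= b ->
  (forall t, a <= t <= b -> forall e, 0 < e -> exists2 d, 0 < d & forall t', a <= t' <= b ->
     `|t - t'| < d -> mdist (gamma t) (gamma t') < e) ->
  mdist O (gamma a) <= v <= mdist O (gamma b) ->
  exists2 t, a <= t <= b & mdist O (gamma t) = v.
Proof.
move=> ab cg /andP[av vb].
have cf : {within `[a, b], continuous (mdist O \o gamma)}.
  apply/subspace_continuousP => t /=; rewrite in_itv/= => tab.
  apply/cvgrPdist_lt => e e0; have [d d0 H] := cg t tab e e0.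
  rewrite /within/=; exists d => //= t' tt'; rewrite in_itv/= => t'ab.
  apply: le_lt_trans (H t' t'ab tt'); rewrite -[leRHS]mul1r.
  exact: mdist_lipschitz.
have [|t] := IVT ab cf (v := v).
  by rewrite ge_min av/= le_max vb orbT.
by rewrite in_itv; exists t.
Qed.

Lemma infinite_curve_mdist gamma t t' : infinite_curve gamma -> 0 <= t -> t <= t' ->
  mdist (gamma t) (gamma t') <= t' - t.
Proof.
move=> [_ lg _] t0 tt'; have t'0 := le_trans t0 tt'.
exact: (curve_length_eq_mdist t0 t'0 (lg t t0) (lg t' t'0) tt').
Qed.

Lemma infinite_curve_norm O gamma v : infinite_curve gamma ->
  mdist O (gamma 0) <= v -> exists2 t, 0 <= t & mdist O (gamma t) = v.
Proof.
move=> ig gv; have [_ _ ug] := ig; have [_ [t /= t0 <-]] := ug O v.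
rewrite in_itv/= andbT in t0; rewrite ballEmdist/= => /negP; rewrite -leNgt => vt.
have [||t' /andP[t'0 _] <-] := @curve_norm_ivt O gamma 0 t v t0; last by exists t'.
- move=> s /andP[s0 st] e e0; exists e => // s' /andP[s'0 s't] ss'.
  have [h|h] := leP s s'.
    apply: le_lt_trans (infinite_curve_mdist ig s0 h) _; apply: le_lt_trans ss'.
    by rewrite distrC ler_norm.
  rewrite metric_sym; apply: le_lt_trans (infinite_curve_mdist ig s'0 (ltW h)) _.
  by apply: le_lt_trans ss'; rewrite ler_norm.
by rewrite gv.
Qed.

End annuli.

(** * Content of annuli; complements of thin sets *)

Section connected_space.
Context {R : realType} {X : completeMetricType R}.
Variable mu : {outer_measure set X -> \bar R}.
Variables (Q CQ CP lam : R).
Hypothesis Q1 : 1 < Q.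
Hypothesis CQ1 : 1 <= CQ.
Hypothesis CP0 : 0 < CP.
Hypothesis lam1 : 1 <= lam.
Hypothesis mmu : metric_measure_space mu.
Hypothesis amu : ahlfors_regular mu Q CQ.
Hypothesis pmu : poincare mu Q CP lam.
Hypothesis unb : unbounded_set [set: X].
Variable O : X.
Implicit Types (x y z : X) (r e d q : R) (E : set X).

Let Q0 : 0 < Q. Proof. exact: lt_trans Q1. Qed.
Let lev0 : 0 < good_level Q CQ CP. Proof. exact: good_level_gt0. Qed.
Let lam0 : 0 < lam. Proof. exact: lt_le_trans lam1. Qed.
Let CQ0 : 0 < CQ. Proof. exact: lt_le_trans CQ1. Qed.

(** A small constant weight makes every point good, so O is joined by a curve to a point of norm at
    least q, and the norm takes the value q on the way. *)
Lemma exists_norm q : 0 <= q -> exists x, mdist O x = q.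
Proof.
move=> q0; have [y _] := unb O q; rewrite ballEmdist/= => /negP; rewrite -leNgt => qy.
pose r := 2 * (mdist O y + 1); have r0 : 0 < r by rewrite mulr_gt0// ltr_wpDl ?mdist_ge0.
(* With d A <= 1, the energy of the constant d is below the level at every scale; the 4 is that of
   [expr2V_le_chain_weight]. *)
pose A := 4 * CQ * lam * r / good_level Q CQ CP.
have A0 : 0 < A by rewrite /A divr_gt0// mulr_gt0// mulr_gt0// mulr_gt0.
pose d := (1 + A)^-1; have d0 : 0 < d by rewrite invr_gt0 addr_gt0.
have d1 : d <= 1 by rewrite invf_le1 ?addr_gt0// lerDl ltW.
have dA : d * A <= 1 by rewrite mulrC ler_pdivrMr ?addr_gt0// mul1r lerDr.
pose g (z : X) : \bar R := d%:E.
have lg : lower_semicontinuous g.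
  apply: (@lsc_lipschitz _ _ (fun=> d) 0) => x z.
  by rewrite subrr normr0 mul0r.
have good x : good_at mu Q lam g (good_level Q CQ CP) x r.
  move=> i; have e0 : 0 < lam * dyadic_radius r i.
    by rewrite mulr_gt0// dyadic_radius_gt0.
  apply: (@le_trans _ _ (CQ * (d * (lam * dyadic_radius r i)) `^ Q)%:E).
    apply: (integral_powR_le_ball Q1 amu (x := x)) => //.
    - exact: measurable_metric_ball.
    - exact: ltW.
    - by move=> z; rewrite lee_fin ltW.
    - exact: measurable_cst.
  have v0 : 0 < chain_weight i :> R := chain_weight_gt0 i.
  have cq : CQ <= CQ `^ Q by rewrite -[leLHS]powRr1 ?(ltW CQ0)//; apply: ler_powR => //; exact: ltW.
  rewrite lee_fin; apply: (@le_trans _ _ ((CQ * (d * (lam * dyadic_radius r i))) `^ Q)).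
    rewrite [leRHS]powRM ?(ltW CQ0)//; last by rewrite mulr_ge0 ?ltW.
    by rewrite ler_wpM2r ?powR_ge0.
  apply: ge0_ler_powR; rewrite ?nnegrE ?(ltW Q0)//.
  - by rewrite mulr_ge0 ?(ltW CQ0)// mulr_ge0 ?(ltW d0)// ltW.
  - by rewrite mulr_ge0 ?(ltW lev0) ?(ltW v0).
  have v2 : 2 ^- i <= 4 * chain_weight i :> R := expr2V_le_chain_weight i.
  have c0 : 0 <= CQ * d * lam * r by apply: ltW; rewrite mulr_gt0// mulr_gt0// mulr_gt0.
  apply: (@le_trans _ _ (CQ * d * lam * r * (4 * chain_weight i))).
    by apply: le_trans (ler_wpM2l c0 v2); rewrite /dyadic_radius !mulrA.
  have -> : CQ * d * lam * r * (4 * chain_weight i) =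
      d * A * good_level Q CQ CP * chain_weight i.
    by rewrite /A; field; rewrite gt_eqF.
  by rewrite ler_pM2r// ler_piMl// ltW.
have Oy : mdist O y <= r / 2 by rewrite /r; lra.
have [||gamma [g0 g1 gl _]] := good_points_curve Q1 CQ1 CP0 lam1 mmu amu pmu
  _ lg d0 d1 _ r0 Oy (good O) (good y).
- by move=> z; rewrite lee_fin ltW.
- by [].
have [|||t _ <-] := @curve_norm_ivt _ _ O gamma 0 2^-1 q; last by exists (gamma t).
- by rewrite invr_ge0.
- move=> t /andP[t0 t2] e e0; exists (d * e); first by rewrite mulr_gt0.
  have H s s' : 0 <= s -> s <= s' -> s' <= 2^-1 -> `|s - s'| < d * e ->
      mdist (gamma s) (gamma s') < e.
    move=> s0 ss' s'2 h; rewrite -(ltr_pM2l d0); apply: le_lt_trans (gl s s' s0 ss' s'2) _.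
    by apply: le_lt_trans h; rewrite distrC ler_norm.
  move=> t' /andP[t'0 t'2] tt'; have [h|h] := leP t t'; first exact: H.
  by rewrite metric_sym; apply: H; rewrite 1?distrC// ltW.
by rewrite g0 g1 mdistxx q0.
Qed.

(** One factor CQ comes from the lower bound for the measure of an annulus of inner radius q, which
    contains a ball of radius q / 2, the other from passing from measure to content. *)
Definition annulus_density : R := 2^-1 `^ Q / CQ ^+ 2.

Lemma annulus_density_gt0 : 0 < annulus_density.
Proof. by rewrite divr_gt0 ?powR_gt0 ?exprn_gt0. Qed.

Lemma mu_outer_annulus_ge q : 0 < q ->
  (((q / 2) `^ Q / CQ)%:E <= mu (outer_annulus O q))%E.
Proof.
move=> q0; have [|x xq] := @exists_norm (3 / 2 * q); first by rewrite mulr_ge0// ltW.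
have q20 : 0 < q / 2 by rewrite divr_gt0.
have /andP[h _] := amu x q20; apply: le_trans h _; apply: le_outer_measure => z.
rewrite ballEmdist/= => xz; apply/outer_annulusP.
have := metric_triangle O x z; have := metric_triangle O z x.
by rewrite (metric_sym z x) xq => h1 h2; apply/andP; split; lra.
Qed.

Lemma hausdorff_content_annulus_ge alpha q : 0 < alpha <= Q -> 0 < q ->
  ((annulus_density * q `^ alpha)%:E <= hausdorff_content alpha (outer_annulus O q))%E.
Proof.
move=> aQ q0; have [h|h] := leP (q `^ alpha)%:E (hausdorff_content alpha (outer_annulus O q)).
  apply: le_trans h; rewrite lee_fin ler_piMl ?powR_ge0//.
  rewrite ler_pdivrMr ?exprn_gt0// mul1r; apply: (@le_trans _ _ 1).
    apply: (@le_trans _ _ (1 `^ Q)); last by rewrite powR1.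
    apply: ge0_ler_powR; rewrite ?nnegrE ?(ltW Q0)//.
    by rewrite invf_le1// ler1n.
  by rewrite exprn_ege1.
have := le_trans (mu_outer_annulus_ge q0) (mu_le_hausdorff_content CQ1 amu aQ q0 h).
have c0 : 0 < CQ * q `^ (Q - alpha) by rewrite mulr_gt0 ?powR_gt0.
rewrite -lee_pdivrMl//; apply: le_trans; rewrite -EFinM lee_fin.
have -> : (q / 2) `^ Q = 2^-1 `^ Q * (q `^ (Q - alpha) * q `^ alpha).
  rewrite -powRD ?subrK; last by apply/implyP => _; rewrite gt_eqF.
  by rewrite mulrC powRM ?invr_ge0 ?(ltW q0).
rewrite /annulus_density le_eqVlt; apply/orP; left; apply/eqP; field.
by rewrite !gt_eqF ?powR_gt0.
Qed.

(** The annulus has content of order q^alpha, of which E takes at most half once the terms of the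
    series are small; subadditivity leaves the rest to the complement. *)
Lemma thin_setC_thick E : thin Q O E -> thick Q O (~` E).
Proof.
move=> [C C1 thinE]; have C0 : 0 < C by exact: lt_le_trans C1.
have ad2 : 0 < annulus_density / 2 by rewrite divr_gt0 ?annulus_density_gt0.
have key alpha : 0 < alpha < Q -> exists k, forall j, (k <= j)%N ->
    ((annulus_density / 2 * (C * 2 ^+ j.+1) `^ alpha)%:E <=
      hausdorff_content alpha (~` E `&` outer_annulus O (C * 2 ^+ j.+1)))%E.
  move=> aQ.
  have [|k Hk] := eseries_term_small _ (thinE alpha aQ) ad2.
    by move=> j; rewrite mule_ge0 ?hausdorff_content_ge0// lee_fin invr_ge0 powR_ge0.
  exists k => j /Hk; set q := C * 2 ^+ j.+1.
  have q0 : 0 < q by rewrite mulr_gt0 ?exprn_gt0.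
  rewrite muleC lee_pdivrMl ?powR_gt0// -EFinM => hE.
  have aQ' : 0 < alpha <= Q by case/andP: aQ => -> /ltW ->.
  have := hausdorff_content_annulus_ge aQ' q0.
  have AE : outer_annulus O q `<=` (E `&` outer_annulus O q) `|` (~` E `&` outer_annulus O q).
    by move=> z Az; have [Ez|nEz] := pselect (E z); [left|right].
  move=> /le_trans /(_ (hausdorff_content_le alpha AE)).
  move=> /le_trans /(_ (hausdorff_contentU _ _ _)) H.
  rewrite leNgt; apply/negP => hnE.
  have hfin : hausdorff_content alpha (~` E `&` outer_annulus O q) \is a fin_num.
    by rewrite ge0_fin_numE ?hausdorff_content_ge0// (lt_trans hnE)// ltry.
  have := le_trans H (leeD2r _ hE); rewrite -(fineK hfin) -EFinD lee_fin.
  move: hnE; rewrite -{1}(fineK hfin) lte_fin => h1 h2.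
  by have := powR_gt0 alpha q0; move: h1 h2; set p := q `^ alpha; set b := annulus_density; lra.
split; last first.
  move=> alpha aQ; have [k Hk] := key alpha aQ; exists (annulus_density / 2), k, C; split => //.
  move=> j /Hk; apply: le_trans; rewrite lee_fin (ler_pM2l ad2).
  have /andP[a0 _] := aQ; apply: ge0_ler_powR; rewrite ?nnegrE ?(ltW a0) ?mulr_ge0 ?exprn_ge0 ?(ltW C0)//.
  by rewrite ler_peMl ?exprn_ge0.
(* A set of positive content is nonempty, so the complement of E has points in all far annuli. *)
move=> x r; have [|k Hk] := key 1; first by rewrite ltr01.
have [n hn] := exists_expr2_gt (mdist O x + r).
have := Hk (k + n)%N (leq_addr _ _); set q := C * _ => H.
have q0 : 0 < q by rewrite mulr_gt0 ?exprn_gt0.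
have [[y [nEy Ay]]|ne] := pselect (exists y, (~` E `&` outer_annulus O q) y); last first.
  move: H; rewrite (_ : _ `&` _ = set0); last first.
    by apply/seteqP; split => // z Hz; apply: ne; exists z.
  rewrite hausdorff_content0 leNgt lte_fin mulr_gt0//; exact: powR_gt0.
exists y => //; move/outer_annulusP : Ay => /andP[qy _]; rewrite ballEmdist/=.
apply/negP; rewrite -leNgt; have := metric_triangle O x y.
have : 2 ^+ n <= q.
  apply: (@le_trans _ _ (2 ^+ (k + n).+1)); last by rewrite ler_peMl ?exprn_ge0.
  by rewrite ler_eXn2l ?ltr1n//; apply: leqW; exact: leq_addl.
lra.
Qed.

End connected_space.

(** * Limits along curves and thick sets force the limit off the exceptional set *)

Section limits_off_exceptional_set.
Context {R : realType} {X : completeMetricType R}.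
Variables (O : X) (u : X -> R) (m : nat) (E : set X) (omega : nat -> R).
Hypothesis exc : exceptional_set O u m E omega.
Local Notation C := (2 ^+ m : R).
Local Notation An := (fun j : nat => outer_annulus O (2 ^+ m * 2 ^+ j.+1)).
Implicit Types (x y z : X) (c : \bar R).

Let C1 : 1 <= C. Proof. by rewrite exprn_ege1// ler1n. Qed.
Let C0 : 0 < C. Proof. by rewrite exprn_gt0. Qed.
Let omega0 := exceptional_cvg0 exc.
Let thinE := exceptional_thin exc.

Let oscE j x y : (An j `|` An j.+1) x -> (An j `|` An j.+1) y ->
  ~ E x -> ~ E y -> `|u x - u y| <= omega j.
Proof.
move=> Ax Ay nEx nEy; have [g [_ <- _ H]] := exceptional_join exc Ax Ay nEx nEy.
by have [|_] := H 2^-1; rewrite ?lexx ?invr_ge0 ?ler0n.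
Qed.

Let Cpow j : 0 < C * 2 ^+ j.
Proof. by rewrite mulr_gt0 ?exprn_gt0. Qed.

Let Cpow_ge j : 2 ^+ j <= C * 2 ^+ j.
Proof. by rewrite ler_peMl ?exprn_ge0. Qed.

Let Cpow_le i j : (i <= j)%N -> C * 2 ^+ i <= C * 2 ^+ j.
Proof. by move=> ij; rewrite ler_pM2l// ler_eXn2l ?ltr1n. Qed.

Lemma exceptional_content_small alpha e : 0 < alpha -> 0 < e ->
  exists k, forall j, (k <= j)%N ->
    (hausdorff_content alpha (E `&` An j) <= (e * (C * 2 ^+ j.+1) `^ alpha)%:E)%E.
Proof.
move=> al0 e0; have [|k Hk] := eseries_term_small _ (thinE al0) e0.
  by move=> j; rewrite mule_ge0 ?hausdorff_content_ge0// lee_fin invr_ge0 powR_ge0.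
by exists k => j /Hk; rewrite muleC lee_pdivrMl ?powR_gt0// -EFinM (mulrC _ e).
Qed.

Lemma exists_outer_annulus x : C * 2 <= mdist O x -> exists j, An j x.
Proof.
move=> Cx; have [|n Hn] := dyadic_floor _ Cx; first by rewrite mulr_gt0.
exists n; apply/outer_annulusP.
rewrite [X in X <= _ < _](_ : _ = C * 2 * 2 ^+ n); last by rewrite exprS mulrA.
rewrite [X in _ <= _ < X](_ : _ = C * 2 * 2 ^+ n.+1)//.
by rewrite !exprS; ring.
Qed.

(** The values of u at two points off E in neighbouring annuli differ by at most omega, so one point
    with value near c in each far pair of annuli is enough. *)
Lemma limit_off_exceptional_set c :
  (forall W : set (\bar R), nbhs c W -> exists i0, forall i, (i0 <= i)%N ->
     exists y, [/\ (An i `|` An i.+1) y, ~ E y & W (u y)%:E]) ->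
  limit_along_set O u c (~` E).
Proof.
move=> H V /nbhs_ereal_shrink [W [d [d0 cW WV]]].
have [i0 Hi0] := H W cW.
have [i1 _ Hi1] : \forall j \near \oo, `|omega j| <= d.
  by move/cvgr0Pnorm_le : omega0; exact.
exists (C * 2 ^+ (maxn i0 i1).+2) => x Mx nEx /=.
have [|n Anx] := @exists_outer_annulus x.
  apply: le_trans (ltW Mx); rewrite !exprS mulrA ler_peMr ?mulr_ge0 ?(ltW C0)//.
  by rewrite -exprS exprn_ege1// ler1n.
have /outer_annulusP/andP[_ xn] := Anx.
have : (maxn i0 i1 <= n)%N.
  rewrite leqNgt; apply/negP => ni; move: (lt_trans Mx xn).
  have -> : 2 * (C * 2 ^+ n.+1) = C * 2 ^+ n.+2 by rewrite (exprS 2 n.+1); ring.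
  rewrite ltNge => /negP; apply; apply: Cpow_le.
  by rewrite !ltnS ltnW.
rewrite geq_max => /andP[ni0 ni1].
have [y [Any nEy Wy]] := Hi0 n ni0.
apply: WV Wy _; apply: le_trans (Hi1 n ni1); apply: le_trans (ler_norm _).
by apply: oscE => //; left.
Qed.

Lemma limit_off_of_limit_some_curve c : limit_some_curve u c -> limit_along_set O u c (~` E).
Proof.
move=> [gamma ig lg]; apply: limit_off_exceptional_set => W cW.
have [T [_ HT]] := lg W cW.
(* The part of the curve crossing an annulus has 1-content at least half of the inner radius; a
   quarter for E leaves points of the curve off E. *)
have e0 : 0 < (4^-1 : R) by rewrite invr_gt0.
have [k Hk] := exceptional_content_small ltr01 e0.
(* The curve is 1-Lipschitz, so it reaches norms above B only after time T. *)
pose B := mdist O (gamma 0) + `|T| + 1.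
have [n hn] := exists_expr2_gt B.
exists (maxn k n) => i; rewrite geq_max => /andP[ki ni].
set q := C * 2 ^+ i.+1; have q0 : 0 < q by exact: Cpow.
have Bq : B < q.
  apply: lt_le_trans hn _; apply: le_trans (Cpow_ge _).
  by rewrite ler_eXn2l ?ltr1n// leqW.
pose G := [set y | An i y /\ exists2 t, T < t & gamma t = y].
have hG : ((q / 2)%:E <= hausdorff_content 1 G)%E.
  have -> : q / 2 = (2 * q - q) / 2 by lra.
  apply: (@hausdorff_content1_ge _ _ (mdist O)) => [x y|v /andP[qv vq]].
    by have := mdist_lipschitz O x y; rewrite mul1r.
  have [|t t0 tv] := @infinite_curve_norm _ _ O gamma v ig.
    apply: le_trans (ltW qv); apply: le_trans (ltW Bq).
    by rewrite /B -addrA lerDl addr_ge0.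
  exists (gamma t) => //; split; first by apply/outer_annulusP; rewrite tv (ltW qv) vq.
  exists t => //; rewrite ltNge; apply/negP => tT.
  have h1 := infinite_curve_mdist ig (lexx _) t0; rewrite subr0 in h1.
  have h2 := metric_triangle O (gamma 0) (gamma t).
  have h3 := ler_norm T; move: Bq; rewrite /B => Bq.
  by move: qv; rewrite -tv; lra.
have [y [[Ay [t Tt ty]] nEy]] : exists y, G y /\ ~ E y.
  apply: contrapT => nG; have GE : G `<=` E `&` An i.
    move=> y Gy; split; last by case: Gy.
    by apply: contrapT => nEy; apply: nG; exists y.
  have := le_trans hG (hausdorff_content_le 1 GE).
  move=> /le_trans /(_ (Hk i ki)); rewrite lee_fin powRr1 -/q ?(ltW q0)//.
  by move: q0; lra.
by exists y; split => //; [left|rewrite -ty; exact: HT].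
Qed.

Lemma limit_off_of_limit_on_thick_set (Q : R) c : 1 < Q ->
  limit_on_thick_set O u c Q -> limit_along_set O u c (~` E).
Proof.
move=> Q1 [F [_ tF] lF]; apply: limit_off_exceptional_set => W cW.
have [M HM] := lF W cW.
have [|d [k0 [C' [d0 C'1 HF]]]] := tF 1; first by rewrite ltr01.
have C'0 : 0 < C' by exact: lt_le_trans C'1.
(* E has content at most e b + 2 e b in two neighbouring annuli of inner radii b and 2 b. Below, b <
   C' 2^(j+1), so this is less than three quarters of the content d 2^(j+1) guaranteed for F. *)
pose e := d / (4 * C'); have e0 : 0 < e by rewrite divr_gt0// mulr_gt0.
have [k Hk] := exceptional_content_small ltr01 e0.
have [n hn] := exists_expr2_gt (`|M| + C' * 2 ^+ k0.+1).
exists (maxn k n) => i; rewrite geq_max => /andP[ki ni].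
set b := C * 2 ^+ i.+1; have b0 : 0 < b by exact: Cpow.
have bM : `|M| + C' * 2 ^+ k0.+1 < b.
  apply: lt_le_trans hn _; apply: le_trans (Cpow_ge _).
  by rewrite ler_eXn2l ?ltr1n// leqW.
have C'b : C' <= b.
  apply: le_trans (ltW bM); apply: ler_wpDl => //.
  by rewrite ler_peMr ?(ltW C'0)// exprn_ege1// ler1n.
(* The annuli of F have another factor C'; the one of inner radius between b and 2 b lies in the
   union of two neighbouring annuli. *)
have [j /andP[jb bj]] := dyadic_floor C'0 C'b.
set q := C' * 2 ^+ j.+1 in bj.
have qE : q = 2 * (C' * 2 ^+ j) by rewrite /q exprS; ring.
have k0j : (k0 <= j)%N.
  rewrite leqNgt; apply/negP => jk0; move: bj; rewrite ltNge => /negP; apply.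
  apply: (@le_trans _ _ (C' * 2 ^+ k0.+1)); last by apply: le_trans (ltW bM); rewrite lerDr.
  by rewrite ler_pM2l// ler_eXn2l ?ltr1n// ltnW.
have b2 : C * 2 ^+ i.+2 = 2 * b by rewrite /b exprS; ring.
have qA : outer_annulus O q `<=` An i `|` An i.+1.
  move=> y /outer_annulusP/andP[qy yq].
  have [yb|by_] := ltP (mdist O y) (2 * b).
    by left; apply/outer_annulusP; rewrite yb (le_trans (ltW bj)).
  right; apply/outer_annulusP; rewrite b2 by_/=.
  by move: jb yq; rewrite qE; lra.
have [y [[Fy Ay] nEy]] : exists y, (F `&` outer_annulus O q) y /\ ~ E y.
  apply: contrapT => nG.
  have GE : F `&` outer_annulus O q `<=` (E `&` An i) `|` (E `&` An i.+1).
    move=> y Gy; have Ey : E y by apply: contrapT => nEy; apply: nG; exists y.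
    by case: (qA y Gy.2); [left|right].
  have := le_trans (HF j k0j) (hausdorff_content_le 1 GE).
  move=> /le_trans /(_ (hausdorff_contentU _ _ _)).
  move=> /le_trans /(_ (leeD (Hk i ki) (Hk i.+1 (leqW ki)))).
  rewrite -EFinD lee_fin (powRr1 (ltW (Cpow i.+1))) (powRr1 (ltW (Cpow i.+2))).
  rewrite (powRr1 (exprn_ge0 j.+1 (ler0n R 2))).
  rewrite -/b b2; have h : e * b < d / 4 * 2 ^+ j.+1.
    have -> : d / 4 * 2 ^+ j.+1 = e * q by rewrite /e /q; field; rewrite gt_eqF.
    by rewrite ltr_pM2l.
  have : 0 < d * 2 ^+ j.+1 by rewrite mulr_gt0 ?exprn_gt0.
  by rewrite (mulrCA e 2 b); move: h; move: (e * b) => x2; lra.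
exists y; split => //; first exact: qA.
apply: HM => //; apply: le_lt_trans (ler_norm M) _.
have /outer_annulusP/andP[qy _] := Ay; apply: lt_le_trans qy.
apply: lt_trans bj; apply: le_lt_trans bM; rewrite lerDl.
by rewrite mulr_ge0 ?exprn_ge0 ?(ltW C'0).
Qed.

Lemma limit_off_exceptional_set_unique c1 c2 : unbounded_set (~` E) ->
  limit_along_set O u c1 (~` E) -> limit_along_set O u c2 (~` E) -> c1 = c2.
Proof.
move=> uE; have PF : ProperFilter (within (~` E) (at_infinity O)).
  split; last exact: within_filter.
  move=> [M HM]; have [y nEy] := uE O (M + 1); rewrite ballEmdist/= => /negP.
  rewrite -leNgt => My; apply: (HM y _ nEy); apply: lt_le_trans My.
  by rewrite ltrDl.
exact: (@cvg_unique _ _ _ _).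
Qed.

End limits_off_exceptional_set.

(** * Arc length parametrization of infinite curves *)

Section infinite_arclength_parametrization.
Context {R : realType} {X : completeMetricType R}.
Implicit Types (gamma : R -> X) (a b s t : R).

(** As gamma is unbounded, every s >= 0 is the length of an initial piece; g s is the value of gamma
    at the end of any such piece. *)
Lemma infinite_arclength_param gamma :
  (forall T, 0 <= T -> rectifiable_curve gamma 0 T) ->
  unbounded_set (gamma @` `[0%R, +oo[) ->
  exists g : R -> X, [/\ infinite_curve g,
    forall t, 0 <= t -> g (fine (curve_length gamma 0 t)) = gamma t &
    forall s, 0 <= s -> exists t, [/\ 0 <= t, curve_length gamma 0 t = s%:E & g s = gamma t]].
Proof.
move=> rg ug; pose l t := fine (curve_length gamma 0 t).
have lE t : 0 <= t -> curve_length gamma 0 t = (l t)%:E.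
  move=> t0; rewrite fineK//; have [_ _ fin] := rg t t0.
  by apply: curve_length_fin fin.
have l_le t t' : 0 <= t -> t <= t' -> l t <= l t'.
  move=> t0 tt'; rewrite -lee_fin -!lE ?(le_trans t0)//.
  exact: curve_length_le.
have l0 : l 0 = 0 by rewrite /l curve_lengthxx.
pose P s := [set t | 0 <= t /\ curve_length gamma 0 t = s%:E].
have exP s : 0 <= s -> exists t, P s t.
  move=> s0; have [_ [T /= T0 <-]] := ug (gamma 0) s.
  rewrite in_itv/= andbT in T0; rewrite ballEmdist/= => /negP; rewrite -leNgt => sT.
  have [||t /andP[t0 _] ts] := @curve_length_ivt _ _ gamma 0 T s (rg T T0); last by exists t.
    by [].
  by apply: le_trans (curve_length_ge_mdist _ T0); rewrite lee_fin.
pose g s := gamma (xget 0 (P s)).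
have gP s : 0 <= s -> exists t, [/\ 0 <= t, curve_length gamma 0 t = s%:E & g s = gamma t].
  move=> s0; have [t Pt] := exP s s0; have [h1 h2] := @xgetPex _ 0 (P s) (ex_intro _ t Pt).
  by exists (xget 0 (P s)).
have gl t : 0 <= t -> g (l t) = gamma t.
  move=> t0; have lt0 : 0 <= l t by rewrite -l0; exact: l_le.
  have [t' [t'0 ht' ->]] := gP _ lt0; apply: mdist_positivity.
  apply/eqP; rewrite eq_le mdist_ge0 andbT -(subrr (l t)).
  by apply: (@curve_length_eq_mdist _ _ gamma 0) => //; exact: lE.
have glip s s' : 0 <= s -> s <= s' -> mdist (g s) (g s') <= s' - s.
  move=> s0 ss'; have [t [t0 ht ->]] := gP s s0.
  have [t' [t'0 ht' ->]] := gP s' (le_trans s0 ss').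
  exact: (@curve_length_eq_mdist _ _ gamma 0).
exists g; split => //; split.
- apply/subspace_continuousP => s /=; rewrite in_itv/= andbT => s0.
  move=> V /nbhs_ballP[e /= e0 eV]; rewrite /within/=; exists e => //= s'.
  move=> ss'; rewrite in_itv/= andbT => s'0; apply: eV; rewrite ballEmdist/=.
  have [h|h] := leP s s'.
    by apply: le_lt_trans (glip _ _ s0 h) _; apply: le_lt_trans ss'; rewrite distrC ler_norm.
  rewrite metric_sym; apply: le_lt_trans (glip _ _ s'0 (ltW h)) _.
  by apply: le_lt_trans ss'; rewrite ler_norm.
- move=> s s0; apply/eqP; rewrite eq_le; apply/andP; split.
    rewrite [leRHS](_ : _ = ((s - 0) / 1)%:E); last by rewrite subr0 divr1.
    by apply: curve_length_le_weighted => // t t' t0 tt' _; rewrite mul1r; exact: glip.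
  have [T [T0 hT _]] := gP s s0; rewrite -hT; apply: curve_length_ub => q pq lq.
  (* Partitions for gamma are carried by l to partitions for g with the same polygon; they are only
     weakly increasing, since l may be constant on intervals. *)
  have poly (q' : seq R) a : 0 <= a -> path <%R a q' ->
      polygon_length gamma a q' = polygon_length g (l a) (map l q') /\
      path <=%R (l a) (map l q').
    elim: q' a => // x q' IH a a0 /= /andP[ax xq].
    have x0 : 0 <= x by apply: le_trans a0 (ltW ax).
    by have [-> ->] := IH x x0 xq; rewrite !gl// l_le ?(ltW ax).
  have [-> pl] := poly q 0 (lexx 0) pq; rewrite -[0 in leRHS]l0.
  by apply: polygon_length_le => //; rewrite last_map lq /l hT.
move=> x r; have [_ [T /= T0 <-] nb] := ug x r; exists (gamma T) => //.
rewrite in_itv/= andbT in T0; exists (l T); last exact: gl.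
by rewrite /= in_itv/= andbT -l0; exact: l_le.
Qed.

End infinite_arclength_parametrization.

(** * Concatenation of curves *)

Section concatenation.
Context {R : realType} {X : completeMetricType R}.
Variables (sigma : nat -> R -> X) (L : nat -> R).
Hypothesis L0 : forall k, 0 < L k.
Hypothesis sigma_join : forall k, sigma k 1 = sigma k.+1 0.
Hypothesis sigma_lip : forall k (t t' : R), 0 <= t -> t <= t' -> t' <= 1 ->
  mdist (sigma k t) (sigma k t') <= L k * (t' - t).
Implicit Types (t : R) (k n : nat).

Definition concat t : X := sigma (Num.truncn t) (t - (Num.truncn t)%:R).

Lemma concatE k t : k%:R <= t <= k.+1%:R -> concat t = sigma k (t - k%:R).
Proof.
move=> /andP[kt]; rewrite le_eqVlt => /predU1P[->|tk].
  by rewrite /concat natrK subrr -natr1 addrC addKr sigma_join.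
by rewrite /concat (@truncn_def _ t k)// kt.
Qed.

Lemma concat_lip n t t' : 0 <= t -> t <= t' -> t' <= n%:R ->
  mdist (concat t) (concat t') <= (\sum_(i < n) L i) * (t' - t).
Proof.
elim: n t t' => [|n ih] t t' t0 tt' t'n.
  by rewrite (le_anti (_ : t <= t' <= t)) ?mdistxx ?subrr ?mulr0// tt' (le_trans t'n).
have S0 : 0 <= \sum_(i < n) L i by apply: sumr_ge0 => i _; exact: ltW.
have key s s' : n%:R <= s -> s <= s' -> s' <= n.+1%:R ->
    mdist (concat s) (concat s') <= L n * (s' - s).
  move=> ns ss' s'n; rewrite !(@concatE n) ?ns ?s'n ?andbT ?(le_trans ns) ?(le_trans ss')//.
  apply: le_trans (@sigma_lip n _ _ _ _ _) _.
  - by rewrite subr_ge0.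
  - by rewrite lerD2r.
  - by rewrite lerBlDr addrC natr1.
  by rewrite opprB addrA subrK.
rewrite big_ord_recr/= mulrDl; have d0 : 0 <= t' - t by rewrite subr_ge0.
have [t'n'|nt'] := leP t' n%:R.
  by apply: le_trans (ih _ _ t0 tt' t'n') _; rewrite lerDl mulr_ge0// ltW.
have [tn|nt] := leP t n%:R; last first.
  by apply: le_trans (key _ _ (ltW nt) tt' t'n) _; rewrite lerDr mulr_ge0.
apply: le_trans (metric_triangle _ (concat n%:R) _) _; apply: lerD.
  by apply: le_trans (ih _ _ t0 tn (lexx _)) _; rewrite ler_wpM2l// lerB// ltW.
by apply: le_trans (key _ _ (lexx _) (ltW nt') t'n) _; rewrite ler_wpM2l ?(ltW (L0 n))// lerB.
Qed.

Lemma concat_rectifiable t : 0 <= t -> rectifiable_curve concat 0 t.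
Proof.
move=> t0; pose n := (Num.truncn t).+1; pose S := 1 + \sum_(i < n) L i.
have S0 : 0 < S by rewrite ltr_wpDr// sumr_ge0// => i _; exact: ltW.
apply: (@rectifiable_lipschitz _ _ _ _ _ S^-1) => //; first by rewrite invr_gt0.
move=> s s' s0 ss' s't; rewrite mulrC ler_pdivrMr// mulrC.
apply: le_trans (@concat_lip n _ _ s0 ss' _) _.
  by apply: le_trans s't (ltW (truncnS_gt t)).
by rewrite ler_wpM2r ?subr_ge0// lerDr.
Qed.

Lemma concat_length n : (curve_length concat 0 n%:R <= (\sum_(i < n) L i)%:E)%E.
Proof.
elim: n => [|n ih]; first by rewrite curve_lengthxx big_ord0.
rewrite (@curve_lengthD _ _ _ 0 n%:R)// ?ler_nat// big_ord_recr/= EFinD.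
apply: leeD => //.
have -> : L n = (n.+1%:R - n%:R) / (L n)^-1 by rewrite invrK -natr1 addrAC subrr add0r mul1r.
apply: curve_length_le_weighted; rewrite ?invr_gt0 ?ler_nat// => t t' nt tt' t'n.
rewrite mulrC ler_pdivrMr// mulrC.
rewrite !(@concatE n) ?nt ?t'n ?andbT ?(le_trans nt) ?(le_trans tt')//.
apply: le_trans (@sigma_lip n _ _ _ _ _) _.
- by rewrite subr_ge0.
- by rewrite lerD2r.
- by rewrite lerBlDr addrC natr1.
by rewrite opprB addrA subrK.
Qed.

End concatenation.

(** s2 is the first time with f >= b, and s1 the last time before it with f <= a; a 1-Lipschitz
    function needs time b - a between them. *)
Lemma lipschitz_crossing {R : realType} (f : R -> R) (a b : R) : a < b ->
  (forall s s', 0 <= s -> s <= s' -> `|f s' - f s| <= s' - s) ->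
  f 0 <= a -> (exists2 s, 0 <= s & b <= f s) ->
  exists s1 s2, [/\ 0 <= s1, b - a <= s2 - s1 & forall s, s1 < s < s2 -> a < f s < b].
Proof.
move=> ab lf f0 [s00 s000 bs00].
have lf' s s' : 0 <= s -> 0 <= s' -> f s' - f s <= `|s' - s|.
  move=> s0 s'0; apply: le_trans (ler_norm _) _.
  have [h|h] := leP s s'; first by rewrite [leRHS]ger0_norm ?subr_ge0//; exact: lf.
  rewrite distrC [leRHS]distrC [leRHS]ger0_norm ?subr_ge0 ?(ltW h)//.
  by apply: lf => //; exact: ltW.
pose S := [set s | 0 <= s /\ b <= f s].
have hS : has_inf S by split; [exists s00|exists 0 => s []].
pose s2 := inf S.
have s20 : 0 <= s2 by apply: lb_le_inf; [exists s00|move=> s []].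
have fs2 : b <= f s2.
  apply/ler_addgt0Pr => e e0; have [s [s0 bs] ss2] := inf_adherent e0 hS.
  have h : s2 <= s by apply: ge_inf => //; case: hS.
  have := lf' s2 s s20 s0; rewrite ger0_norm ?subr_ge0//.
  by move: ss2; rewrite -/s2; lra.
have lts2 s : 0 <= s -> s < s2 -> f s < b.
  move=> s0 ss2; rewrite ltNge; apply/negP => bs; move: ss2.
  by rewrite ltNge => /negP; apply; apply: ge_inf => //; case: hS.
pose S' := [set s | 0 <= s <= s2 /\ f s <= a].
have hS' : has_sup S'.
  by split; [exists 0; split; rewrite ?lexx|exists s2 => s [/andP[_ ->]]].
pose s1 := sup S'.
have s10 : 0 <= s1 by apply: ub_le_sup; [case: hS'|split; rewrite ?lexx].
have s12 : s1 <= s2 by apply: ge_sup; [case: hS'|move=> s [/andP[]]].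
have fs1 : f s1 <= a.
  apply/ler_addgt0Pr => e e0; have [s Ss ss1] := sup_adherent e0 hS'.
  have h : s <= s1 by apply: ub_le_sup => //; case: hS'.
  have [/andP[s0 _] sa] := Ss.
  have := lf' s s1 s0 s10; rewrite ger0_norm ?subr_ge0//.
  by move: ss1; rewrite -/s1; lra.
exists s1, s2; split => //.
  have := lf' s1 s2 s10 s20; rewrite ger0_norm ?subr_ge0//; lra.
move=> s /andP[s1s ss2]; have s0 : 0 <= s by apply: le_trans s10 (ltW s1s).
rewrite (lts2 s s0 ss2) andbT ltNge; apply/negP => fsa; move: s1s.
rewrite ltNge => /negP; apply; apply: ub_le_sup; first by case: hS'.
by split => //; rewrite s0 ltW.
Qed.

(** * Length of a curve in balls and annuli *)

Section length_in_balls.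
Context {R : realType} {X : completeMetricType R}.
Implicit Types (O : X) (gamma : R -> X) (r s : R).

Lemma measurable_length_in_ball O gamma r : infinite_curve gamma ->
  measurable (`[0%R, +oo[ `&` gamma @^-1` (ball O r)).
Proof.
move=> ig; pose f s := mdist O (gamma (Num.max s 0)).
have lf s s' : `|f s - f s'| <= `|s - s'|.
  have h1 : `|f s - f s'| <= mdist (gamma (Num.max s 0)) (gamma (Num.max s' 0)).
    by have := mdist_lipschitz O (gamma (Num.max s 0)) (gamma (Num.max s' 0)); rewrite mul1r.
  apply: le_trans h1 _.
  wlog ss' : s s' / s <= s'.
    by move=> H; have [|/ltW] := leP s s'; [exact: H|rewrite metric_sym distrC; exact: H].
  have m0 : 0 <= Num.max s 0 by rewrite le_max lexx orbT.
  have mm : Num.max s 0 <= Num.max s' 0 by rewrite ge_max !le_max ss' lexx orbT.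
  apply: le_trans (infinite_curve_mdist ig m0 mm) _.
  rewrite distrC ger0_norm ?subr_ge0//.
  by rewrite /Num.max; do 2 case: ifP; move=> *; lra.
have cf : continuous f.
  move=> s; apply/cvgrPdist_lt => e e0; exists e => //= s' ss'.
  exact: le_lt_trans (lf _ _) ss'.
rewrite (_ : _ `&` _ = `[0%R, +oo[ `&` f @^-1` `]-oo, r[); last first.
  have fE s : s \in `[0%R, +oo[ -> f s = mdist O (gamma s).
    by rewrite in_itv/= andbT => s0; rewrite /f max_l.
  apply/seteqP; split => s [s0 h]; split => //; move: h.
    by rewrite /preimage/= in_itv/= fE// ballEmdist.
  by rewrite /preimage/= in_itv/= fE// ballEmdist.
apply: measurableI => //; rewrite -[X in measurable X]setTI.
by apply: continuous_measurable_fun => //; exact: measurable_itv.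
Qed.

Lemma measurable_length_in_annulus O gamma r : infinite_curve gamma ->
  measurable (`[0%R, +oo[ `&` gamma @^-1` (inner_annulus O r)).
Proof.
move=> ig; rewrite (_ : _ `&` _ =
    (`[0%R, +oo[ `&` gamma @^-1` (ball O r)) `\`
    (`[0%R, +oo[ `&` gamma @^-1` (ball O (r / 2)))).
  by apply: measurableD; exact: measurable_length_in_ball.
apply/seteqP; split => s /=; first by move=> [s0 [h1 h2]]; split => // -[].
by move=> [[s0 h1] h2]; split => //; split => // h3; apply: h2.
Qed.

Lemma length_in_annulus_le O gamma r : infinite_curve gamma -> 
  (length_in gamma (inner_annulus O r) <= length_in gamma (ball O r))%E.
Proof.
move=> ig; apply: le_measure; rewrite ?inE.
- exact: measurable_length_in_annulus.
- exact: measurable_length_in_ball.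
by move=> s [s0 [h _]].
Qed.

Lemma length_in_ball_le O gamma r M : infinite_curve gamma -> 0 <= M ->
  (forall s, 0 <= s -> mdist O (gamma s) < r -> s <= M) ->
  (length_in gamma (ball O r) <= M%:E)%E.
Proof.
move=> ig M0 H; apply: (@le_trans _ _ (lebesgue_measure `[0%R, M]%classic)).
  apply: le_measure; rewrite ?inE//; first exact: measurable_length_in_ball.
  move=> s /= []; rewrite !in_itv/= andbT ballEmdist/= => s0 sr.
  by rewrite s0 H.
rewrite lebesgue_measure_itv/= lte_fin; case: ifP => _; last by rewrite lee_fin.
by rewrite -EFinB subr0.
Qed.

Lemma length_in_annulus_ge O gamma r : infinite_curve gamma -> 0 < r ->
  mdist O (gamma 0) <= r / 2 -> ((r / 2)%:E <= length_in gamma (inner_annulus O r))%E.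
Proof.
move=> ig r0 g0; have [||||s1 [s2 [s10 s12 Hs]]] :=
    @lipschitz_crossing R (fun s => mdist O (gamma s)) (r / 2) r.
- lra.
- move=> s s' s0 ss'; apply: le_trans (infinite_curve_mdist ig s0 ss').
  by rewrite (metric_sym (gamma s)) -[leRHS]mul1r; exact: mdist_lipschitz.
- exact: g0.
- have [|s s0 hs] := @infinite_curve_norm _ _ O gamma r ig; first by lra.
  by exists s; rewrite ?hs.
apply: (@le_trans _ _ (lebesgue_measure `]s1, s2[%classic)).
  rewrite lebesgue_measure_itv/= lte_fin ifT; last by lra.
  by rewrite -EFinB lee_fin; lra.
apply: le_measure; rewrite ?inE//; first exact: measurable_length_in_annulus.
move=> s /=; rewrite !in_itv/= andbT => ss; have /andP[h1 h2] := Hs s ss.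
case/andP: ss => s1s _; split; first exact: le_trans s10 (ltW s1s).
rewrite /inner_annulus !ballEmdist/=; split => //.
by apply/negP; rewrite -leNgt ltW.
Qed.

End length_in_balls.

(** * Infinite curves through given good points *)

Section curve_through_points.
Context {R : realType} {X : completeMetricType R}.
Variables (O : X) (u : X -> R) (m : nat) (E : set X) (omega : nat -> R).
Hypothesis m0 : (0 < m)%N.
Hypothesis exc : exceptional_set O u m E omega.
Local Notation An := (fun j : nat => outer_annulus O (2 ^+ m * 2 ^+ j.+1)).

Let omega0 := exceptional_cvg0 exc.
Let connE := exceptional_join exc.

(** A joining curve of scale j has speed at most m 2^m 2^(j+3) / 2 on an interval of length 1 / 2,
    hence length at most this constant times 2^(j+1). *)
Definition exit_const : R := 2 ^+ m * m%:R.

Lemma sum_dyadic_le j k : \sum_(i < k.+1) (2 : R) ^+ (j + i) <= 2 ^+ (j + k).+1.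
Proof.
suff -> : \sum_(i < k.+1) (2 : R) ^+ (j + i) = 2 ^+ (j + k).+1 - 2 ^+ j.
  by rewrite gerBl exprn_ge0.
elim: k => [|k ih]; first by rewrite big_ord1 addn0 exprS mulrDl mul1r addrK.
by rewrite big_ord_recr/= ih addnS !exprS; ring.
Qed.

(** The piece at scale j stays outside radius 2^(j+3), while the pieces up to it have total length
    at most [exit_const * 2 ^+ j.+2] by a geometric sum; so arc length is bounded by a multiple of
    the current norm. On that piece u stays within omega j of its value at a point off E, which
    gives the limit. *)
Lemma curve_through j0 (p : nat -> X) (c : \bar R) :
  (forall k, An (j0 + k)%N (p k)) -> (forall k, ~ E (p k)) ->
  limit_along_set O u c (~` E) ->
  exists gamma : R -> X, [/\ infinite_curve gamma, gamma 0 = p 0%N,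
    forall k, exists2 s, 0 <= s & gamma s = p k,
    limit_along_curve u c gamma &
    forall s r, 0 <= s -> mdist O (gamma s) < r -> s <= exit_const / 2 * r].
Proof.
move=> Ap nEp lc.
have /choice [sig0 Hsig0] : forall k, exists gamma : R -> X, [/\ gamma 0 = p k, gamma 2^-1 = p k.+1,
    forall t t' : R, 0 <= t -> t <= t' -> t' <= 2^-1 ->
      2 / m%:R / (2 ^+ m * 2 ^+ (j0 + k).+3) * mdist (gamma t) (gamma t') <= t' - t &
    forall t : R, 0 <= t <= 2^-1 -> 2 ^+ (j0 + k).+3 < mdist O (gamma t) /\
      `|u (p k) - u (gamma t)| <= omega (j0 + k)%N].
  move=> k; have [||||g [h1 h2 h3 h5]] := @connE (j0 + k)%N (p k) (p k.+1) => //.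
  - by left.
  - by right; rewrite -addnS.
  by exists g.
have mR : 0 < m%:R :> R by rewrite ltr0n.
pose sigma k (t : R) := sig0 k (t / 2).
pose L k : R := exit_const * 2 ^+ (j0 + k).+1.
have ec0 : 0 < exit_const by rewrite mulr_gt0 ?exprn_gt0.
have L0 k : 0 < L k by rewrite mulr_gt0 ?exprn_gt0.
have sj k : sigma k 1 = sigma k.+1 0.
  rewrite /sigma div1r mul0r; case: (Hsig0 k) => _ -> _ _.
  by case: (Hsig0 k.+1) => ->.
have sl k (t t' : R) : 0 <= t -> t <= t' -> t' <= 1 ->
    mdist (sigma k t) (sigma k t') <= L k * (t' - t).
  move=> t0 tt' t'1; case: (Hsig0 k) => _ _ + _ => /(_ (t / 2) (t' / 2)) H.
  have t20 : 0 <= t / 2 by rewrite divr_ge0.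
  have tt2 : t / 2 <= t' / 2 by rewrite ler_pM2r// invr_gt0.
  have t'2 : t' / 2 <= 2^-1 by rewrite -[leRHS]mul1r ler_pM2r// invr_gt0.
  have {H} := H t20 tt2 t'2; rewrite -mulrBl -ler_pdivlMl; last first.
    by apply: divr_gt0; [exact: divr_gt0|rewrite mulr_gt0 ?exprn_gt0].
  move=> /le_trans; apply; rewrite le_eqVlt; apply/orP; left; apply/eqP.
  by rewrite /L /exit_const (exprS 2 (j0 + k).+2) (exprS 2 (j0 + k).+1); field;
    rewrite !gt_eqF ?exprn_gt0.
have Gk t k : k%:R <= t <= k.+1%:R -> concat sigma t = sig0 k ((t - k%:R) / 2).
  exact: (concatE sj).
have Gp k : concat sigma k%:R = p k.
  rewrite (Gk _ k) ?lexx ?ler_nat//= subrr mul0r.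
  by case: (Hsig0 k).
have tk (t : R) : 0 <= t -> exists k, k%:R <= t < k.+1%:R.
  by move=> t0; exists (Num.truncn t); exact: truncn_itv.
have in2 (t : R) k : k%:R <= t < k.+1%:R -> 0 <= (t - k%:R) / 2 <= 2^-1.
  move=> /andP[kt tk1]; rewrite divr_ge0 ?subr_ge0//=.
  rewrite -[leRHS]mul1r ler_pM2r ?invr_gt0// lerBlDr addrC natr1; exact: ltW.
have Apk k : 2 ^+ k <= mdist O (p k).
  have /outer_annulusP/andP[h _] := Ap k; apply: le_trans h.
  rewrite -exprD ler_eXn2l ?ltr1n//; apply: leq_trans (leq_addl _ _).
  by apply: leqW; exact: leq_addl.
have ub : unbounded_set (concat sigma @` `[0%R, +oo[).
  move=> x r; have [k hk] := exists_expr2_gt (mdist O x + r).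
  exists (p k); first by exists k%:R; rewrite ?Gp//= in_itv/= andbT.
  rewrite ballEmdist/=; apply/negP; rewrite -leNgt.
  have := Apk k; have := metric_triangle O x (p k); lra.
have rg t := concat_rectifiable L0 sj sl (t := t).
have [g [ig gG gE]] := infinite_arclength_param rg ub.
have len_le t k : 0 <= t -> t <= k.+1%:R ->
    (curve_length (concat sigma) 0 t <= (exit_const * 2 ^+ (j0 + k).+2)%:E)%E.
  move=> t0 tk1; apply: le_trans (curve_length_le _ (lexx 0) t0 tk1) _.
  apply: le_trans (concat_length L0 sj sl k.+1) _; rewrite lee_fin /L -mulr_sumr ler_pM2l//.
  under eq_bigr => i _ do rewrite -addSn.
  by apply: le_trans (sum_dyadic_le _ _) _; rewrite addSn.
exists g; split => //.
- have := gG 0 (lexx 0); rewrite curve_lengthxx/= => ->.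
  exact: (Gp 0%N).
- move=> k; exists (fine (curve_length (concat sigma) 0 k%:R)).
    by rewrite fine_ge0// curve_length_ge0.
  by rewrite gG.
- move=> V /nbhs_ereal_shrink [W [d [d0 cW WV]]].
  have [M HM] := lc W cW.
  have [j1 _ Hj1] : \forall j \near \oo, `|omega j| <= d.
    by move/cvgr0Pnorm_le : omega0; exact.
  have [n hn] := exists_expr2_gt M.
  pose k1 := maxn n j1.
  exists (fine (curve_length (concat sigma) 0 k1%:R)); split; first exact: num_real.
  move=> s k1s; have s0 : 0 <= s.
    by apply: le_trans (ltW k1s); rewrite fine_ge0// curve_length_ge0.
  change (V (u (g s))%:E); have [t [t0 ht ->]] := gE s s0.
  have k1t : k1%:R <= t.
    rewrite leNgt; apply/negP => tk1; move: k1s; rewrite ltNge => /negP; apply.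
    have [_ _ fin] := rg k1%:R (ler0n _ _).
    rewrite -lee_fin -ht fineK; first by apply: curve_length_le => //; exact: ltW.
    by apply: curve_length_fin fin.
  have [k kt] := tk t t0; have /andP[kt1 kt2] := kt.
  have k1k : (k1 <= k)%N.
    by rewrite -ltnS -(ltr_nat R); exact: le_lt_trans k1t kt2.
  move: k1k; rewrite geq_max => /andP[nk j1k].
  rewrite (Gk t k) ?kt1 ?(ltW kt2)//.
  have [_ _ _ /(_ _ (in2 t k kt)) [_ hu]] := Hsig0 k.
  apply: (WV (u (p k))).
    apply: HM; last exact: nEp.
    apply: lt_le_trans hn _; apply: le_trans (Apk k).
    by rewrite ler_eXn2l ?ltr1n.
  apply: le_trans hu _; apply: le_trans (ler_norm _) _; apply: Hj1.
  by apply: leq_trans j1k _; exact: leq_addl.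
move=> s r s0; have [t [t0 ht ->]] := gE s s0.
have [k kt] := tk t t0; have /andP[kt1 kt2] := kt.
rewrite (Gk t k) ?kt1 ?(ltW kt2)// => hr.
have [_ _ _ /(_ _ (in2 t k kt)) [hf _]] := Hsig0 k.
have := len_le t k t0 (ltW kt2); rewrite ht lee_fin => /le_trans; apply.
have := lt_trans hf hr; rewrite (exprS 2 (j0 + k).+2) => h.
rewrite [leRHS](_ : _ = exit_const * (r / 2)); last by ring.
by rewrite ler_pM2l//; move: h; set a := 2 ^+ _; lra.
Qed.

End curve_through_points.

(** * The family of curves and its constants *)

Section curve_family.
Context {R : realType} {X : completeMetricType R}.
Variable mu : {outer_measure set X -> \bar R}.
Variables (Q CQ CP lam : R).
Hypothesis Q1 : 1 < Q.
Hypothesis CQ1 : 1 <= CQ.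
Hypothesis CP0 : 0 < CP.
Hypothesis lam1 : 1 <= lam.
Hypothesis mmu : metric_measure_space mu.
Hypothesis amu : ahlfors_regular mu Q CQ.
Hypothesis pmu : poincare mu Q CP lam.
Hypothesis unb : unbounded_set [set: X].
Variables (O : X) (u : X -> R) (m : nat) (E : set X) (omega : nat -> R).
Hypothesis m0 : (0 < m)%N.
Hypothesis exc : exceptional_set O u m E omega.
Local Notation An := (fun j : nat => outer_annulus O (2 ^+ m * 2 ^+ j.+1)).

Let CQ0 : 0 < CQ. Proof. exact: lt_le_trans CQ1. Qed.
Let Q0 : 0 < Q. Proof. exact: lt_trans Q1. Qed.

(** The 2 serves the lower bound r / 2 for the length in the annulus, [exit_const] the upper bound
    for the length in the ball. The last term serves the measure: the trajectories fill at least
    4^-Q r^Q / (2 CQ) of the annulus, while the ball has measure at most CQ r^Q. *)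
Definition family_const : R := 2 + exit_const m + 2 * CQ ^+ 2 / 4^-1 `^ Q.

(** The two pieces of E that can meet the annulus have measure at most CQ e r^Q each, together half
    of the lower bound 4^-Q r^Q / CQ for the annulus. *)
Let e : R := 4^-1 `^ Q / (4 * CQ ^+ 2).

Let p0 : 0 < (4^-1 : R) `^ Q. Proof. by rewrite powR_gt0. Qed.

Let e0 : 0 < e. Proof. by rewrite divr_gt0// mulr_gt0// exprn_gt0. Qed.

Let e1 : e < 1.
Proof.
rewrite ltr_pdivrMr ?mulr_gt0 ?exprn_gt0// mul1r; apply: (@le_lt_trans _ _ (1 `^ Q)).
  apply: ge0_ler_powR; rewrite ?nnegrE ?(ltW Q0)//.
  by rewrite invf_le1// ler1n.
rewrite powR1; have : 1 <= CQ ^+ 2 by rewrite exprn_ege1.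
lra.
Qed.

Let ec0 : 0 < exit_const m :> R.
Proof. by rewrite mulr_gt0 ?exprn_gt0// ltr0n. Qed.

Let K0 : 0 < 2 * CQ ^+ 2 / 4^-1 `^ Q.
Proof. by rewrite divr_gt0// mulr_gt0// exprn_gt0. Qed.

Let K2 : 2 <= family_const.
Proof. by rewrite /family_const; move: ec0 K0; lra. Qed.

Let fc0 : 0 < family_const. Proof. exact: lt_le_trans K2. Qed.

Lemma exists_annulus_point : exists j0, forall j, (j0 <= j)%N -> exists2 q, An j q & ~ E q.
Proof.
have d0 : 0 < annulus_density Q CQ / 2 by rewrite divr_gt0// annulus_density_gt0.
have [k Hk] := exceptional_content_small exc ltr01 d0; exists k => j /Hk.
set q := 2 ^+ m * 2 ^+ j.+1; have q0 : 0 < q by rewrite mulr_gt0 ?exprn_gt0.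
have aQ : 0 < (1 : R) <= Q by rewrite ltr01 ltW.
move=> h; apply: contrapT => nq.
have AE : outer_annulus O q `<=` E `&` outer_annulus O q.
  by move=> x Ax; split=> //; apply: contrapT => nEx; apply: nq; exists x.
have := hausdorff_content_annulus_ge Q1 CQ1 CP0 lam1 mmu amu pmu unb O aQ q0.
move=> /le_trans /(_ (hausdorff_content_le 1 AE)) /le_trans /(_ h).
rewrite lee_fin leNgt => /negP; apply; rewrite ltr_pM2r ?powR_gt0//.
by move: d0; lra.
Qed.

(** The annulus lies in the union of two neighbouring dyadic annuli. Off E it is covered by
    trajectories, and E has small 1-content there, hence small measure by
    [mu_le_hausdorff_content]. *)
Lemma mu_annulus_trajectories (Gam : set (R -> X)) j0 :
  (forall j x, (j0 <= j)%N -> An j x -> ~ E x -> trajectories Gam x) ->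
  \forall r \near +oo%R, ((family_const^-1)%:E * mu (ball O r) <=
     mu (inner_annulus O r `&` trajectories Gam))%E.
Proof.
move=> HT; have [k1 Hk1] := exceptional_content_small exc ltr01 e0.
pose k := maxn j0 k1; pose a : R := 2 ^+ m * 2 ^+ k.+1.
have a0 : 0 < a by rewrite mulr_gt0 ?exprn_gt0.
exists (2 * a); split; first exact: num_real.
move=> r ar; have r0 : 0 < r by apply: lt_trans ar; rewrite mulr_gt0.
have ar2 : a <= r / 2 by rewrite ler_pdivlMr// mulrC ltW.
have [n /andP[nr rn]] := dyadic_floor a0 ar2.
pose i := (k + n)%N; pose b : R := 2 ^+ m * 2 ^+ i.+1.
have bE : b = a * 2 ^+ n by rewrite /b /a /i -addSn exprD mulrA.
have b2 : 2 ^+ m * 2 ^+ i.+2 = 2 * b by rewrite /b (exprS 2 i.+1); ring.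
have br : b <= r / 2 by rewrite bE.
have rb : r < 4 * b by move: rn; rewrite exprS bE; lra.
have ki : (k <= i)%N by exact: leq_addr.
have [j0i k1i] : (j0 <= i)%N /\ (k1 <= i)%N.
  by move: ki; rewrite geq_max => /andP[].
set TT := trajectories Gam.
have sub : inner_annulus O r `<=` (inner_annulus O r `&` TT) `|`
    ((E `&` An i) `|` (E `&` An i.+1)).
  move=> x Ax; have Ax' : (An i `|` An i.+1) x.
    move: Ax; rewrite /inner_annulus !ballEmdist/= => -[xr /negP]; rewrite -leNgt => rx.
    have [xb|bx] := ltP (mdist O x) (2 * b).
      by left; apply/outer_annulusP; rewrite -/b xb (le_trans br).
    by right; apply/outer_annulusP; rewrite b2 bx/=; lra.
  have [Ex|nEx] := pselect (E x).
    by right; case: Ax'; [left|right].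
  left; split => //; case: Ax' => Ax'; first exact: HT Ax' nEx.
  by apply: HT Ax' nEx; exact: leqW.
have small j : (k1 <= j)%N -> 2 ^+ m * 2 ^+ j.+1 <= r ->
    (mu (E `&` An j) <= (CQ * e * r `^ Q)%:E)%E.
  move=> k1j jr; have h := Hk1 j k1j.
  have h' : (hausdorff_content 1 (E `&` An j) <= (e * r)%:E)%E.
    apply: le_trans h _; rewrite lee_fin ler_pM2l//.
    by rewrite powRr1 ?mulr_ge0 ?exprn_ge0.
  have lt : (hausdorff_content 1 (E `&` An j) < (r `^ 1)%:E)%E.
    apply: le_lt_trans h' _; rewrite lte_fin powRr1 ?(ltW r0)//.
    by rewrite gtr_pMl.
  have aQ : 0 < (1 : R) <= Q by rewrite ltr01 ltW.
  apply: le_trans (mu_le_hausdorff_content CQ1 amu aQ r0 lt) _.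
  have c0 : 0 <= CQ * r `^ (Q - 1) by rewrite mulr_ge0 ?powR_ge0 ?(ltW CQ0).
  apply: le_trans (lee_wpmul2l _ h') _; first by rewrite lee_fin.
  rewrite -EFinM lee_fin le_eqVlt; apply/orP; left; apply/eqP.
  have -> : r `^ Q = r `^ (Q - 1) * r.
    rewrite -{3}(powRr1 (ltW r0)) -powRD ?subrK//.
    by apply/implyP => _; rewrite gt_eqF.
  by ring.
have low : ((4^-1 `^ Q * r `^ Q / CQ)%:E <= mu (inner_annulus O r))%E.
  have r20 : 0 < r / 2 by rewrite divr_gt0.
  have := mu_outer_annulus_ge Q1 CQ1 CP0 lam1 mmu amu pmu unb O r20.
  have -> : outer_annulus O (r / 2) = inner_annulus O r.
    by rewrite /outer_annulus /inner_annulus mulrC divfK.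
  have -> : r / 2 / 2 = 4^-1 * r by lra.
  by rewrite powRM ?(ltW r0).
have sum : (mu (inner_annulus O r) <=
    mu (inner_annulus O r `&` TT) + ((CQ * e * r `^ Q)%:E + (CQ * e * r `^ Q)%:E))%E.
  apply: le_trans (le_outer_measure mu _ _ sub) _.
  apply: le_trans (outer_measureU2 _ _ _) _; rewrite leeD2l//.
  apply: le_trans (outer_measureU2 _ _ _) _; apply: leeD; apply: small => //.
  - by rewrite -/b (le_trans br)// ler_piMr ?(ltW r0)// invf_le1// ler1n.
  - exact: leqW.
  - by rewrite b2; lra.
have /andP[_ up] := amu O r0.
have fin : mu (inner_annulus O r `&` TT) \is a fin_num.
  rewrite ge0_fin_numE ?outer_measure_ge0//; apply: (@le_lt_trans _ _ (mu (ball O r))).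
    by apply: le_outer_measure => x [[]].
  exact: le_lt_trans up (ltry _).
have := le_trans low sum; rewrite -(fineK fin) -!EFinD lee_fin => H.
have rQ : 0 < r `^ Q by rewrite powR_gt0.
apply: (@le_trans _ _ (family_const^-1%:E * (CQ * r `^ Q)%:E)%E).
  by apply: lee_wpmul2l up; rewrite lee_fin invr_ge0 ltW.
rewrite -EFinM lee_fin; apply: (@le_trans _ _ (4^-1 `^ Q * r `^ Q / CQ / 2)).
  rewrite ler_pdivrMl// ; apply: (@le_trans _ _
      ((2 * CQ ^+ 2 / 4^-1 `^ Q) * (4^-1 `^ Q * r `^ Q / CQ / 2))).
    by rewrite le_eqVlt; apply/orP; left; apply/eqP; field; rewrite !gt_eqF.
  rewrite ler_wpM2r//; last by rewrite /family_const; move: ec0; lra.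
  by rewrite !divr_ge0 ?mulr_ge0 ?(ltW p0) ?(ltW rQ) ?(ltW CQ0).
have He : CQ * e * r `^ Q = 4^-1 `^ Q * r `^ Q / CQ / 4.
  by rewrite /e; field; rewrite gt_eqF.
move: H; rewrite He; move: (_ / CQ) => z; lra.
Qed.

Lemma limit_curve_family_of_limit_off c : limit_along_set O u c (~` E) ->
  limit_curve_family O u c mu family_const.
Proof.
move=> lc; have [j0 Hj0] := exists_annulus_point.
have /choice [q Hq] : forall k, exists q, An (j0 + k)%N q /\ ~ E q.
  by move=> k; have [|q Aq nEq] := Hj0 (j0 + k)%N; [exact: leq_addr|exists q].
(* Bounding the norms of the starting points makes the threshold on r in the length estimates
   uniform over the family. *)
pose M : R := 2 * (2 ^+ m * 2 ^+ j0.+1).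
pose Gam := [set gamma : R -> X | [/\ infinite_curve gamma, limit_along_curve u c gamma,
  mdist O (gamma 0) < M &
  forall s r, 0 <= s -> mdist O (gamma s) < r -> s <= exit_const m / 2 * r]].
(* A fixed sequence of good points with one entry replaced by x gives a curve of the family through
   x. *)
have traj j x : (j0 <= j)%N -> An j x -> ~ E x -> trajectories Gam x.
  move=> j0j Ax nEx; pose p k := if k == (j - j0)%N then x else q k.
  have Ap k : An (j0 + k)%N (p k).
    rewrite /p; case: eqP => [->|_]; last by case: (Hq k).
    by rewrite subnKC.
  have nEp k : ~ E (p k) by rewrite /p; case: eqP => // _; case: (Hq k).
  have [g [ig g0 gp lg eg]] := curve_through m0 exc Ap nEp lc.
  have [s s0 gs] := gp (j - j0)%N.
  exists g; last by exists s; rewrite /= ?in_itv/= ?s0// gs /p eqxx.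
  split => //; rewrite g0; have := Ap 0%N; rewrite addn0.
  by move=> /outer_annulusP/andP[].
exists Gam; split; [by move=> g []|by move=> g []|].
have near_r : \forall r \near +oo%R, 2 * M < r.
  by exists (2 * M); split; first exact: num_real.
have M0 : 0 < M by rewrite !mulr_gt0 ?exprn_gt0.
apply: filterS2 near_r (mu_annulus_trajectories traj) => r Mr Hmu.
have r0 : 0 < r by apply: lt_trans Mr; rewrite mulr_gt0.
have K1 : 1 <= family_const by apply: le_trans K2; rewrite ler1n.
have Ki (y : \bar R) : (0 <= y)%E -> ((family_const^-1)%:E * y <= y)%E.
  by move=> y0; rewrite -[leRHS]mul1e; apply: lee_wpmul2r; rewrite // lee_fin invf_le1.
have KK (y : \bar R) : (0 <= y)%E -> (y <= family_const%:E * y)%E.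
  by move=> y0; rewrite -[leLHS]mul1e; apply: lee_wpmul2r; rewrite // lee_fin.
have ab : inner_annulus O r `&` trajectories Gam `<=` ball O r `&` trajectories Gam.
  by move=> x [[Bx _] Tx].
have KB : (mu (ball O r) <= family_const%:E * mu (inner_annulus O r `&` trajectories Gam))%E.
  by move: Hmu; rewrite lee_pdivrMl.
split.
- split.
    apply: le_trans (Ki _ (outer_measure_ge0 mu _)) _; exact: le_outer_measure.
  by apply: le_trans KB; apply: le_outer_measure => x [].
- split => //; apply: (@le_trans _ _ (mu (ball O r))); last first.
    by apply: KK; exact: outer_measure_ge0.
  by apply: le_outer_measure => x [[]].
move=> g [ig lg g0 eg].
have lb : (length_in g (ball O r) <= (exit_const m / 2 * r)%:E)%E.
  apply: length_in_ball_le => //.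
    by rewrite mulr_ge0 ?divr_ge0 ?(ltW ec0) ?(ltW r0).
  by move=> s s0 /(eg s r s0).
have la : ((r / 2)%:E <= length_in g (inner_annulus O r))%E.
  by apply: length_in_annulus_ge => //; lra.
have lab := length_in_annulus_le O r ig.
have la0 : (0 <= length_in g (inner_annulus O r))%E.
  by apply: le_trans la; rewrite lee_fin divr_ge0// ltW.
split; split.
- exact: le_trans (Ki _ la0) lab.
- apply: le_trans lb _; apply: (@le_trans _ _ (family_const%:E * (r / 2)%:E)%E).
    rewrite -EFinM lee_fin [leLHS](_ : _ = exit_const m * (r / 2)); last by ring.
    by rewrite ler_pM2r ?divr_gt0// /family_const; move: K0; lra.
  by apply: lee_wpmul2l la; rewrite lee_fin ltW.
- apply: le_trans la; rewrite -EFinM lee_fin mulrC ler_pM2l// lef_pV2 ?posrE//.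
apply: le_trans lab (le_trans lb _); rewrite -EFinM lee_fin ler_pM2r//.
by rewrite /family_const; move: K0 ec0; lra.
Qed.

End curve_family.

(** If no trajectory met the annulus, the comparison of measures would make the measure of a ball
    zero; so the family has a curve. *)
Lemma limit_some_curve_of_limit_curve_family {R : realType} {X : completeMetricType R}
    (mu : {outer_measure set X -> \bar R}) (Q CQ K : R) (O : X) u c : 1 <= CQ ->
  ahlfors_regular mu Q CQ -> 0 < K ->
  limit_curve_family O u c mu K -> limit_some_curve u c.
Proof.
move=> CQ1 amu K0 [Gam [iG lG [M [_ HM]]]].
have r0 : 0 < `|M| + 1 by rewrite ltr_wpDl.
have Mr : M < `|M| + 1 by rewrite ltr_pwDr// ler_norm.
have [_ [h _] _] := HM _ Mr.
have /andP[low _] := amu O _ r0.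
have [[x [_ [g Gg _]]]|ne] := pselect (exists x, (inner_annulus O (`|M| + 1) `&` trajectories Gam) x).
  by exists g; [exact: iG|exact: lG].
move: h; rewrite (_ : _ `&` _ = set0); last first.
  by apply/seteqP; split => // x Hx; apply: ne; exists x.
rewrite outer_measure0 leNgt mule_gt0 ?lte_fin ?invr_gt0//.
by apply: lt_le_trans low; rewrite lte_fin divr_gt0 ?powR_gt0// (lt_le_trans _ CQ1).
Qed.

Theorem theorem1p2 (R : realType) (Q CQ CP lam : R)
    (hQ : 1 < Q) (hCQ : 1 <= CQ) (hCP : 0 < CP) (hlam : 1 <= lam) :
  exists2 K : R, 0 < K &
  forall (X : completeMetricType R) (mu : {outer_measure set X -> \bar R})
    (O : X),
  metric_measure_space mu ->
  unbounded_set [set: X] ->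
  ahlfors_regular mu Q CQ ->
  poincare mu Q CP lam ->
  forall u : X -> R, homogeneous_newtonian mu Q u ->
  (forall c : \bar R,
    [<-> limit_some_curve u c;
         limit_off_thin_set O u c Q;
         limit_on_thick_set O u c Q;
         limit_curve_family O u c mu K]) /\
  (forall c1 c2 : \bar R,
    [\/ limit_some_curve u c1, limit_off_thin_set O u c1 Q,
        limit_on_thick_set O u c1 Q | limit_curve_family O u c1 mu K] ->
    [\/ limit_some_curve u c2, limit_off_thin_set O u c2 Q,
        limit_on_thick_set O u c2 Q | limit_curve_family O u c2 mu K] ->
    c1 = c2).
Proof.
have Q0 : 0 < Q by exact: lt_trans hQ.
have CQ0 : 0 < CQ by exact: lt_le_trans hCQ.
have lam0 : 0 < lam by exact: lt_le_trans hlam.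
pose lev := good_level Q CQ CP.
have lev0 : 0 < lev `^ Q by rewrite powR_gt0// good_level_gt0.
pose B : R := 10 * lam * (128 * lam).
have B0 : 0 < B by rewrite /B !mulr_gt0.
have BQ : 0 < 2 * CQ * B `^ Q by rewrite !mulr_gt0 ?powR_gt0.
(* The depth, and with it K, is fixed by Q, CQ, CP and lam before the space is introduced. *)
have [m m8 hm] := exists_log_depth hQ (divr_gt0 lev0 BQ).
have m0 : (0 < m)%N by apply: leq_trans m8.
have mdepth : 2 * CQ * (10 * lam * (2 / m%:R) * (128 * lam)) `^ Q * (m%:R + 2) <= lev `^ Q.
  have -> : 10 * lam * (2 / m%:R) * (128 * lam) = B * (2 / m%:R) by rewrite /B; ring.
  rewrite (powRM Q (ltW B0)) ?divr_ge0//.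
  have -> : 2 * CQ * (B `^ Q * (2 / m%:R) `^ Q) * (m%:R + 2) =
    2 * CQ * B `^ Q * ((2 / m%:R) `^ Q * (m%:R + 2)) by ring.
  by rewrite mulrC -ler_pdivlMr.
have C1 : 1 <= 2 ^+ m :> R by rewrite exprn_ege1// ler1n.
pose K := family_const Q CQ m.
have K0 : 0 < K.
  rewrite /K /family_const addr_gt0// ?addr_gt0// ?divr_gt0 ?mulr_gt0 ?exprn_gt0 ?powR_gt0// ltr0n.
  exact: m0.
exists K => // X mu O mmu unb amu pmu u Nu.
have [E [omega exc]] := exists_exceptional_set hQ hCQ hCP hlam mmu amu pmu O m8 mdepth Nu.
have tE : thin Q O E.
  by exists (2 ^+ m) => // alpha /andP[al0 _]; exact: (exceptional_thin exc).
have thickC F := thin_setC_thick hQ hCQ hCP hlam mmu amu pmu unb (O := O) (E := F).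
have I_off c := limit_off_of_limit_some_curve exc (c := c).
have III_off c := limit_off_of_limit_on_thick_set exc (c := c) hQ.
(* The thin set in II is arbitrary and unrelated to E; passing to its complement, which is thick,
   brings the limit back to E. *)
have II_III c : limit_off_thin_set O u c Q -> limit_on_thick_set O u c Q.
  by move=> [F tF lF]; exists (~` F) => //; exact: thickC.
have off_IV c := limit_curve_family_of_limit_off hQ hCQ hCP hlam mmu amu pmu unb m0
  exc (c := c).
have IV_I c := limit_some_curve_of_limit_curve_family hCQ amu K0 (O := O) (u := u) (c := c).
split=> [c|c1 c2 H1 H2].
  tfae.
  - by move=> /I_off lc; exists E.
  - exact: II_III.
  - by move=> /III_off /off_IV.
  - exact: IV_I.
(* Whatever c and the condition, the limit is taken off the same set E, whose complement is
   unbounded; uniqueness of limits concludes. *)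
have off c : [\/ limit_some_curve u c, limit_off_thin_set O u c Q,
    limit_on_thick_set O u c Q | limit_curve_family O u c mu K] ->
    limit_along_set O u c (~` E).
  by move=> [/I_off|/II_III/III_off|/III_off|/IV_I/I_off].
exact: (limit_off_exceptional_set_unique (thickC _ tE).1 (off _ H1) (off _ H2)).
Qed.
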